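(* Let $(\mathcal E,i)$ be a prop with $A_\infty$-multiplication and $\Phi:\mathcal E\to\mathrm{Ch}$ a functor. For any $n$ and $m$, there is a quasi-isomorphism of chain complexes $$\tilde\beta:C^n(\Phi)(m)\xrightarrow{\ \simeq\ }C^n(B(\Phi,\mathcal E,\mathcal E))(m)$$ natural both with respect to natural transformations $\Phi\to\Phi'$ and with respect to functors $j:\mathcal E\to\mathcal E'$ with $i'=j\circ i:A_\infty\to\mathcal E'$. Moreover, $\tilde\beta$ is a right inverse to $C^n(\alpha)$, where $\alpha:B(\Phi,\mathcal E,\mathcal E)\to\Phi$ is the natural augmentation.
   Context: Conventions. $\mathrm{Ch}$ is the category of chain complexes over $\mathbb Z$ (usual Koszul signs). A dg-category is a category enriched in $\mathrm{Ch}$, with composition written $\mathcal E(m,n)\otimes\mathcal E(n,p)\to\mathcal E(m,p)$. A dg-functor $\Phi:\mathcal E\to\mathrm{Ch}$ (simply ''functor'') has structure chain maps $c_\Phi:\Phi(m)\otimes\mathcal E(m,n)\to\Phi(n)$. A prop is a symmetric monoidal dg-category with objects $0,1,2,\dots$ and monoidal product $+$ on objects. The prop $A_\infty$. $A_\infty(m,n)$ is the chain complex generated by isomorphism classes of oriented planar forests consisting of $n$ trees, each with one root (outgoing leaf) and at least one incoming leaf, all vertices of valence $\ge 3$ (the tree with no vertex is allowed), with incoming leaves labeled $1,\dots,m$ and roots labeled $1,\dots,n$. An orientation of a graph with vertex set $V$ and half-edge set $H$ is a unit vector in $\det(\mathbb R(V\sqcup H))$, and $-1$ is identified with reversing orientation.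 The degree is $\sum_v(|v|-3)$. The differential of $G$ is the sum of all blow-ups, i.e. $\sum\tilde G$ over pairs $(\tilde G,e)$, $e$ an internal edge with $\tilde G/e=G$; if $e=\{h_1,h_2\}$ joins $v_1,v_2$, the orientation $v_1\wedge v_2\wedge h_1\wedge h_2\wedge x$ of $\tilde G$ collapses to $v\wedge x$, $v$ the new vertex. Composition grafts roots to leaves with the same label, wedging orientations; the monoidal structure is disjoint union. A prop with $A_\infty$-multiplication is a pair $(\mathcal E,i)$ with $\mathcal E$ a prop and $i:A_\infty\to\mathcal E$ a symmetric monoidal dg-functor which is the identity on objects. Hochschild complex. Let $l_n$ ($n\ge1$) be the graph with one white vertex $w$ and $n$ leaves $h_1,\dots,h_n$ in this cyclic order, $h_1$ being the distinguished start leaf, with orientation $w\wedge h_1\wedge\dots\wedge h_n$ and degree $n-1$; $L_n=\mathbb Z l_n$. Its differential is the sum of its blow-ups: for $2\le r\le n$, $1\le j\le n$, the leaves $h_j,\dots,h_{j+r-1}$ (indices mod $n$) are moved to a new black vertex joined to $w$ by a new edge (which becomes the start half-edge at $w$ if $h_1$ is among the moved leaves), oriented so that collapsing the new edge (by the rule above) returns the orientation of $l_n$. Cutting around $w$, each blow-up is a forest in $A_\infty(n,k)$, $k=n+1-r$, grafted on $l_k$ (orientation of the forest wedge that of $l_k$), so the differential is written $d_L(l_n)=\sum_{k<n}f_{n,k}\otimes l_k$ with $f_{n,k}\in A_\infty(n,k)$. For a functor $\Phi:\mathcal E\to\mathrm{Ch}$, its Hochschild complex is the functor $C(\Phi):\mathcal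 E\to\mathrm{Ch}$ with $$C(\Phi)(m)=\bigoplus_{n\ge1}\Phi(n+m)\otimes L_n,\quad d(x\otimes l_n)=d_\Phi x\otimes l_n+(-1)^{|x|}\sum_{k<n}\Phi(i(f_{n,k})+id_m)(x)\otimes l_k,$$ and a morphism $f$ of $\mathcal E$ acting by $\Phi(id_n+f)$ on the first factor (with Koszul sign $(-1)^{(n-1)|f|}$). $C^n(\Phi)$ is the $n$-fold iterate. Bar construction. $B(\Phi,\mathcal E,\mathcal E):\mathcal E\to\mathrm{Ch}$ is the functor with value at $m$ equal to $\bigoplus_{p\ge0}B_p$, $B_p=\bigoplus_{m_0,\dots,m_p}\Phi(m_0)\otimes\mathcal E(m_0,m_1)\otimes\dots\otimes\mathcal E(m_{p-1},m_p)\otimes\mathcal E(m_p,m)$, with differential $(-1)^p\delta+\sum_{i=0}^p(-1)^id_i$ on $B_p$, $\delta$ the tensor product differential and $d_i$ the face maps given by the action of the first morphism on $\Phi$ ($i=0$) and composition of consecutive morphisms ($i>0$). The augmentation $\alpha$ is $a\otimes c\mapsto\Phi(c)(a)$ on $B_0$ and $0$ on $B_p$ for $p>0$. *)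

(* Defs.v *)
From HB Require Import structures.
From mathcomp Require Import all_boot all_order all_algebra.
From mathcomp Require Import boolp.
From mathcomp Require Import freeg.

Set Implicit Arguments.
Unset Strict Implicit.
Unset Printing Implicit Defensive.

Import GRing.Theory.
Local Open Scope ring_scope.

(* (-1)^i x *)
Definition ksgn (V : zmodType) (i : int) (x : V) : V :=
  if odd `|i|%N then - x else x.

Record gcx := Gcx {
  gr :> int -> zmodType;
  dif : forall i j : int, i = j + 1 -> gr i -> gr j }.
Arguments dif {g i j}.

Definition add_map (U V : zmodType) (f : U -> V) : Prop :=
  forall x y, f (x + y) = f x + f y.

Definition is_complex (C : gcx) : Prop :=
  (forall (i j : int) (e : i = j + 1), add_map (@dif C i j e)) /\
  (forall (i j k : int) (e : i = j + 1) (e' : j = k + 1) (x : C i),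
     dif e' (dif e x) = 0).

Definition gmap (C D : gcx) := forall i : int, C i -> D i.

Definition chain_map (C D : gcx) (f : gmap C D) : Prop :=
  (forall i : int, add_map (f i)) /\
  (forall (i j : int) (e : i = j + 1) (x : C i), f j (dif e x) = dif e (f i x)).

Definition cycle (C : gcx) (i : int) (x : C i) : Prop :=
  forall (j : int) (e : i = j + 1), dif e x = 0.

Definition homologous (C : gcx) (i : int) (x y : C i) : Prop :=
  exists (k : int) (e : k = i + 1) (b : C k), x - y = dif e b.

Definition quasi_iso (C D : gcx) (f : gmap C D) : Prop :=
  [/\ is_complex C, is_complex D, chain_map f &
    forall i : int,
      (forall x y : C i, cycle x -> cycle y ->
         homologous (f i x) (f i y) -> homologous x y) /\
      (forall z : D i, cycle z -> exists2 x : C i, cycle x &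
         homologous (f i x) z)].

(* Composition is in diagrammatic order.  An operation landing in degree      *)
(* i + j takes the target degree k and a proof of i + j = k, so that no       *)
(* transport between the components of a graded group is needed.              *)
Record dgcat_data := DgcatData {
  mor : nat -> nat -> gcx;
  idm : forall m, mor m m 0;
  comp : forall m n p (i j k : int),
    i + j = k -> mor m n i -> mor n p j -> mor m p k }.
Arguments mor : clear implicits.
Arguments idm {d}.
Arguments comp {d m n p i j k}.

Record is_dgcat (E : dgcat_data) : Prop := IsDgcat {
  hom_complex : forall m n, is_complex (mor E m n);
  comp_addl : forall m n p (i j k : int) (e : i + j = k) (g : mor E n p j),
    add_map (fun f : mor E m n i => comp e f g);
  comp_addr : forall m n p (i j k : int) (e : i + j = k) (f : mor E m n i),
    add_map (fun g : mor E n p j => comp e f g);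
  comp_dif : forall m n p (i j k i' j' k' : int) (e : i + j = k)
      (ei : i = i' + 1) (ej : j = j' + 1) (ek : k = k' + 1)
      (e1 : i' + j = k') (e2 : i + j' = k')
      (f : mor E m n i) (g : mor E n p j),
    dif ek (comp e f g) = comp e1 (dif ei f) g + ksgn i (comp e2 f (dif ej g));
  idm_cycle : forall m, cycle (idm m : mor E m m 0);
  comp_idl : forall m n (i : int) (e : 0 + i = i) (f : mor E m n i),
    comp e (idm m) f = f;
  comp_idr : forall m n (i : int) (e : i + 0 = i) (f : mor E m n i),
    comp e f (idm n) = f;
  comp_assoc : forall m n p q (i j k ij jk t : int)
      (e1 : i + j = ij) (e2 : ij + k = t) (e3 : j + k = jk) (e4 : i + jk = t)
      (f : mor E m n i) (g : mor E n p j) (h : mor E p q k),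
    comp e2 (comp e1 f g) h = comp e4 f (comp e3 g h) }.

(* Right action maps Phi(m) (x) E(m,n) -> Phi(n).  The laws are kept apart from *)
(* the data, so that the constructions below apply to data and can be iterated; *)
(* that their values are complexes is required by quasi_iso.                    *)
Record fun_data (E : dgcat_data) := FunData {
  fob :> nat -> gcx;
  act : forall m n (i j k : int),
    i + j = k -> fob m i -> mor E m n j -> fob n k }.
Arguments act {E f m n i j k}.

Record is_dgfun (E : dgcat_data) (Phi : fun_data E) : Prop := IsDgfun {
  fob_complex : forall m, is_complex (Phi m);
  act_addl : forall m n (i j k : int) (e : i + j = k) (f : mor E m n j),
    add_map (fun x : Phi m i => act e x f);
  act_addr : forall m n (i j k : int) (e : i + j = k) (x : Phi m i),
    add_map (fun f : mor E m n j => act e x f);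
  act_dif : forall m n (i j k i' j' k' : int) (e : i + j = k)
      (ei : i = i' + 1) (ej : j = j' + 1) (ek : k = k' + 1)
      (e1 : i' + j = k') (e2 : i + j' = k') (x : Phi m i) (f : mor E m n j),
    dif ek (act e x f) = act e1 (dif ei x) f + ksgn i (act e2 x (dif ej f));
  act_id : forall m (i : int) (e : i + 0 = i) (x : Phi m i),
    act e x (idm m) = x;
  act_comp : forall m n p (i j k ij jk t : int)
      (e1 : i + j = ij) (e2 : ij + k = t) (e3 : j + k = jk) (e4 : i + jk = t)
      (x : Phi m i) (f : mor E m n j) (g : mor E n p k),
    act e2 (act e1 x f) g = act e4 x (comp e3 f g) }.

Record dgfun (E : dgcat_data) := Dgfun {
  dgfun_data :> fun_data E;
  dgfunP : is_dgfun dgfun_data }.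

(* The two functors may live on different dg-categories, for naturality with  *)
(* respect to the dg-category.                                                *)
Definition fmap (E E' : dgcat_data) (Phi : fun_data E) (Psi : fun_data E') :=
  forall m, gmap (Phi m) (Psi m).

Definition natural_transf (E : dgcat_data) (Phi Psi : fun_data E)
    (th : fmap Phi Psi) : Prop :=
  (forall m, chain_map (th m)) /\
  (forall m n (i j k : int) (e : i + j = k) (x : Phi m i) (f : mor E m n j),
     th n k (act e x f) = act e (th m i x) f).

Definition cmap (E E' : dgcat_data) :=
  forall m n, gmap (mor E m n) (mor E' m n).

Record is_dgfunctor (E E' : dgcat_data) (j : cmap E E') : Prop := IsDgfunctor {
  cmap_chain : forall m n, chain_map (j m n);
  cmap_id : forall m, j m m 0 (idm m) = idm m;
  cmap_comp : forall m n p (a b c : int) (e : a + b = c)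
      (f : mor E m n a) (g : mor E n p b),
    j m p c (comp e f g) = comp e (j m n a f) (j n p b g) }.

Definition id_cmap (E : dgcat_data) : cmap E E := fun m n i f => f.

Definition restr_data (E E' : dgcat_data) (j : cmap E E') (Phi : fun_data E') :
    fun_data E :=
  @FunData E (fob Phi) (fun m n a b c e x f => act e x (j m n b f)).

Lemma restr_is_dgfun (E E' : dgcat_data) (j : cmap E E') (Phi : fun_data E') :
  is_dgfunctor j -> is_dgfun Phi -> is_dgfun (restr_data j Phi).
Proof.
case=> jC j1 jM [Pc Pl Pr Pd Pi Pm]; split=> //=.
- by move=> m n a b c e x f g /=; rewrite (jC m n).1; exact: Pr.
- move=> m n a b c a' b' c' e ea eb ec e1 e2 x f.
  by rewrite (jC m n).2; exact: Pd.
- by move=> m a e x; rewrite j1; exact: Pi.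
- move=> m n p a b c ab bc t e1 e2 e3 e4 x f g.
  by rewrite (jM _ _ _ _ _ _ e3); exact: Pm.
Qed.

Definition restr (E E' : dgcat_data) (j : cmap E E') (hj : is_dgfunctor j)
    (Phi : dgfun E') : dgfun E :=
  Dgfun (restr_is_dgfun hj (dgfunP Phi)).

Definition restr_id (E E' : dgcat_data) (j : cmap E E') (Phi : fun_data E') :
  fmap (restr_data j Phi) Phi := fun m i x => x.

Record prop_data := PropData {
  pcat :> dgcat_data;
  mon : forall m n m' n' (i j k : int), i + j = k ->
    mor pcat m n i -> mor pcat m' n' j -> mor pcat (m + m') (n + n') k;
  sym : forall m n, mor pcat (m + n) (n + m) 0 }.
Arguments mon {p m n m' n' i j k}.
Arguments sym {p}.

Definition hcast (E : dgcat_data) m m' n n' (em : m = m') (en : n = n')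
    (i : int) (f : mor E m n i) : mor E m' n' i :=
  ecast x (mor E x n' i) em (ecast y (mor E m y i) en f).

(* Props are strict symmetric monoidal; the casts are along the associativity *)
(* and unit equalities of + on objects.                                       *)
Record is_prop (E : prop_data) : Prop := IsProp {
  prop_dgcat : is_dgcat E;
  mon_addl : forall m n m' n' (i j k : int) (e : i + j = k) (g : mor E m' n' j),
    add_map (fun f : mor E m n i => mon e f g);
  mon_addr : forall m n m' n' (i j k : int) (e : i + j = k) (f : mor E m n i),
    add_map (fun g : mor E m' n' j => mon e f g);
  mon_dif : forall m n m' n' (i j k i' j' k' : int) (e : i + j = k)
      (ei : i = i' + 1) (ej : j = j' + 1) (ek : k = k' + 1)
      (e1 : i' + j = k') (e2 : i + j' = k')
      (f : mor E m n i) (g : mor E m' n' j),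
    dif ek (mon e f g) = mon e1 (dif ei f) g + ksgn i (mon e2 f (dif ej g));
  mon_id : forall m n (e : 0 + 0 = 0 :> int),
    mon e (idm m) (idm n) = idm (m + n)%N :> mor E _ _ 0;
  mon_comp : forall m n p m' n' p' (a b c d ab cd ac bd t : int)
      (e1 : a + b = ab) (e2 : c + d = cd) (e3 : ab + cd = t)
      (e4 : a + c = ac) (e5 : b + d = bd) (e6 : ac + bd = t)
      (f : mor E m n a) (g : mor E m' n' b)
      (f' : mor E n p c) (g' : mor E n' p' d),
    comp e3 (mon e1 f g) (mon e2 f' g') =
    ksgn (b * c) (mon e6 (comp e4 f f') (comp e5 g g'));
  mon_assoc : forall m n m' n' m'' n'' (i j k ij jk t : int)
      (e1 : i + j = ij) (e2 : ij + k = t) (e3 : j + k = jk) (e4 : i + jk = t)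
      (f : mor E m n i) (g : mor E m' n' j) (h : mor E m'' n'' k),
    hcast (addnA m m' m'') (addnA n n' n'') (mon e4 f (mon e3 g h)) =
    mon e2 (mon e1 f g) h;
  mon_0l : forall m n (i : int) (e : 0 + i = i) (f : mor E m n i),
    mon e (idm 0%N) f = f;
  mon_0r : forall m n (i : int) (e : i + 0 = i) (f : mor E m n i),
    hcast (addn0 m) (addn0 n) (mon e f (idm 0%N)) = f;
  sym_cycle : forall m n, cycle (sym m n : mor E _ _ 0);
  sym_nat : forall m n m' n' (i j k : int) (e1 : i + j = k) (e2 : j + i = k)
      (e3 : k + 0 = k) (e4 : 0 + k = k)
      (f : mor E m n i) (g : mor E m' n' j),
    comp e3 (mon e1 f g) (sym n n') =
    ksgn (i * j) (comp e4 (sym m m') (mon e2 g f));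
  sym_invol : forall m n (e : 0 + 0 = 0 :> int),
    comp e (sym m n) (sym n m) = idm (m + n)%N :> mor E _ _ 0;
  sym_hexagon : forall m n p (e : 0 + 0 = 0 :> int),
    comp e (hcast (esym (addnA m n p)) (esym (addnA n m p))
              (mon e (sym m n) (idm p)))
           (mon e (idm n) (sym m p)) =
    hcast erefl (esym (addnA n p m)) (sym m (n + p)%N) :> mor E _ _ 0 }.

Record dgprop := Dgprop {
  dgprop_data :> prop_data;
  dgpropP : is_prop dgprop_data }.

Record is_prop_functor (E E' : prop_data) (j : cmap E E') : Prop :=
  IsPropFunctor {
    pf_dgfunctor : is_dgfunctor j;
    pf_mon : forall m n m' n' (a b c : int) (e : a + b = c)
        (f : mor E m n a) (g : mor E m' n' b),
      j _ _ c (mon e f g) = mon e (j _ _ a f) (j _ _ b g);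
    pf_sym : forall m n, j _ _ 0 (sym m n) = sym m n }.

(* Trees are read from the root up, the children of a vertex being listed in  *)
(* the planar order; leaves are labelled from 0.  A forest is the list of its *)
(* trees, the i-th one having the root labelled i.                            *)
Inductive ptree := Leaf of nat | Node of seq ptree.

Fixpoint ptree_enc (t : ptree) : GenTree.tree nat :=
  match t with
  | Leaf i => GenTree.Leaf i
  | Node ts => GenTree.Node 0 (map ptree_enc ts)
  end.

Fixpoint ptree_dec (t : GenTree.tree nat) : ptree :=
  match t with
  | GenTree.Leaf i => Leaf i
  | GenTree.Node _ ts => Node (map ptree_dec ts)
  end.

Lemma ptree_encK : cancel ptree_enc ptree_dec.
Proof.
rewrite /cancel; fix IH 1; case=> [i|ts] //=; congr Node.
by elim: ts => [|t ts IHts] //=; rewrite IH IHts.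
Qed.

HB.instance Definition _ := Equality.copy ptree (can_type ptree_encK).
HB.instance Definition _ := Choice.copy ptree (can_type ptree_encK).

Definition forest := seq ptree.

Fixpoint leaves (t : ptree) : seq nat :=
  match t with
  | Leaf i => [:: i]
  | Node ts => flatten (map leaves ts)
  end.

(* A vertex with r children has valence r + 1.                                *)
Fixpoint valence_ge3 (t : ptree) : bool :=
  match t with
  | Leaf _ => true
  | Node ts => (2 <= size ts)%N && all valence_ge3 ts
  end.

Fixpoint tdeg (t : ptree) : nat :=
  match t with
  | Leaf _ => 0
  | Node ts => (size ts - 2) + sumn (map tdeg ts)
  end.

Definition is_forest (m n : nat) (k : int) (F : forest) : bool :=
  [&& size F == n, all valence_ge3 F,
      perm_eq (flatten (map leaves F)) (iota 0 m) &
      (sumn (map tdeg F))%:Z == k].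

Definition forest_of (m n : nat) (k : int) := {F : forest | is_forest m n k F}.

(******************************************************************************)
(*  Orientations                                                              *)
(*                                                                            *)
(*  The vertices and half-edges of a forest are named by letters (a, c), with *)
(*  a the address of a subtree (a = i :: p is the subtree reached from the    *)
(*  root of the tree i along the branches p) and                              *)
(*    (a, 0) the root vertex of the subtree at a,                             *)
(*    (a, 1) the outgoing half-edge of that vertex,                           *)
(*    (a, 2) the half-edge, at the vertex below, on which that subtree sits;  *)
(*  so a leaf at a which is not a whole tree is the half-edge (a, 2), and the *)
(*  edge below a vertex at a is {(a, 1), (a, 2)} when it is internal.  A tree *)
(*  without vertex has no letter.  An orientation is written as a word in     *)
(*  which each letter occurs exactly once, standing for the wedge product.    *)
(******************************************************************************)

Definition letter := (seq nat * nat)%type.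

Fixpoint inversions (s : seq nat) : nat :=
  match s with
  | [::] => 0
  | x :: s' => count (fun y => (y < x)%N) s' + inversions s'
  end.

(* The sign by which two orderings of the same letters differ.                *)
Definition word_sign (u v : seq letter) : int :=
  (-1) ^+ inversions [seq index x v | x <- u].

(* Puts the i-th list in the i-th branch above the current address.           *)
Definition branches (A : Type) (ws : seq (seq (seq nat * A))) :
    seq (seq nat * A) :=
  flatten [seq [seq (iw.1 :: x.1, x.2) | x <- iw.2] |
           iw <- zip (iota 0 (size ws)) ws].

(* The orientation chosen for each tree and forest: every vertex is followed  *)
(* by its outgoing and then its incoming half-edges in planar order.          *)
Fixpoint tword (t : ptree) : seq letter :=
  match t with
  | Leaf _ => [::]
  | Node ts => [:: ([::], 0%N), ([::], 1%N) &
                 [seq ([:: c], 2%N) | c <- iota 0 (size ts)]] ++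
               branches (map tword ts)
  end.

Definition fword (F : forest) : seq letter := branches (map tword F).

Fixpoint tleaves (t : ptree) : seq (seq nat * nat) :=
  match t with
  | Leaf i => [:: ([::], i)]
  | Node ts => branches (map tleaves ts)
  end.

(* The list of pairs (address of a leaf, label of that leaf).                 *)
Definition fleaves (F : forest) : seq (seq nat * nat) :=
  branches (map tleaves F).

Definition leaf_addr (F : forest) (i : nat) : seq nat :=
  let s := fleaves F in (nth ([::], 0%N) s (index i [seq x.2 | x <- s])).1.

Fixpoint tgraft (F : forest) (t : ptree) : ptree :=
  match t with
  | Leaf i => nth (Leaf 0) F i
  | Node ts => Node (map (tgraft F) ts)
  end.

(* The roots of F are grafted on the leaves of G.                             *)
Definition graft (F G : forest) : forest := map (tgraft F) G.

Definition graft_letter (G : forest) (x : letter) : letter :=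
  match x.1 with
  | i :: p => (leaf_addr G i ++ p, x.2)
  | [::] => x
  end.

(* The sign comparing the wedge of the orientations of F and G with the       *)
(* chosen orientation of the grafted forest.                                  *)
Definition graft_sign (F G : forest) : int :=
  word_sign (map (graft_letter G) (fword F) ++ fword G) (fword (graft F G)).

Fixpoint tshift (m : nat) (t : ptree) : ptree :=
  match t with
  | Leaf i => Leaf (m + i)
  | Node ts => Node (map (tshift m) ts)
  end.

(* Disjoint union of a forest with m leaves and a forest; no sign occurs      *)
(* since fword (F ++ G) is fword F followed by the word of G (renamed).       *)
Definition funion (m : nat) (F G : forest) : forest := F ++ map (tshift m) G.

Definition fid (m : nat) : forest := map Leaf (iota 0 m).

(* The leaf i < m is at the root n + i, the leaf m + i at the root i.         *)
Definition fswap (m n : nat) : forest :=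
  map Leaf (iota m n) ++ map Leaf (iota 0 m).

(* All ways of moving between 2 and r - 1 consecutive children of the root    *)
(* vertex, of r children, to a new vertex above it; and, in fblow, all ways   *)
(* of blowing up a vertex.  The blow-up comes with the address of the new     *)
(* vertex, which is the upper end of the new edge.                            *)
Definition split_root (ts : seq ptree) : seq (seq ptree * seq nat) :=
  [seq (take j ts ++ Node (take s (drop j ts)) :: drop (j + s) ts, [:: j]) |
    s <- iota 2 (size ts - 2), j <- iota 0 (size ts - s).+1].

Definition blow_in (ts : seq ptree) (bs : seq (seq (ptree * seq nat))) :
    seq (seq ptree * seq nat) :=
  flatten [seq [seq (set_nth (Leaf 0) ts ib.1 x.1, ib.1 :: x.2) | x <- ib.2] |
           ib <- zip (iota 0 (size ts)) bs].

Fixpoint tblow (t : ptree) : seq (ptree * seq nat) :=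
  match t with
  | Leaf _ => [::]
  | Node ts => [seq (Node x.1, x.2) | x <- split_root ts ++
                                           blow_in ts (map tblow ts)]
  end.

Definition fblow (F : forest) : seq (forest * seq nat) :=
  blow_in F (map tblow F).

(* For a graph G' with an edge e of half-edges h1 (at the lower vertex v1)    *)
(* and h2 (at the upper vertex v2), both vertices and half-edges being named  *)
(* from the address a of v2, and a graph G = G'/e:  u' and u are words for    *)
(* orientations of G' and G, and k renames the remaining letters of G' to     *)
(* those of G.  If u' = s (v1 v2 h1 h2 y) and (v1 k(y)) = s' u, then u'       *)
(* collapses to s s' u.                                                       *)
Definition collapse_sign (u' u : seq letter) (a : seq nat)
    (k : letter -> letter) : int :=
  let v1 := (take (size a).-1 a, 0%N) in
  let e := [:: v1; (a, 0%N); (a, 2%N); (a, 1%N)] in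
  let y := [seq x <- u' | x \notin e] in
  word_sign (e ++ y) u' * word_sign (v1 :: map k y) u.

(* When the edge below the vertex at a, with s children, is collapsed, the    *)
(* branch c of the lower vertex which ends in a is replaced with s branches.  *)
Definition collapse_letter (a : seq nat) (s : nat) (x : letter) : letter :=
  let: (b, kind) := x in
  let a1 := take (size a).-1 a in
  let c := last 0%N a in
  if prefix a1 b then
    match drop (size a1) b with
    | [::] => x
    | c' :: p =>
        if (c' < c)%N then x
        else if (c < c')%N then (a1 ++ (c' + s).-1 :: p, kind)
        else if p is c'' :: p' then (a1 ++ (c + c'')%N :: p', kind)
        else x
    end
  else x.

Definition tchildren (t : ptree) : seq ptree :=
  if t is Node ts then ts else [::].

Fixpoint children_at (ts : seq ptree) (a : seq nat) : seq ptree :=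
  match a with
  | [::] => ts
  | c :: p => children_at (tchildren (nth (Leaf 0) ts c)) p
  end.

(* The coefficient of the blow-up (F', a) of F in the differential of F.      *)
Definition blow_sign (F F' : forest) (a : seq nat) : int :=
  collapse_sign (fword F') (fword F) a
    (collapse_letter a (size (children_at F' a))).

Definition fg_lift (K : choiceType) (V : zmodType) (f : K -> V)
    (D : {freeg K}) : V := \sum_(x <- dom D) f x *~ coeff x D.

Lemma fg_liftE (K : choiceType) (V : zmodType) (f : K -> V) (D : {freeg K})
    (s : seq K) :
  uniq s -> {subset dom D <= s} -> fg_lift f D = \sum_(x <- s) f x *~ coeff x D.
Proof.
move=> us sDs; rewrite (bigID (mem (dom D))) /= [X in _ + X]big1; last first.
  by move=> x hx; rewrite coeff_outdom.
rewrite addr0 -big_filter; apply: perm_big; apply: uniq_perm.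
- exact: uniq_dom.
- exact: filter_uniq.
by move=> x; rewrite mem_filter; case: (boolP (x \in dom D)) => // /sDs ->.
Qed.

Lemma fg_liftD (K : choiceType) (V : zmodType) (f : K -> V) :
  add_map (fg_lift f).
Proof.
move=> D D'; pose s := undup (dom D ++ dom D').
have us : uniq s by exact: undup_uniq.
have sub (A : seq K) : {subset A <= dom D ++ dom D'} -> {subset A <= s}.
  by move=> sA x /sA; rewrite mem_undup.
rewrite !(@fg_liftE _ _ f _ s) //.
- by rewrite -big_split; apply: eq_bigr => x _; rewrite coeffD mulrzDr.
- by apply: sub => x hx; rewrite mem_cat hx orbT.
- by apply: sub => x hx; rewrite mem_cat hx.
by apply: sub; exact: domD_subset.
Qed.

Lemma fg_liftU (K : choiceType) (V : zmodType) (f : K -> V) (x : K) :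
  fg_lift f << x >> = f x.
Proof. by rewrite /fg_lift domU1 big_seq1 coeffU eqxx. Qed.

(* Isomorphism classes of oriented forests modulo reversal of orientation are *)
(* a free abelian group on forests with their chosen orientation.             *)
Definition ainf_gr (m n : nat) (k : int) : zmodType := {freeg forest_of m n k}.

Definition ainf_elt (m n : nat) (k : int) (c : int) (F : forest) :
    ainf_gr m n k :=
  if insub F is Some G then << c *g (G : forest_of m n k) >> else 0.

Definition ainf_dif m n (i j : int) (_ : i = j + 1) :
    ainf_gr m n i -> ainf_gr m n j :=
  fg_lift (fun F : forest_of m n i =>
    \sum_(b <- fblow (val F)) ainf_elt m n j (blow_sign (val F) b.1 b.2) b.1).

Definition ainf_hom (m n : nat) : gcx := Gcx (@ainf_dif m n).

Definition ainf_comp m n p (i j k : int) (_ : i + j = k)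
    (x : ainf_hom m n i) (y : ainf_hom n p j) : ainf_hom m p k :=
  fg_lift (fun F : forest_of m n i =>
    fg_lift (fun G : forest_of n p j =>
      ainf_elt m p k (graft_sign (val F) (val G)) (graft (val F) (val G))) y) x.

Definition ainf_mon m n m' n' (i j k : int) (_ : i + j = k)
    (x : ainf_hom m n i) (y : ainf_hom m' n' j) :
    ainf_hom (m + m') (n + n') k :=
  fg_lift (fun F : forest_of m n i =>
    fg_lift (fun G : forest_of m' n' j =>
      ainf_elt (m + m') (n + n') k 1 (funion m (val F) (val G))) y) x.

Definition ainf_cat : dgcat_data :=
  @DgcatData ainf_hom (fun m => ainf_elt m m 0 1 (fid m)) ainf_comp.

Definition Ainf : prop_data :=
  @PropData ainf_cat ainf_mon
    (fun m n => ainf_elt (m + n) (n + m) 0 1 (fswap m n)).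

Record ainf_prop := AinfProp {
  aprop :> dgprop;
  amul : cmap Ainf aprop;
  amulP : is_prop_functor amul }.

(* The white vertex is placed at the empty address, below the roots of a      *)
(* forest; its half-edges are then the letters ([:: i], 2), and l_n is the    *)
(* case of a forest of n trivial trees.                                       *)
Definition white_word (n : nat) : seq letter :=
  ([::], 0%N) :: [seq ([:: i], 2%N) | i <- iota 0 n].

(* The r leaves j, j+1, ... (mod n) of l_n are moved to a new black vertex.   *)
(* If the leaf 0 is among them (j + r > n, or j = 0), the new edge becomes    *)
(* the start half-edge at the white vertex.                                   *)
Definition white_blow (n r j : nat) : forest :=
  let b := Node (map Leaf [seq ((j + c) %% n)%N | c <- iota 0 r]) in
  if (j + r <= n)%N
  then map Leaf (iota 0 j) ++ b :: map Leaf (iota (j + r) (n - (j + r)))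
  else b :: map Leaf (iota (j + r - n) (n - r)).

Definition white_blow_pos (n r j : nat) : nat := if (j + r <= n)%N then j else 0.

(* The half-edge of the leaf labelled i is the i-th half-edge of l_n.         *)
Definition white_collapse_letter (F : forest) (x : letter) : letter :=
  let s := fleaves F in
  if x.1 \in [seq y.1 | y <- s]
  then ([:: nth 0%N [seq y.2 | y <- s] (index x.1 [seq y.1 | y <- s])], x.2)
  else x.

(* The orientation of the blow-up is that of the forest wedge that of l_k.    *)
Definition white_sign (n r j : nat) : int :=
  let F := white_blow n r j in
  collapse_sign (fword F ++ white_word (size F)) (white_word n)
    [:: white_blow_pos n r j] (white_collapse_letter F).

(* f_{n+1,k+1}; here r = (n+1) + 1 - (k+1).                                   *)
Definition dL (n k : nat) : Ainf.(mor) n.+1 k.+1 (n%:Z - k%:Z - 1) :=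
  \sum_(j < n.+1) ainf_elt n.+1 k.+1 (n%:Z - k%:Z - 1)
    (white_sign n.+1 (n.+1 - k) j) (white_blow n.+1 (n.+1 - k) j).

(******************************************************************************)
(*  The forests produced above all satisfy is_forest in the expected degree,  *)
(*  so that ainf_elt is always applied in its first case.                     *)
(******************************************************************************)

Lemma ptree_ind_all (P : ptree -> Prop) :
  (forall i, P (Leaf i)) ->
  (forall ts, (forall t, t \in ts -> P t) -> P (Node ts)) ->
  forall t, P t.
Proof.
move=> PL PN; have nil u : u \in [::] -> P u by [].
fix IH 1; case=> [i|ts]; first exact: PL.
apply: PN; elim: ts => [|t ts IHts] u; first exact: nil.
rewrite in_cons => /predU1P [->|]; [exact: IH | exact: IHts].
Qed.

Lemma is_forest_graft m n p (i j : int) (F G : forest) :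
  is_forest m n i F -> is_forest n p j G -> is_forest m p (i + j) (graft F G).
Proof.
case/and4P=> /eqP sF vF lF /eqP dF /and4P [/eqP sG vG lG /eqP dG].
pose N := nth (Leaf 0) F.
have Fmap : F = map N (iota 0 n) by rewrite -sF map_nth_iota0 ?take_size.
have lE t : leaves (tgraft F t) = flatten [seq leaves (N k) | k <- leaves t].
  elim/ptree_ind_all: t => [k|ts IH] /=; first by rewrite cats0.
  elim: ts IH => [|t ts IHts] IH //=.
  rewrite map_cat flatten_cat IH ?mem_head // IHts // => u hu.
  by rewrite IH // in_cons hu orbT.
have dE t : tdeg (tgraft F t) =
    (sumn [seq tdeg (N k) | k <- leaves t] + tdeg t)%N.
  elim/ptree_ind_all: t => [k|ts IH] /=; first by rewrite !addn0.
  rewrite size_map addnCA; congr addn.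
  elim: ts IH => [|t ts IHts] IH //=.
  rewrite map_cat sumn_cat IH ?mem_head // IHts; first by rewrite addnACA.
  move=> u hu.
  by rewrite IH // in_cons hu orbT.
have vE t : valence_ge3 t -> valence_ge3 (tgraft F t).
  elim/ptree_ind_all: t => [k|ts IH] /=.
    move=> _; case: (ltnP k (size F)) => hk; last by rewrite nth_default.
    by apply: (allP vF); apply: mem_nth.
  rewrite size_map => /andP [-> /allP vts] /=.
  by rewrite all_map; apply/allP => t ht /=; apply: IH => //; apply: vts.
apply/and4P; split.
- by rewrite size_map sG.
- by rewrite all_map; apply/allP => t /(allP vG) /vE.
- rewrite -map_comp (eq_map (g := fun t =>
    flatten [seq leaves (N k) | k <- leaves t])) //.
  have -> : flatten [seq flatten [seq leaves (N k) | k <- leaves t] | t <- G] =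
            flatten [seq leaves (N k) | k <- flatten (map leaves G)].
    by elim: (G) => [|t ts IHts] //=; rewrite map_cat flatten_cat IHts.
  rewrite -(permPr lF) {1}Fmap -map_comp; apply: perm_flatten.
  exact: perm_map.
- rewrite -map_comp -dF -dG -PoszD; apply/eqP; congr Posz.
  rewrite (eq_map (g := fun t =>
    (sumn [seq tdeg (N k) | k <- leaves t] + tdeg t)%N)) //.
  have -> : sumn [seq (sumn [seq tdeg (N k) | k <- leaves t] + tdeg t)%N | t <- G]
     = (sumn [seq tdeg (N k) | k <- flatten (map leaves G)] +
        sumn (map tdeg G))%N.
    elim: (G) => [|t ts IHts] //=.
    by rewrite map_cat sumn_cat IHts addnACA.
  congr addn; rewrite {1}Fmap -map_comp; apply: perm_sumn.
  exact: perm_map.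
Qed.

Lemma is_forest_union m n m' n' (i j : int) (F G : forest) :
  is_forest m n i F -> is_forest m' n' j G ->
  is_forest (m + m') (n + n') (i + j) (funion m F G).
Proof.
case/and4P=> /eqP sF vF lF /eqP dF /and4P [/eqP sG vG lG /eqP dG].
have lE t : leaves (tshift m t) = map (addn m) (leaves t).
  elim/ptree_ind_all: t => [k|ts IH] //=.
  elim: ts IH => [|t ts IHts] IH //=.
  rewrite map_cat IH ?mem_head // IHts // => u hu.
  by rewrite IH // in_cons hu orbT.
have dE t : tdeg (tshift m t) = tdeg t.
  elim/ptree_ind_all: t => [k|ts IH] //=.
  rewrite size_map -map_comp; congr (_ + sumn _)%N.
  exact/eq_in_map.
have vE t : valence_ge3 (tshift m t) = valence_ge3 t.
  elim/ptree_ind_all: t => [k|ts IH] //=.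
  by rewrite size_map all_map; congr andb; apply: eq_in_all => t; exact: IH.
apply/and4P; split.
- by rewrite size_cat size_map sF sG.
- by rewrite all_cat vF all_map (eq_all (a2 := valence_ge3)).
- rewrite map_cat flatten_cat iotaD; apply: perm_cat => //.
  rewrite add0n -[X in iota X]addn0 iotaDl -map_comp.
  rewrite (eq_map (g := map (addn m) \o leaves)) // map_comp -map_flatten.
  exact: perm_map.
- rewrite map_cat sumn_cat -map_comp (eq_map (g := tdeg)) //.
  by rewrite PoszD dF dG.
Qed.

Lemma is_forest_leaves (m : nat) (s : seq nat) :
  perm_eq s (iota 0 m) -> is_forest m m 0 (map Leaf s).
Proof.
move=> hs; apply/and4P; split.
- by rewrite size_map (perm_size hs) size_iota.
- by rewrite all_map; apply/allP.
- by rewrite -map_comp flatten_seq1.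
- by apply/eqP; congr Posz; elim: (s).
Qed.

Lemma is_forest_id m : is_forest m m 0 (fid m).
Proof. exact: is_forest_leaves. Qed.

Lemma is_forest_swap m n : is_forest (m + n) (n + m) 0 (fswap m n).
Proof.
rewrite [X in is_forest _ X]addnC /fswap -map_cat; apply: is_forest_leaves.
by rewrite iotaD add0n perm_catC.
Qed.

Lemma take_drop_cat (T : Type) (j s : nat) (ts : seq T) :
  take j ts ++ take s (drop j ts) ++ drop (j + s) ts = ts.
Proof. by rewrite addnC -drop_drop cat_take_drop cat_take_drop. Qed.

Definition blown (F F' : seq ptree) :=
  [/\ all valence_ge3 F', flatten (map leaves F') = flatten (map leaves F) &
      (sumn (map tdeg F')).+1 = sumn (map tdeg F)].

Lemma blow_inP (ts : seq ptree) (b : seq ptree * seq nat) :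
  all valence_ge3 ts ->
  (forall t x, t \in ts -> x \in tblow t -> blown [:: t] [:: x.1]) ->
  b \in blow_in ts (map tblow ts) -> size b.1 = size ts /\ blown ts b.1.
Proof.
move=> vts IH /flattenP [bs /mapP [[i l]]].
move=> hz ->{bs} /mapP [x].
have [ltk hi] : (i < size ts)%N /\ l = tblow (nth (Leaf 0) ts i).
  case/(nthP (0%N, [::])): hz => k.
  rewrite size_zip size_iota size_map minnn => hk.
  rewrite nth_zip; last by rewrite size_iota size_map.
  by rewrite nth_iota // (nth_map (Leaf 0)) // add0n; case=> <- <-.
rewrite /= hi => hx ->{b} /=.
have [] := IH _ _ (mem_nth _ ltk) hx.
rewrite /= !cats0 !addn0 andbT => vx lx dx.
split; first by rewrite size_set_nth; apply/maxn_idPr.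
rewrite set_nthE ltk; split.
- by rewrite all_cat /= vx -all_cat; apply/allP => t;
    rewrite mem_cat => /orP [/mem_take|/mem_drop]; apply: (allP vts).
- rewrite -[in RHS](cat_take_drop i ts) (drop_nth (Leaf 0) ltk).
  by rewrite !map_cat !flatten_cat /= lx.
- rewrite -[in RHS](cat_take_drop i ts) (drop_nth (Leaf 0) ltk).
  by rewrite !map_cat !sumn_cat /= -dx addSn addnS.
Qed.

Lemma split_rootP (ts : seq ptree) (b : seq ptree * seq nat) :
  all valence_ge3 ts -> b \in split_root ts ->
  [/\ (2 <= size b.1)%N, all valence_ge3 b.1,
      flatten (map leaves b.1) = flatten (map leaves ts) &
      ((size b.1 - 2 + sumn (map tdeg b.1)).+1 =
         size ts - 2 + sumn (map tdeg ts))%N].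
Proof.
move=> vts /allpairsPdep [s [j []]].
rewrite !mem_iota => /andP [le2s lts] /andP [_ ltj] -> /=.
have les : (s < size ts)%N.
  by case: (ltnP 2 (size ts)) lts => [h|h]; [rewrite subnKC // ltnW |
     rewrite (eqP h) addn0 ltnNge le2s].
rewrite add0n ltnS in ltj.
have lejs : (j + s <= size ts)%N by rewrite addnC -leq_subRL // ltnW.
have lej : (j <= size ts)%N by apply: leq_trans lejs; exact: leq_addr.
have sE : size (take s (drop j ts)) = s.
  by rewrite size_takel // size_drop leq_subRL.
have szE : (size (take j ts ++ Node (take s (drop j ts)) :: drop (j + s) ts) + s
            = (size ts).+1)%N.
  by rewrite size_cat /= size_drop size_takel // addnS addSn addnAC subnKC.
set u := take j ts ++ _ in szE *.
have lt2u : (2 <= size u)%N by rewrite -(leq_add2r s) szE add2n ltnS.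
split=> //.
- rewrite all_cat /= sE le2s /= -!all_cat; apply/allP => t.
  rewrite !mem_cat => /or3P [/mem_take|/mem_take/mem_drop|/mem_drop];
    exact: (allP vts).
- rewrite -[in RHS](take_drop_cat j s ts).
  by rewrite !map_cat !flatten_cat /=.
- have -> : sumn (map tdeg u) = (s - 2 + sumn (map tdeg ts))%N.
    rewrite -[in RHS](take_drop_cat j s ts) !map_cat !sumn_cat /= sE.
    by rewrite -addnA addnCA.
  rewrite addnA -addSn; congr addn.
  move: (size u) lt2u szE => a lt2u szE; clear -lt2u szE le2s.
  move: a (size ts) s lt2u szE le2s => [|[|a]] // c [|[|b]] // _.
  by rewrite !subn2 !addSn !addnS => -[<-].
Qed.

Lemma tblowP (t : ptree) (b : ptree * seq nat) :
  valence_ge3 t -> b \in tblow t -> blown [:: t] [:: b.1].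
Proof.
elim/ptree_ind_all: t b => [i|ts IH] b //= /andP [le2 vts].
case/mapP => x + ->{b}; rewrite mem_cat => /orP [hx|hx].
  have [h1 h2 h3 h4] := split_rootP vts hx.
  by split; rewrite /= ?h1 ?h2 ?h3 ?addn0 ?cats0.
have [t u ht hu|h1 [h2 h3 h4]] := blow_inP vts _ hx.
  by apply: IH => //; apply: (allP vts).
by split; rewrite /= ?h1 ?le2 ?h2 ?h3 ?addn0 ?cats0 // -addnS h4.
Qed.

Lemma is_forest_blow m n (i j : int) (F : forest) (b : forest * seq nat) :
  i = j + 1 -> is_forest m n i F -> b \in fblow F -> is_forest m n j b.1.
Proof.
move=> e /and4P [/eqP sF vF lF /eqP dF] hb.
have [t u ht hu|h1 [h2 h3 h4]] := blow_inP vF _ hb.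
  by apply: tblowP => //; apply: (allP vF).
apply/and4P; split=> //; first by rewrite h1 sF.
  by rewrite h3.
by rewrite -(inj_eq (addIr 1)) -e -dF -h4 intS addrC.
Qed.

Lemma is_forest_white (n r j : nat) :
  (2 <= r <= n)%N -> (j < n)%N ->
  is_forest n (n - r).+1 (r%:Z - 2) (white_blow n r j).
Proof.
case/andP=> le2r lern ltjn; have n_gt0 : (0 < n)%N by apply: leq_trans ltjn.
have small s : all valence_ge3 (map Leaf s) by rewrite all_map; apply/allP.
have lmap s : flatten (map leaves (map Leaf s)) = s.
  by rewrite -map_comp flatten_seq1.
have dmap s : sumn (map tdeg (map Leaf s)) = 0%N by elim: s.
pose w := [seq ((j + c) %% n)%N | c <- iota 0 r].
have dE : (r - 2)%N%:Z = r%:Z - 2 by rewrite subzn.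
rewrite /white_blow -/w; case: (leqP (j + r) n) => hjr.
  have wE : w = iota j r.
    rewrite -[j in RHS]addn0 iotaDl; apply/eq_in_map => c.
    rewrite mem_iota add0n => /= ltc; rewrite modn_small //.
    by apply: leq_trans hjr; rewrite ltn_add2l.
  apply/and4P; split.
  - rewrite size_cat /= !size_map !size_iota addnS eqSS.
    by rewrite (addnC j r) subnDA subnKC // leq_subRL // addnC.
  - by rewrite all_cat small /= !size_map size_iota le2r !small.
  - rewrite map_cat flatten_cat lmap /= !lmap wE -iotaD -(iotaD 0 j).
    by rewrite addnA subnKC.
  - by rewrite map_cat sumn_cat /= !dmap size_map wE size_iota !addn0 dE.
apply/and4P; split.
- by rewrite /= size_map size_iota.
- by rewrite /= !size_map size_iota le2r !small.
- rewrite /= !lmap.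
  have -> : w = iota j (n - j) ++ iota 0 (j + r - n).
    have rE : r = (n - j + (j + r - n))%N.
      by rewrite addnBA 1?ltnW // addnA subnK 1?ltnW // addKn.
    rewrite /w {1}rE iotaD add0n map_cat; congr cat.
      rewrite -[X in _ = iota X _]addn0 [RHS]iotaDl; apply/eq_in_map => c.
      by rewrite mem_iota add0n ltn_subRL /= => ltc; rewrite modn_small.
    rewrite -[X in map _ (iota X _)]addn0 iotaDl -map_comp -[RHS]map_id.
    apply/eq_in_map => c; rewrite mem_iota add0n => /= ltc.
    rewrite addnA subnKC 1?ltnW // modnDl modn_small //.
    by apply: (leq_trans ltc); rewrite leq_subLR leq_add // ltnW.
  have -> : (n - r = j - (j + r - n))%N.
    by rewrite subnBA 1?ltnW // subnDl.
  rewrite -catA -iotaD subnKC; last by rewrite leq_subLR addnC leq_add2r.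
  by rewrite perm_catC -iotaD subnKC // ltnW.
- by rewrite /= !dmap !size_map size_iota !addn0 dE.
Qed.

Definition dprod (F : nat -> zmodType) := forall n, F n.

Section Dprod.
Variable F : nat -> zmodType.

HB.instance Definition _ := gen_eqMixin (dprod F).
HB.instance Definition _ := gen_choiceMixin (dprod F).

Let padd (x y : dprod F) : dprod F := fun n => x n + y n.
Let popp (x : dprod F) : dprod F := fun n => - x n.
Let pzero : dprod F := fun n => 0.

Fact dprod_addA : associative padd.
Proof. by move=> x y z; apply: functional_extensionality_dep => n;
  exact: addrA. Qed.
Fact dprod_addC : commutative padd.
Proof. by move=> x y; apply: functional_extensionality_dep => n;
  exact: addrC. Qed.
Fact dprod_add0 : left_id pzero padd.
Proof. by move=> x; apply: functional_extensionality_dep => n;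
  exact: add0r. Qed.
Fact dprod_addN : left_inverse pzero popp padd.
Proof. by move=> x; apply: functional_extensionality_dep => n;
  exact: addNr. Qed.

HB.instance Definition _ :=
  GRing.isZmodule.Build (dprod F) dprod_addA dprod_addC dprod_add0 dprod_addN.

Definition vanish_from (x : dprod F) (N : nat) : bool :=
  `[< forall n, (N <= n)%N -> x n = 0 >].

Definition finsupp : {pred dprod F} := fun x => `[< exists N, vanish_from x N >].

Fact finsupp_zmod_closed : zmod_closed finsupp.
Proof.
split=> [|x y /asboolP [M /asboolP hM] /asboolP [N /asboolP hN]].
  by apply/asboolP; exists 0%N; apply/asboolP.
apply/asboolP; exists (maxn M N); apply/asboolP => n.
rewrite geq_max => /andP [Mn Nn].
by rewrite -[LHS]/(x n - y n) hM // hN // subr0.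
Qed.

HB.instance Definition _ :=
  GRing.isZmodClosed.Build (dprod F) finsupp finsupp_zmod_closed.

Definition dsum := {x : dprod F | finsupp x}.

HB.instance Definition _ := SubChoice.copy dsum {x : dprod F | finsupp x}.
HB.instance Definition _ := [SubChoice_isSubZmodule of dsum by <:].

Definition single (n : nat) (a : F n) : dprod F :=
  fun k => if n =P k is ReflectT e then ecast l (F l) e a else 0.

Fact single_finsupp n (a : F n) : finsupp (single a).
Proof.
apply/asboolP; exists n.+1; apply/asboolP => k lt_nk; rewrite /single.
by case: eqP => // e; exfalso; move: lt_nk; rewrite e ltnn.
Qed.

Definition dinj (n : nat) (a : F n) : dsum := Sub (single a) (single_finsupp a).

Definition dbound (x : dsum) : nat := ex_minn (asboolP _ (valP x)).

(* The map induced on the direct sum by the maps g n.                         *)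
Definition dlift (V : zmodType) (g : forall n, F n -> V) (x : dsum) : V :=
  \sum_(n < dbound x) g n (val x n).

Lemma dliftE (V : zmodType) (g : forall n, F n -> V) (x : dsum) (N : nat) :
  (forall n, g n 0 = 0) -> vanish_from (val x) N ->
  dlift g x = \sum_(n < N) g n (val x n).
Proof.
move=> g0 /asboolP hN; rewrite /dlift /dbound; case: ex_minnP => M hM minM.
have leMN : (M <= N)%N by apply: minM; apply/asboolP.
rewrite (big_ord_widen _ (fun n => g n (val x n)) leMN) 
  [RHS](bigID (fun n : 'I_N => (n < M)%N)).
rewrite /= [X in _ + X]big1 ?addr0 // => n; rewrite -leqNgt => leMn.
by move/asboolP: hM => ->.
Qed.

Lemma dlift_inj (V : zmodType) (g : forall n, F n -> V) n (a : F n) :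
  (forall n, g n 0 = 0) -> dlift g (dinj a) = g n a.
Proof.
move=> g0; rewrite (@dliftE _ _ _ n.+1) //; last first.
  apply/asboolP => k lt_nk; rewrite /= /single.
  by case: eqP => // e; exfalso; move: lt_nk; rewrite e ltnn.
rewrite big_ord_recr /= big1 ?add0r.
  by rewrite /single; case: eqP => // e; rewrite (eq_irrelevance e erefl).
move=> k _; rewrite /single; case: eqP => // e.
by exfalso; move: (ltn_ord k); rewrite -e ltnn.
Qed.

Lemma dliftD (V : zmodType) (g : forall n, F n -> V) :
  (forall n, add_map (g n)) -> add_map (dlift g).
Proof.
move=> gD x y; have g0 n : g n 0 = 0.
  by apply: (addIr (g n 0)); rewrite -gD !add0r.
have [/asboolP [M hM] /asboolP [N hN]] := (valP x, valP y).
have leM : vanish_from (val x) (maxn M N).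
  apply/asboolP => n; rewrite geq_max => /andP [h _].
  by move/asboolP: hM => ->.
have leN : vanish_from (val y) (maxn M N).
  apply/asboolP => n; rewrite geq_max => /andP [_ h].
  by move/asboolP: hN => ->.
rewrite !(dliftE g0 leM, dliftE g0 leN) (@dliftE _ _ (x + y) (maxn M N)) //.
  by rewrite -big_split; apply: eq_bigr => n _; exact: (gD n (val x n) (val y n)).
apply/asboolP => n h; rewrite -[LHS]/(val x n + val y n).
by move/asboolP: leM => -> //; move/asboolP: leN => -> //; rewrite addr0.
Qed.

End Dprod.
Arguments dinj {F} n a.

Section Tens.
Variables (E : dgcat_data) (T : nat -> gcx) (n : nat) (k : int).

(* The component of degree k of the direct sum over m of T m (x) mor E m n is *)
(* the free abelian group on the pairs of homogeneous elements of total       *)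
(* degree k, modulo biadditivity.                                             *)
Record tgen := Tgen {
  tmid : nat;
  tdl : int;
  tdr : int;
  tdeg_eq : tdl + tdr = k;
  tleft : T tmid tdl;
  tright : mor E tmid n tdr }.

Definition tfree : zmodType := {freeg {classic tgen}}.

Definition tfgen m (i j : int) (e : i + j = k) (x : T m i) (f : mor E m n j) :
    tfree := << (Tgen e x f : {classic tgen}) >>.

Inductive tens_rel : tfree -> Prop :=
| tens_rel_l m i j (e : i + j = k) (x y : T m i) (f : mor E m n j) :
    tens_rel (tfgen e (x + y) f - tfgen e x f - tfgen e y f)
| tens_rel_r m i j (e : i + j = k) (x : T m i) (f g : mor E m n j) :
    tens_rel (tfgen e x (f + g) - tfgen e x f - tfgen e x g)
| tens_rel_0 : tens_rel 0
| tens_rel_B u v : tens_rel u -> tens_rel v -> tens_rel (u - v).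

Definition tens_relb : {pred tfree} := fun u => `[< tens_rel u >].

Fact tens_rel_zmod_closed : zmod_closed tens_relb.
Proof.
split=> [|u v /asboolP hu /asboolP hv]; apply/asboolP.
  exact: tens_rel_0.
exact: tens_rel_B.
Qed.

HB.instance Definition _ :=
  GRing.isZmodClosed.Build tfree tens_relb tens_rel_zmod_closed.

Definition tens : zmodType := Quotient.quot tens_relb.

Definition tpure m (i j : int) (e : i + j = k) (x : T m i) (f : mor E m n j) :
  tens := (\pi_(Quotient.quot tens_relb) (tfgen e x f))%qT.

(* The map on the tensor product induced by the biadditive maps g.            *)
Definition tlift (V : zmodType)
    (g : forall m (i j : int), i + j = k -> T m i -> mor E m n j -> V)
    (u : tens) : V :=
  fg_lift (fun w : {classic tgen} => g _ _ _ (tdeg_eq w) (tleft w) (tright w))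
    (repr (u : Quotient.quot tens_relb)).

Definition biadditive (V : zmodType)
    (g : forall m (i j : int), i + j = k -> T m i -> mor E m n j -> V) : Prop :=
  (forall m (i j : int) (e : i + j = k) (f : mor E m n j),
     add_map (fun x : T m i => g m i j e x f)) /\
  (forall m (i j : int) (e : i + j = k) (x : T m i),
     add_map (fun f : mor E m n j => g m i j e x f)).

Lemma tlift_pi (V : zmodType)
    (g : forall m (i j : int), i + j = k -> T m i -> mor E m n j -> V)
    (u : tfree) : biadditive g ->
  tlift g (\pi_(Quotient.quot tens_relb) u)%qT =
  fg_lift (fun w : {classic tgen} => g _ _ _ (tdeg_eq w) (tleft w) (tright w)) u.
Proof.
case=> gl gr; rewrite /tlift; set h := fun w : {classic tgen} => _.
have h0 : fg_lift h 0 = 0.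
  by apply: (addIr (fg_lift h 0)); rewrite -fg_liftD !add0r.
have hB a b : fg_lift h (a - b) = fg_lift h a - fg_lift h b.
  by apply/eqP; rewrite -subr_eq opprK -fg_liftD subrK.
have hrel a : tens_rel a -> fg_lift h a = 0.
  elim=> [m i j e x y f|m i j e x f f'||v w _ hv _ hw] //.
  - by rewrite !hB !fg_liftU /h /= gl addrAC addrK subrr.
  - by rewrite !hB !fg_liftU /h /= gr addrAC addrK subrr.
  - by rewrite hB hv hw subrr.
apply/eqP; rewrite -subr_eq0 -hB; apply/eqP/hrel/asboolP.
have : (repr (\pi_(Quotient.quot tens_relb) u) == u
          %[mod Quotient.quot tens_relb])%qT by rewrite reprK.
by rewrite -Quotient.idealrBE.
Qed.

Lemma tlift_pure (V : zmodType)
    (g : forall m (i j : int), i + j = k -> T m i -> mor E m n j -> V)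
    m (i j : int) (e : i + j = k) (x : T m i) (f : mor E m n j) :
  biadditive g -> tlift g (tpure e x f) = g m i j e x f.
Proof. by move=> gb; rewrite tlift_pi // fg_liftU. Qed.

Lemma tliftD (V : zmodType)
    (g : forall m (i j : int), i + j = k -> T m i -> mor E m n j -> V) :
  biadditive g -> add_map (tlift g).
Proof.
move=> gb u v; rewrite -[u](@reprK _ (Quotient.quot tens_relb)).
rewrite -[v](@reprK _ (Quotient.quot tens_relb)).
have -> : (\pi_(Quotient.quot tens_relb) (repr (u : Quotient.quot tens_relb)) +
           \pi_(Quotient.quot tens_relb) (repr (v : Quotient.quot tens_relb)))%qT =
  (\pi_(Quotient.quot tens_relb) (repr (u : Quotient.quot tens_relb) +
                                   repr (v : Quotient.quot tens_relb)))%qT.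
  by rewrite [RHS]Quotient.pi_add.
by rewrite !tlift_pi // fg_liftD.
Qed.

End Tens.

(* T (x) E, for T a family of complexes indexed by the objects, with the      *)
(* tensor product differential.                                               *)
Section TensComplex.
Variables (E : dgcat_data) (T : nat -> gcx).

Fact addr1_left (i i' j t s : int) :
  i + j = t -> t = s + 1 -> i = i' + 1 -> i' + j = s.
Proof. by move=> <- et ei; move: et; rewrite ei addrAC => /addIr. Qed.

Fact addr1_right (i j j' t s : int) :
  i + j = t -> t = s + 1 -> j = j' + 1 -> i + j' = s.
Proof. by move=> <- et ej; move: et; rewrite ej addrA => /addIr. Qed.

Fact subr1K (i : int) : i = (i - 1) + 1.
Proof. by rewrite subrK. Qed.

Definition tens_dif (n : nat) (t s : int) (e : t = s + 1) :
    tens E T n t -> tens E T n s :=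
  tlift (fun m i j (e' : i + j = t) (x : T m i) (f : mor E m n j) =>
    tpure (addr1_left e' e (subr1K i)) (dif (subr1K i) x) f +
    ksgn i (tpure (addr1_right e' e (subr1K j)) x (dif (subr1K j) f))).

Definition tensC (n : nat) : gcx := Gcx (@tens_dif n).

End TensComplex.

Section Bar.
Variables (E : dgcat_data) (Phi : fun_data E).

(* bar_tens q n is the direct sum over m_0, ..., m_{q-1} of                   *)
(* Phi(m_0) (x) E(m_0,m_1) (x) ... (x) E(m_{q-1},n); thus B_p = bar_tens p.+1.*)
Fixpoint bar_tens (q : nat) : nat -> gcx :=
  match q with
  | 0 => Phi
  | q'.+1 => tensC E (bar_tens q')
  end.

Definition bar_last (q n p : nat) (i j k : int) (e : i + j = k)
    (b : bar_tens q.+1 n i) (f : mor E n p j) : bar_tens q.+1 p k :=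
  tlift (fun m a c (e' : a + c = i) (x : bar_tens q m a) (g : mor E m n c) =>
    tpure (etrans (addrA a c j) (etrans (congr1 (fun z => z + j) e') e))
      x (comp erefl g f) : bar_tens q.+1 p k) b.

(* The face d_r : B_q -> B_{q-1}, for 0 <= r <= q and q > 0; for q = r = 0    *)
(* this is the action B_0 -> Phi.                                             *)
Fixpoint bar_face (q r n : nat) (i k : int) (e : i = k) {struct q} :
    bar_tens q.+1 n i -> bar_tens q n k :=
  match q with
  | 0 => tlift (fun m a c (e' : a + c = i) (x : Phi m a) (f : mor E m n c) =>
           act (etrans e' e) x f)
  | q'.+1 =>
      if r == q'.+1
      then tlift (fun m a c (e' : a + c = i) (b : bar_tens q'.+1 m a)
                      (f : mor E m n c) => bar_last (etrans e' e) b f)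
      else tlift (fun m a c (e' : a + c = i) (b : bar_tens q'.+1 m a)
                      (f : mor E m n c) =>
             tpure (etrans e' e) (bar_face r (erefl a) b) f
             : bar_tens q'.+1 n k)
  end.

Fact deg_shift_dif (t s : int) (p : nat) :
  t = s + 1 -> t - p%:Z = (s - p%:Z) + 1.
Proof. by move=> ->; rewrite addrAC. Qed.

Fact deg_shift_face (t s : int) (p : nat) :
  t = s + 1 -> t - (p.+1)%:Z = s - p%:Z.
Proof. by move=> ->; rewrite -addn1 PoszD opprD addrACA subrr addr0. Qed.

Fact deg_shift_act (i j k : int) (p : nat) :
  i + j = k -> (i - p%:Z) + j = k - p%:Z.
Proof. by move=> <-; rewrite addrAC. Qed.

Definition bar_gr (m : nat) (t : int) : zmodType :=
  dsum (fun p => bar_tens p.+1 m (t - p%:Z)).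

Definition bar_faces (m : nat) (t s : int) (e : t = s + 1) (p : nat) :
    bar_tens p.+1 m (t - p%:Z) -> bar_gr m s :=
  match p with
  | 0 => fun=> 0
  | p'.+1 => fun b =>
      \sum_(r < p'.+2) dinj p' (ksgn r%:Z (bar_face r (deg_shift_face p' e) b))
  end.

Definition bar_dif (m : nat) (t s : int) (e : t = s + 1) :
    bar_gr m t -> bar_gr m s :=
  dlift (fun p b =>
    dinj p (ksgn p%:Z (dif (deg_shift_dif p e) b)) + bar_faces e b).

Definition bar_complex (m : nat) : gcx := Gcx (@bar_dif m).

Definition bar_act (m n : nat) (i j k : int) (e : i + j = k)
    (b : bar_complex m i) (f : mor E m n j) : bar_complex n k :=
  dlift (fun p (c : bar_tens p.+1 m (i - p%:Z)) =>
    dinj p (bar_last (deg_shift_act p e) c f) : bar_complex n k) b.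

Definition bar : fun_data E := FunData bar_act.

Fact deg_shift_0 (t : int) : t - 0%:Z = t.
Proof. by rewrite subr0. Qed.

(* The augmentation a (x) c |-> Phi(c)(a) on B_0, and 0 on B_p for p > 0.     *)
Definition bar_aug : fmap bar Phi := fun m t b =>
  dlift (fun p =>
    match p return bar_tens p.+1 m (t - p%:Z) -> Phi m t with
    | 0 => bar_face 0 (deg_shift_0 t)
    | _.+1 => fun=> 0
    end) b.

End Bar.

(* The map B(Phi,E,E) -> B(Phi',E',E') induced by j : E -> E' and a map       *)
(* th : Phi -> Phi' over j.                                                   *)
Section BarMap.
Variables (E E' : dgcat_data) (Phi : fun_data E) (Phi' : fun_data E').
Variables (j : cmap E E') (th : fmap Phi Phi').

Fixpoint bar_tens_map (q : nat) :
    forall n, gmap (bar_tens Phi q n) (bar_tens Phi' q n) :=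
  match q with
  | 0 => th
  | q'.+1 => fun n k =>
      tlift (fun m a c (e : a + c = k) (x : bar_tens Phi q' m a)
                 (f : mor E m n c) =>
        tpure e (@bar_tens_map q' m a x) (j f) : bar_tens Phi' q'.+1 n k)
  end.

Definition bar_map : fmap (bar Phi) (bar Phi') := fun m t b =>
  dlift (fun p c => dinj p (@bar_tens_map p.+1 m (t - p%:Z) c) : bar Phi' m t) b.

End BarMap.

Section Hochschild.
Variables (E : ainf_prop) (Phi : fun_data E).

(* The summand of index n is Phi(n.+1 + m) (x) L_{n.+1}, where l_{n.+1} has   *)
(* degree n.                                                                  *)
Definition hoch_gr (m : nat) (t : int) : zmodType :=
  dsum (fun n => Phi (n.+1 + m)%N (t - n%:Z)).

Fact deg_shift_dL (t s : int) (n k : nat) :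
  t = s + 1 -> (t - n%:Z) + (n%:Z - k%:Z - 1) = s - k%:Z.
Proof. by move=> ->; rewrite !addrA subrK addrAC addrK. Qed.

Definition hoch_dif (m : nat) (t s : int) (e : t = s + 1) :
    hoch_gr m t -> hoch_gr m s :=
  dlift (fun n x =>
    dinj n (dif (deg_shift_dif n e) x) +
    \sum_(k < n) dinj (k : nat) (ksgn (t - n%:Z)
      (act (deg_shift_dL n k e) x
        (mon (addr0 _) (amul E (dL n k)) (idm m) : mor E _ _ _)))).

Definition hoch_complex (m : nat) : gcx := Gcx (@hoch_dif m).

Definition hoch_act (m p : nat) (i j k : int) (e : i + j = k)
    (x : hoch_complex m i) (f : mor E m p j) : hoch_complex p k :=
  dlift (fun n (y : Phi (n.+1 + m)%N (i - n%:Z)) =>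
    dinj n (ksgn (n%:Z * j)
      (act (deg_shift_act n e) y (mon (add0r j) (idm n.+1) f : mor E _ _ _)))
    : hoch_complex p k) x.

Definition hoch : fun_data E := FunData hoch_act.

End Hochschild.

Fixpoint hoch_iter (E : ainf_prop) (n : nat) (Phi : fun_data E) : fun_data E :=
  match n with
  | 0 => Phi
  | n'.+1 => hoch (hoch_iter n' Phi)
  end.

Definition hoch_map (E E' : ainf_prop) (Phi : fun_data E) (Phi' : fun_data E')
    (th : fmap Phi Phi') : fmap (hoch Phi) (hoch Phi') := fun m t x =>
  dlift (fun n (y : Phi (n.+1 + m)%N (t - n%:Z)) =>
    dinj n (th _ _ y) : hoch Phi' m t) x.

Fixpoint hoch_iter_map (E E' : ainf_prop) (n : nat)
    (Phi : fun_data E) (Phi' : fun_data E') (th : fmap Phi Phi') :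
    fmap (hoch_iter n Phi) (hoch_iter n Phi') :=
  match n return fmap (hoch_iter n Phi) (hoch_iter n Phi') with
  | 0 => th
  | n'.+1 => hoch_map (@hoch_iter_map E E' n' Phi Phi' th)
  end.
Arguments hoch_iter_map {E E'} n {Phi Phi'} th.

(* Main.v *)
From mathcomp Require Import all_boot all_order all_algebra.
From mathcomp Require Import boolp freeg zify.
Require Import Defs.

(* For each object m, the map a |-> a (x) id_m is a chain map from Phi(m) to     *)
(* B(Phi,E,E)(m) and a section of the augmentation, and the extra degeneracy     *)
(* b |-> +- b (x) id_m contracts B(Phi,E,E)(m) onto its image; neither of them   *)
(* is natural in m, but the augmentation is.  The Hochschild differential is     *)
(* d + t, with d the internal differential and t lowering the index n.  If eta   *)
(* is a section of alpha and h a contraction for d, with alpha h = 0, then       *)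
(* beta = sum_p (-h t)^p eta and sum_p (-h t)^p h are of the same kind for d + t *)
(* and C(alpha), because alpha commutes with t; so this step can be iterated.    *)
(* For n = 1 it gives the sum of +- (x (x) f (x) ... (x) f (x) id) (x) l_k over  *)
(* chains of morphisms f_{n,n'}.                                                 *)
(*                                                                               *)
(* That d + t has square zero amounts to d f_{n,k} = sum_l +- f_{n,l} f_{l,k} in *)
(* A_infinity: forests with two nested vertices occur once on each side, and     *)
(* forests with two vertices side by side occur twice on the right-hand side,    *)
(* once for each order of the blow-ups, with opposite signs.                     *)

Set Implicit Arguments.
Unset Strict Implicit.
Unset Printing Implicit Defensive.

Import Order.TTheory GRing.Theory Num.Theory.
Local Open Scope ring_scope.

(** At a fixed object m the bar construction contracts onto [Phi m]: tensoring with [idm m] on the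
    right is an extra degeneracy, which gives a section eta of the augmentation alpha and a homotopy
    h with dh + hd = 1 - eta alpha and alpha h = 0 ([bar_is_contraction]). Neither eta nor h is
    natural in m, so neither can simply be applied under the Hochschild complex. The failure is
    confined to the part t of the Hochschild differential d + t, which acts through the morphisms
    i(f_{n,k}) + id_m and strictly lowers n.

    Homological perturbation repairs this. Put K = - h t. On each element only finitely many powers
    of K are nonzero, so 1 - K is invertible ([resolvent_step], [resolvent_uniq]), and (1 - K)^-1
    eta and (1 - K)^-1 h form a contraction for d + t ([perturbed_chain], [perturbed_homotopy],
    [hoch_is_contraction]). Since alpha is natural it commutes with t, and alpha K = 0, so the same
    C(alpha) remains the retraction. The output has the shape of the input, hence the step iterates
    n times. A contraction makes its inclusion a quasi-isomorphism ([contraction_quasi_iso]).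
    Naturality holds because a map commuting with t, eta and h preserves the fixed-point equations
    which determine the new data ([hoch_contraction_compat]); for the bar construction this only
    uses that j preserves identities.

    What remains is that C(Phi) is a complex and again a functor ([hoch_dif_sq], [hoch_is_dgfun]).
    This rests on the Maurer-Cartan equation [dL_maurer_cartan] in A_infinity, a combinatorial
    identity with signs. All forests in it have two vertices. Nested ones match term by term
    ([sum_nested]), after a case distinction on where the start leaf lies; those with vertices side
    by side cancel in pairs ([sum_disjoint], from [line_signs] and [cycle_signs]). The signs are
    computed by factoring the relative sign of two words through a fixed order of all letters
    ([word_signE]). *)

(** * Signs of words *)

(* The sign of a word relative to an arbitrary fixed order of the letters.       *)
Definition wsg (u : seq letter) : int := (-1) ^+ inversions (map pickle u).

Lemma count_gt_swap (a b : seq nat) x y z :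
  count (fun w => (w < z)%N) (a ++ x :: y :: b) =
  count (fun w => (w < z)%N) (a ++ y :: x :: b).
Proof. by rewrite !count_cat /= (addnCA (x < z)%N). Qed.

Lemma inversions_swap (a b : seq nat) x y : x != y ->
  (-1) ^+ inversions (a ++ x :: y :: b) =
  - (-1) ^+ inversions (a ++ y :: x :: b) :> int.
Proof.
move=> neq; elim: a => [|z a IH] /=; last first.
  by rewrite !exprD IH mulrN count_gt_swap.
set cx := count _ b; set cy := count _ b; set i := inversions b.
have := neq; rewrite neq_ltn => /orP [h|h].
  rewrite h [(y < x)%N]ltnNge (ltnW h) /= !exprD expr1 expr0 !mul1r.
  by rewrite mulN1r mulNr opprK mulrCA.
rewrite h [(x < y)%N]ltnNge (ltnW h) /= !exprD expr1 expr0 !mul1r.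
by rewrite mulN1r mulNr mulrCA.
Qed.

Lemma swap_front (T : Type) (P : seq T -> Prop) :
  (forall a b x y, P (a ++ x :: y :: b) -> P (a ++ y :: x :: b)) ->
  forall a x b, P (a ++ x :: b) -> P (x :: a ++ b).
Proof.
move=> Psw a x b; elim/last_ind: a b => [|a z IH] b //.
by rewrite !cat_rcons => h; apply: IH; apply: Psw.
Qed.

Lemma swap_ind (T : eqType) (P : seq T -> Prop) (v : seq T) :
  P v ->
  (forall a b x y, P (a ++ x :: y :: b) -> P (a ++ y :: x :: b)) ->
  forall u, perm_eq u v -> P u.
Proof.
move=> Pv Psw u; elim: u v P Pv Psw => [|x u IH] v P Pv Psw uv.
  by move: uv; rewrite perm_sym => /perm_nilP <-.
have xv : x \in v by rewrite -(perm_mem uv) mem_head.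
case/splitPr: xv Pv uv => a b Pv uv.
have {}uv : perm_eq u (a ++ b).
  by rewrite -(perm_cons x); apply: (perm_trans uv); rewrite -(cat1s x b) perm_catCA.
apply: (IH (a ++ b) (fun u => P (x :: u))) => //; first exact: swap_front.
by move=> c d y z; exact: (Psw (x :: c)).
Qed.

Lemma wsg_swap (a b : seq letter) x y : x != y ->
  wsg (a ++ x :: y :: b) = - wsg (a ++ y :: x :: b).
Proof.
by move=> neq; rewrite /wsg !map_cat /= inversions_swap // (inj_eq (pcan_inj pickleK)).
Qed.

Lemma wsg_sq u : wsg u * wsg u = 1.
Proof. by rewrite /wsg -expr2 sqrr_sign. Qed.

Lemma inversions_iota n m : inversions (iota m n) = 0%N.
Proof.
elim: n m => //= n IH m; rewrite IH addn0; apply/eqP.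
by rewrite -leqn0 leqNgt -has_count; apply/hasPn => x; rewrite mem_iota; lia.
Qed.

(** Both sides change sign when two neighbouring letters of [u] are exchanged, and both equal 1 at
    [u = v]. The factorization makes relative signs multiplicative, so that each sign below reduces
    to moving blocks inside one word. *)
Lemma word_signE (u v : seq letter) : uniq u -> perm_eq u v ->
  word_sign u v = wsg u * wsg v.
Proof.
move=> uu uv; have uv0 := uv; move: u uv uu uv0; apply: swap_ind.
  move=> uv _; rewrite wsg_sq /word_sign.
  suff -> : [seq index x v | x <- v] = iota 0 (size v) by rewrite inversions_iota.
  case: v uv => // x v uv; apply: (@eq_from_nth _ 0%N); first by rewrite size_map size_iota.
  move=> i; rewrite size_map => hi; rewrite (nth_map x) // nth_iota //.
  by rewrite index_uniq.
move=> a b x y IH uu uv.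
have pe : perm_eq (a ++ x :: y :: b) (a ++ y :: x :: b).
  by rewrite perm_cat2l -(cat1s x) -(cat1s y) -(cat1s y) -(cat1s x) perm_catCA.
have uu' : uniq (a ++ x :: y :: b) by rewrite (perm_uniq pe).
have neq : x != y.
  by move: uu'; rewrite cat_uniq => /and3P [_ _] /=; rewrite inE negb_or -andbA => /andP [].
have uv' := perm_trans pe uv.
have xv : x \in v by rewrite -(perm_mem uv') mem_cat mem_head orbT.
have yv : y \in v by rewrite -(perm_mem uv) mem_cat mem_head orbT.
rewrite wsg_swap 1?eq_sym // mulNr -IH //.
rewrite /word_sign !map_cat /= inversions_swap //.
apply: contraNneq neq => /(congr1 (nth x v)).
by rewrite !nth_index // => ->.
Qed.

Lemma wsg_move1 (a b c : seq letter) x : uniq (a ++ x :: b ++ c) ->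
  wsg (a ++ x :: b ++ c) = (-1) ^+ size b * wsg (a ++ b ++ x :: c).
Proof.
elim: b a => [|y b IH] a /=; first by rewrite expr0 mul1r.
move=> u; have neq : x != y.
  by move: u; rewrite cat_uniq => /and3P [_ _] /=; rewrite inE negb_or -andbA => /andP [].
rewrite wsg_swap // exprS mulN1r mulNr; congr (- _).
rewrite -!(cat_rcons y a); apply: IH; rewrite cat_rcons; move: u.
rewrite (perm_uniq (s2 := a ++ y :: x :: b ++ c)) //.
by rewrite perm_cat2l -(cat1s x) -(cat1s y) -(cat1s y) -(cat1s x) perm_catCA.
Qed.

Lemma wsg_move (a b c d : seq letter) : uniq (a ++ b ++ c ++ d) ->
  wsg (a ++ b ++ c ++ d) = (-1) ^+ (size b * size c) * wsg (a ++ c ++ b ++ d).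
Proof.
elim: b a => [|x b IH] a u; first by rewrite mul0n expr0 mul1r.
rewrite [_ ++ d]/= -cat_rcons IH ?cat_rcons // wsg_move1.
  by rewrite mulrA -exprD mulSn addnC.
move: u; rewrite /= (perm_uniq (s2 := a ++ x :: c ++ b ++ d)) //.
by rewrite perm_cat2l perm_cons perm_catCA.
Qed.

(** * Forests with one or two vertices *)

(** This is [branches] with the numbering started at [k], which makes it compatible with
    concatenation of forests. *)
Definition branches_from (A : Type) k (ws : seq (seq (seq nat * A))) :
    seq (seq nat * A) :=
  flatten [seq [seq (iw.1 :: x.1, x.2) | x <- iw.2] |
           iw <- zip (iota k (size ws)) ws].

Lemma branches_from_cat (A : Type) k (v w : seq (seq (seq nat * A))) :
  branches_from k (v ++ w) = branches_from k v ++ branches_from (k + size v) w.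
Proof.
by rewrite /branches_from size_cat iotaD zip_cat ?size_iota // map_cat flatten_cat.
Qed.

Lemma branches_from_cons (A : Type) k v (w : seq (seq (seq nat * A))) :
  branches_from k (v :: w) =
  [seq (k :: x.1, x.2) | x <- v] ++ branches_from k.+1 w.
Proof. by []. Qed.

Lemma branches_from_word_leaves k (s : seq nat) :
  branches_from k (map tword (map Leaf s)) = [::].
Proof. by elim: s k => //= x s IH k; rewrite branches_from_cons IH. Qed.

Lemma branches_from_leaves k (s : seq nat) :
  branches_from k (map tleaves (map Leaf s)) =
  zip [seq [:: i] | i <- iota k (size s)] s.
Proof. by elim: s k => //= x s IH k; rewrite branches_from_cons IH. Qed.

(** The letters that a vertex at address [a] with [r] children contributes to the chosen
    orientation. There are r + 2 of them, so exchanging two blocks costs the parity of the product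
    of the numbers of children. *)
Definition vblock (a : seq nat) (r : nat) : seq letter :=
  (a, 0%N) :: (a, 1%N) :: [seq (rcons a c, 2%N) | c <- iota 0 r].

Lemma size_vblock a r : size (vblock a r) = r.+2.
Proof. by rewrite /= size_map size_iota. Qed.

Lemma vblock_cons q a r :
  [seq (q :: x.1, x.2) | x <- vblock a r] = vblock (q :: a) r.
Proof. by rewrite /vblock /= -map_comp. Qed.

Lemma vblock_uniq a r : uniq (vblock a r).
Proof.
rewrite /= inE map_inj_uniq ?iota_uniq; last first.
  by move=> x y [] /rcons_inj [].
rewrite andbT; apply/andP; split; last by apply/mapP => -[].
by rewrite negb_or; apply/andP; split; [apply/eqP => -[] | apply/mapP => -[]].
Qed.

(** The address of the vertex can be read off from each letter of its block, so blocks at different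
    addresses have no letter in common. *)
Lemma vblock_owner a r x : x \in vblock a r ->
  (if x.2 == 2%N then take (size x.1).-1 x.1 else x.1) = a.
Proof.
rewrite !inE => /or3P [/eqP ->|/eqP ->|/mapP [c _ ->]] //=.
by rewrite size_rcons /= -cats1 take_size_cat.
Qed.

Lemma vblock_disj a r b s : a != b -> uniq (vblock a r ++ vblock b s).
Proof.
move=> neq; rewrite cat_uniq !vblock_uniq andbT; apply/hasPn => x /vblock_owner xb.
by apply/negP => /vblock_owner xa; move: neq; rewrite -xa -xb eqxx.
Qed.

(** The three shapes of forest that occur: a blow-up of the white vertex has one black vertex, and a
    second blow-up yields two black vertices, side by side or one above the other. The arguments are
    the leaf labels in planar order. *)
Definition corolla (a xs b : seq nat) : forest :=
  map Leaf a ++ Node (map Leaf xs) :: map Leaf b.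

Definition two_corollas (a xs b ys c : seq nat) : forest :=
  map Leaf a ++ Node (map Leaf xs) :: corolla b ys c.

Definition nested_corollas (a xs ys zs b : seq nat) : forest :=
  map Leaf a ++ Node (corolla xs ys zs) :: map Leaf b.

Lemma tword_node ts :
  tword (Node ts) = vblock [::] (size ts) ++ branches_from 0 (map tword ts).
Proof. by []. Qed.

Lemma tword_leaves xs : tword (Node (map Leaf xs)) = vblock [::] (size xs).
Proof.
by rewrite /= size_map [branches _](branches_from_word_leaves 0 xs) cats0.
Qed.

Lemma fword_corolla_from k a xs b :
  branches_from k (map tword (corolla a xs b)) = vblock [:: (k + size a)%N] (size xs).
Proof.
rewrite map_cat branches_from_cat branches_from_word_leaves size_map size_map.
rewrite map_cons branches_from_cons tword_leaves.
by rewrite branches_from_word_leaves cats0 vblock_cons.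
Qed.

Lemma fword_corolla a xs b : fword (corolla a xs b) = vblock [:: size a] (size xs).
Proof. exact: (fword_corolla_from 0). Qed.

Lemma fword_two a xs b ys c : fword (two_corollas a xs b ys c) =
  vblock [:: size a] (size xs) ++ vblock [:: (size a + size b).+1] (size ys).
Proof.
rewrite /fword -[branches _]/(branches_from 0 _).
rewrite map_cat branches_from_cat branches_from_word_leaves size_map size_map.
rewrite map_cons branches_from_cons tword_leaves.
by rewrite fword_corolla_from vblock_cons.
Qed.

Lemma size_corolla a xs b : size (corolla a xs b) = (size a + size b).+1.
Proof. by rewrite size_cat /= !size_map addnS. Qed.

Lemma fword_nested a xs ys zs b : fword (nested_corollas a xs ys zs b) =
  vblock [:: size a] (size xs + size zs).+1 ++ vblock [:: size a; size xs] (size ys).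
Proof.
rewrite /fword -[branches _]/(branches_from 0 _).
rewrite map_cat branches_from_cat branches_from_word_leaves size_map size_map.
rewrite map_cons branches_from_cons branches_from_word_leaves cats0.
rewrite tword_node fword_corolla_from size_corolla.
by rewrite map_cat !vblock_cons.
Qed.

Lemma fleaves_corolla a xs b : fleaves (corolla a xs b) =
  zip ([seq [:: i] | i <- iota 0 (size a)] ++
       [seq [:: size a; c] | c <- iota 0 (size xs)] ++
       [seq [:: i] | i <- iota (size a).+1 (size b)]) (a ++ xs ++ b).
Proof.
rewrite /fleaves -[branches _]/(branches_from 0 _).
rewrite map_cat branches_from_cat branches_from_leaves size_map size_map.
rewrite map_cons branches_from_cons branches_from_leaves [tleaves _]/=.
rewrite [branches _](branches_from_leaves 0) !zip_cat ?size_map ?size_iota //.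
have gen (A : seq (seq nat)) (L : seq nat) q :
    [seq (q :: x.1, x.2) | x <- zip A L] = zip (map (cons q) A) L.
  by elim: A L => [|x A IH] [|y L] //=; rewrite IH.
by congr (_ ++ (_ ++ _)); rewrite gen -map_comp.
Qed.

(** * Blow-ups of the white vertex and their signs *)

Lemma white_blow_nowrap n r j : (j + r <= n)%N ->
  white_blow n r j = corolla (iota 0 j) (iota j r) (iota (j + r) (n - (j + r))).
Proof.
move=> h; rewrite /white_blow h; congr (_ ++ Node (map _ _) :: _).
rewrite -[in RHS](addn0 j) iotaDl. apply/eq_in_map => c; rewrite mem_iota => hc.
by rewrite modn_small //; lia.
Qed.

Lemma white_blow_wrap n r j : (n < j + r)%N -> (j < n)%N -> (r <= n)%N ->
  white_blow n r j =
  corolla [::] (iota j (n - j) ++ iota 0 (j + r - n)) (iota (j + r - n) (n - r)).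
Proof.
move=> h ltj ler; rewrite /white_blow leqNgt h /=; congr (Node (map _ _) :: _).
have {1}-> : r = (n - j + (j + r - n))%N by lia.
rewrite iotaD add0n map_cat; congr cat.
  rewrite -[X in _ = iota X _]addn0 iotaDl; apply/eq_in_map => c; rewrite mem_iota => hc.
  by rewrite modn_small //; lia.
rewrite -[X in iota X _]addn0 iotaDl -map_comp -[RHS]map_id; apply/eq_in_map => c.
rewrite mem_iota => hc /=; have -> : (j + (n - j + c) = n + c)%N by lia.
by rewrite modnDl modn_small //; lia.
Qed.

Definition white_letter (l : nat) : letter := ([:: l], 2%N).

Lemma white_wordE n : white_word n = ([::], 0%N) :: map white_letter (iota 0 n).
Proof. by []. Qed.

Lemma white_letter_inj : injective white_letter.
Proof. by move=> i j []. Qed.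

Lemma white_collapse_map F A L :
  fleaves F = zip A L -> size A = size L -> uniq A ->
  [seq white_collapse_letter F (x, 2%N) | x <- A] = map white_letter L.
Proof.
move=> FE sE uA; have s1 : [seq y.1 | y <- fleaves F] = A.
  by rewrite FE -/(unzip1 _) unzip1_zip // sE.
have s2 : [seq y.2 | y <- fleaves F] = L by rewrite FE -/(unzip2 _) unzip2_zip // sE.
apply: (@eq_from_nth _ ([::], 0%N)); rewrite !size_map // => i hi.
rewrite (nth_map [::]) // (nth_map 0%N) -?sE // /white_collapse_letter s1 s2 /=.
by rewrite mem_nth // index_uniq.
Qed.

Lemma leaf_addrs_uniq q r k :
  uniq ([seq [:: i] | i <- iota 0 q] ++ [seq [:: q; c] | c <- iota 0 r] ++
        [seq [:: i] | i <- iota q.+1 k]).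
Proof.
rewrite !cat_uniq !map_inj_uniq ?iota_uniq; try by move=> x y [].
rewrite /= andbT; apply/andP; split; apply/hasPn => x.
  rewrite mem_cat => /orP [] /mapP [c hc ->]; apply/mapP => -[d hd] //.
  by case=> E; move: hc hd; rewrite !mem_iota E; lia.
by move=> /mapP [c hc ->]; apply/mapP => -[].
Qed.

Lemma white_collapse_corolla a xs b :
  let kap x := white_collapse_letter (corolla a xs b) (x, 2%N) in
  [/\ map kap [seq [:: i] | i <- iota 0 (size a)] = map white_letter a,
      map kap [seq [:: size a; c] | c <- iota 0 (size xs)] = map white_letter xs &
      map kap [seq [:: i] | i <- iota (size a).+1 (size b)] = map white_letter b].
Proof.
move=> kap.
have := white_collapse_map (fleaves_corolla a xs b) _ (leaf_addrs_uniq _ _ _).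
rewrite !size_cat !size_map !size_iota => /(_ erefl) /eqP.
rewrite !map_cat !eqseq_cat ?size_map ?size_iota //.
by case/and3P => /eqP ? /eqP ? /eqP ?.
Qed.

Lemma sign_odd n : (-1) ^+ n = (-1) ^+ odd n :> int.
Proof. by rewrite signr_odd. Qed.

(** Bringing the four letters of the collapsed edge to the front costs [- (-1) ^+ size a]. The
    letters left over, once renamed, list the leaves as [xs ++ a ++ b], and the second factor
    compares this order with that of [white_word]. *)
Lemma white_sign_corolla n a xs b : perm_eq (xs ++ a ++ b) (iota 0 n) ->
  let F := corolla a xs b in
  collapse_sign (fword F ++ white_word (size F)) (white_word n) [:: size a]
    (white_collapse_letter F) =
  - (-1) ^+ size a * (wsg (([::], 0%N) :: map white_letter (xs ++ a ++ b)) *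
                      wsg (white_word n)).
Proof.
move=> pe /=; rewrite /collapse_sign fword_corolla size_corolla white_wordE.
set q := size a; set r := size xs; set k := size b.
set w := ([::], 0%N); pose v := ([:: q], 0%N) : letter.
pose o := ([:: q], 1%N) : letter; pose xq := ([:: q], 2%N) : letter.
pose I := [seq ([:: q; c], 2%N) : letter | c <- iota 0 r].
pose X0 := map white_letter (iota 0 q).
pose X1 := map white_letter (iota q.+1 k).
have XE : map white_letter (iota 0 (q + k).+1) = X0 ++ xq :: X1.
  by rewrite -addnS iotaD map_cat.
rewrite XE -[vblock _ _]/(v :: o :: I).
rewrite -/w -/v -/o -/xq.
have uu : uniq ((v :: o :: I) ++ w :: X0 ++ xq :: X1).
  have h := vblock_uniq [:: q] r.
  rewrite cat_uniq -[_ :: _ :: I]/(vblock [:: q] r) h /= -XE.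
  rewrite (map_inj_uniq white_letter_inj) iota_uniq andbT; apply/andP; split.
    rewrite negb_or; apply/andP; split.
      by apply/negP => /vblock_owner.
    apply/hasPn => x /mapP [c _ ->]; apply/negP => /vblock_owner //.
  by apply/mapP => -[].
have ye : [seq x <- (v :: o :: I) ++ w :: X0 ++ xq :: X1 | x \notin [:: w; v; xq; o]]
   = I ++ X0 ++ X1.
  rewrite filter_cat /= !inE !eqxx /= ?orbT /= filter_cat /= !inE eqxx ?orbT /=.
  by congr (_ ++ (_ ++ _)); apply/all_filterP/allP => x /mapP [c hc ->];
    apply/negP; rewrite !inE => /or4P [] /eqP [] // E; move: hc;
    rewrite mem_iota E; lia.
rewrite ye.
have pe1 : perm_eq ([:: w; v; xq; o] ++ I ++ X0 ++ X1) ((v :: o :: I) ++ w :: X0 ++ xq :: X1).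
  by apply/permP => p; rewrite /= !count_cat /= !count_cat /=; lia.
rewrite word_signE //; last by rewrite (perm_uniq pe1).
have -> : wsg ([:: w; v; xq; o] ++ I ++ X0 ++ X1) =
  - (-1) ^+ q * wsg ((v :: o :: I) ++ w :: X0 ++ xq :: X1).
  have u1 : uniq ([:: w; v; xq; o] ++ I ++ X0 ++ X1) by rewrite (perm_uniq pe1).
  (* The white vertex [w] passes r + 3 letters and the half-edge [xq] passes r + q + 2, with total
     parity q + 1. *)
  have := @wsg_move [::] [:: w] ([:: v; xq; o] ++ I) (X0 ++ X1).
  rewrite /= -?catA => -> //.
  have := @wsg_move [:: v] [:: xq] (o :: I ++ w :: X0) X1.
  rewrite /= -?catA /= => ->.
    rewrite mulrA -exprD !mul1n size_cat /= !size_map !size_iota.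
    congr (_ * _); rewrite -[RHS]mulN1r -exprS sign_odd [RHS]sign_odd; congr (_ ^+ _).
    by congr nat_of_bool; lia.
  change (is_true (uniq (v :: xq :: o :: I ++ w :: X0 ++ X1))).
  rewrite (perm_uniq (s2 := [:: w; v; xq; o] ++ I ++ X0 ++ X1)) //.
  by apply/permP => p; rewrite /= !count_cat /= !count_cat /=; lia.
rewrite -[_ * wsg _ * wsg _]mulrA wsg_sq mulr1; congr (_ * _).
have [h0 h1 h2] := white_collapse_corolla a xs b.
have -> : w :: [seq white_collapse_letter (corolla a xs b) i | i <- I ++ X0 ++ X1] =
   w :: map white_letter (xs ++ a ++ b).
  by congr (_ :: _); rewrite !map_cat -h0 -h1 -h2 -!map_comp.
have pe2 : perm_eq (w :: map white_letter (xs ++ a ++ b)) (w :: map white_letter (iota 0 n)).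
  by rewrite perm_cons; apply: perm_map.
rewrite word_signE // (perm_uniq pe2) /= (map_inj_uniq white_letter_inj) iota_uniq andbT.
by apply/mapP => -[].
Qed.

Lemma white_sign_nowrap n r j : (j + r <= n)%N ->
  white_sign n r j = - (-1) ^+ (j * r.+1).
Proof.
move=> h; rewrite /white_sign /white_blow_pos h white_blow_nowrap //.
have iE : iota 0 n = iota 0 j ++ iota j r ++ iota (j + r) (n - (j + r)).
  have {1}-> : n = (j + (r + (n - (j + r))))%N by lia.
  by rewrite !iotaD add0n.
have pe : perm_eq (iota j r ++ iota 0 j ++ iota (j + r) (n - (j + r))) (iota 0 n).
  by rewrite iE perm_catCA.
have := white_sign_corolla pe; rewrite /= size_iota => ->.
rewrite white_wordE iE !map_cat.
have := @wsg_move [:: ([::], 0%N)] (map white_letter (iota j r))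
  (map white_letter (iota 0 j)) (map white_letter (iota (j + r) (n - (j + r)))).
rewrite /= => ->.
  rewrite -[_ * _ * wsg _]mulrA wsg_sq mulr1 !size_map !size_iota.
  by rewrite mulNr -exprD mulnS mulnC.
rewrite -!map_cat (perm_uniq (perm_map white_letter pe)).
rewrite (perm_mem (perm_map white_letter pe)).
rewrite (map_inj_uniq white_letter_inj) iota_uniq andbT.
by apply/mapP => -[].
Qed.

(** The new tree comes first here, so no leaf stands before it, and only the rotation of the leaves
    [j, ..., n - 1] past [0, ..., j - 1] contributes to the exponent. *)
Lemma white_sign_wrap n r j : (n < j + r)%N -> (j < n)%N -> (r <= n)%N ->
  white_sign n r j = - (-1) ^+ (j * (n - j)).
Proof.
move=> h ltj ler; rewrite /white_sign /white_blow_pos leqNgt h /= white_blow_wrap //.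
have iE : iota 0 j = iota 0 (j + r - n) ++ iota (j + r - n) (n - r).
  have {1}-> : j = (j + r - n + (n - r))%N by lia.
  by rewrite !iotaD add0n.
have iE2 : iota 0 n = iota 0 j ++ iota j (n - j).
  have {1}-> : n = (j + (n - j))%N by lia.
  by rewrite !iotaD add0n.
have pe : perm_eq ((iota j (n - j) ++ iota 0 (j + r - n)) ++ [::] ++ iota (j + r - n) (n - r))
   (iota 0 n).
  by rewrite -catA /= -iE iE2 perm_catC.
have := white_sign_corolla pe; rewrite [size [::]]/= => ->.
rewrite /= white_wordE iE2 -catA -iE !map_cat.
have := @wsg_move [:: ([::], 0%N)] (map white_letter (iota j (n - j)))
  (map white_letter (iota 0 j)) [::].
rewrite /= !cats0 => ->.
  rewrite -[_ * _ * wsg _]mulrA wsg_sq mulr1 !size_map !size_iota.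
  by rewrite mulN1r mulnC.
rewrite -catA /= -iE in pe.
rewrite -!map_cat (perm_uniq (perm_map white_letter pe)).
rewrite (perm_mem (perm_map white_letter pe)).
rewrite (map_inj_uniq white_letter_inj) iota_uniq andbT.
by apply/mapP => -[].
Qed.

(** * Blow-ups and grafts of corollas *)

Lemma blow_in_leaves (ts : seq ptree) k (s : seq nat) :
  flatten [seq [seq (set_nth (Leaf 0) ts ib.1 x.1, ib.1 :: x.2) | x <- ib.2] |
           ib <- zip (iota k (size s)) (map tblow (map Leaf s))] = [::].
Proof. by elim: s k => //= x s IH k; rewrite IH. Qed.

Lemma split_root_leaves xs : split_root (map Leaf xs) =
  [seq (corolla (take p xs) (take s (drop p xs)) (drop (p + s) xs), [:: p]) |
    s <- iota 2 (size xs - 2), p <- iota 0 (size xs - s).+1].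
Proof.
rewrite /split_root size_map; congr flatten; apply: eq_map => s; apply: eq_map => p.
by rewrite /corolla -!map_drop -!map_take.
Qed.

Lemma fblow_corolla a xs b : fblow (corolla a xs b) =
  [seq (nested_corollas a (take p xs) (take s (drop p xs)) (drop (p + s) xs) b,
        [:: size a; p]) |
    s <- iota 2 (size xs - 2), p <- iota 0 (size xs - s).+1].
Proof.
rewrite /fblow /blow_in size_corolla -addnS map_cat iotaD zip_cat ?size_map ?size_iota //.
rewrite map_cat flatten_cat blow_in_leaves /= blow_in_leaves cats0 add0n.
rewrite /blow_in size_map blow_in_leaves cats0 split_root_leaves !map_flatten -!map_comp.
congr flatten; apply: eq_map => s; rewrite -[LHS]map_comp -[LHS]map_comp; apply: eq_map => p /=.
congr pair; rewrite /nested_corollas set_nthE size_corolla ltnS leq_addr.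
have sa : size a = size (map Leaf a) by rewrite size_map.
by rewrite {1 2}sa take_size_cat // drop_cat ltnNge leqnSn /= subSnn /= drop0.
Qed.

Lemma collapse_branch_lt q p s c k : (c < p)%N ->
  collapse_letter [:: q; p] s ([:: q; c], k) = ([:: q; c], k).
Proof. by move=> h; rewrite /collapse_letter /= eqxx h. Qed.

Lemma collapse_branch_gt q p s c k : (p < c)%N ->
  collapse_letter [:: q; p] s ([:: q; c], k) = ([:: q; (c + s).-1], k).
Proof. by move=> h; rewrite /collapse_letter /= eqxx ltnNge (ltnW h) /= h. Qed.

Lemma collapse_branch_eq q p s c k :
  collapse_letter [:: q; p] s ([:: q; p; c], k) = ([:: q; (p + c)%N], k).
Proof. by rewrite /collapse_letter /= eqxx ltnn. Qed.

Lemma wsg_moveE a b c d k u v : u = a ++ b ++ c ++ d -> v = a ++ c ++ b ++ d ->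
  odd k = odd (size b * size c) -> uniq u -> wsg u = (-1) ^+ k * wsg v.
Proof.
by move=> -> -> ek uu; rewrite wsg_move // -signr_odd -ek signr_odd.
Qed.

(** Extracting the new edge costs [size x]. After the collapse the half-edges of [y] stand behind
    those of [z], and putting them back in planar order costs [size y * size z]. *)
Lemma blow_sign_nested a x y z b :
  blow_sign (corolla a (x ++ y ++ z) b) (nested_corollas a x y z b)
    [:: size a; size x] = (-1) ^+ (size x + size y * size z).
Proof.
rewrite /blow_sign /collapse_sign fword_corolla fword_nested.
have -> : size (children_at (nested_corollas a x y z b) [:: size a; size x]) = size y.
  rewrite /= /nested_corollas nth_cat size_map ltnn subnn /=.
  by rewrite /corolla nth_cat size_map ltnn subnn /= size_map.
rewrite !size_cat; set q := size a; set p := size x; set s := size y; set t := size z.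
pose v := ([:: q], 0%N) : letter; pose o := ([:: q], 1%N) : letter.
pose v2 := ([:: q; p], 0%N) : letter; pose o2 := ([:: q; p], 1%N) : letter.
pose l c := ([:: q; c], 2%N) : letter; pose xp := l p.
pose X0 := map l (iota 0 p); pose X1 := map l (iota p.+1 t).
pose K := [seq ([:: q; p; c], 2%N) : letter | c <- iota 0 s].
have nq : [:: q] != [:: q; p] by rewrite eqseq_cons andbF.
have uu := vblock_disj (p + t).+1 s nq.
have E1 : vblock [:: q] (p + t).+1 ++ vblock [:: q; p] s =
  v :: o :: X0 ++ xp :: X1 ++ v2 :: o2 :: K.
  by rewrite -addnS /vblock iotaD map_cat /= -catA.
rewrite E1 in uu *.
rewrite -/v -/v2 -/o -/o2 -/(l p) -/xp.
have -> : [seq x <- v :: o :: X0 ++ xp :: X1 ++ v2 :: o2 :: K | x \notin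
     [:: (take (size [:: q; p]).-1 [:: q; p], 0%N); v2; xp; o2]] = o :: X0 ++ X1 ++ K.
  rewrite [take _ _]/= -/v; set e := [:: v; v2; xp; o2].
  have -> : v :: o :: X0 ++ xp :: X1 ++ v2 :: o2 :: K =
    [:: v; o] ++ X0 ++ [:: xp] ++ X1 ++ [:: v2; o2] ++ K by [].
  have oe : o \notin e by apply/negP; rewrite !inE => /or4P [] /eqP [].
  have f1 : filter (fun u => u \notin e) [:: v; o] = [:: o].
    by rewrite /= oe inE eqxx.
  have f2 : filter (fun u => u \notin e) [:: xp] = [::].
    by rewrite /= !inE eqxx !orbT.
  have f3 : filter (fun u => u \notin e) [:: v2; o2] = [::].
    by rewrite /= !inE !eqxx !orbT.
  have f4 (T : seq letter) : (forall u, u \in T -> u \notin e) ->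
      filter (fun u => u \notin e) T = T by move=> /allP /all_filterP.
  by rewrite !filter_cat f1 f2 f3 !f4 // => u /mapP [c hc ->];
    apply/negP; rewrite !inE => /or4P [] /eqP [] // E; move: hc;
    rewrite mem_iota E; lia.
have pe : perm_eq ([:: v; v2; xp; o2] ++ o :: X0 ++ X1 ++ K)
   (v :: o :: X0 ++ xp :: X1 ++ v2 :: o2 :: K).
  by apply/permP => f; rewrite /= !count_cat /= ?count_cat /=; lia.
have sX0 : size X0 = p by rewrite size_map size_iota.
have sX1 : size X1 = t by rewrite size_map size_iota.
rewrite word_signE //; last by rewrite (perm_uniq pe).
have -> : wsg ([:: v; v2; xp; o2] ++ o :: X0 ++ X1 ++ K) =
   (-1) ^+ p * wsg (v :: o :: X0 ++ xp :: X1 ++ v2 :: o2 :: K).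
  have u1 : uniq ([:: v; v2; xp; o2] ++ o :: X0 ++ X1 ++ K) by rewrite (perm_uniq pe).
  pose w1 := v :: xp :: o2 :: o :: X0 ++ X1 ++ v2 :: K.
  pose w2 := v :: o2 :: o :: X0 ++ xp :: X1 ++ v2 :: K.
  have p1 : perm_eq w1 ([:: v; v2; xp; o2] ++ o :: X0 ++ X1 ++ K).
    by apply/permP => f; rewrite /= !count_cat /= ?count_cat /=; lia.
  have p2 : perm_eq w2 ([:: v; v2; xp; o2] ++ o :: X0 ++ X1 ++ K).
    by apply/permP => f; rewrite /= !count_cat /= ?count_cat /=; lia.
  (* The letters [v2], [xp] and [o2] are moved one after the other, past p + t + 3, p + 2 and p + t
     + 3 letters; the total has the parity of p. *)
  have m1 : wsg ([:: v; v2; xp; o2] ++ o :: X0 ++ X1 ++ K) = (-1) ^+ (p + t).+3 * wsg w1.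
    apply: (@wsg_moveE [:: v] [:: v2] (xp :: o2 :: o :: X0 ++ X1) K) => //.
    - by rewrite /= -catA.
    - by rewrite /w1 /= -catA.
    - by rewrite /= size_cat sX0 sX1; lia.
  have m2 : wsg w1 = (-1) ^+ p.+2 * wsg w2.
    apply: (@wsg_moveE [:: v] [:: xp] (o2 :: o :: X0) (X1 ++ v2 :: K)) => //.
    - by rewrite /= sX0; lia.
    - by rewrite (perm_uniq p1).
  have m3 : wsg w2 = (-1) ^+ (p + t).+3 * wsg (v :: o :: X0 ++ xp :: X1 ++ v2 :: o2 :: K).
    apply: (@wsg_moveE [:: v] [:: o2] (o :: X0 ++ xp :: X1 ++ [:: v2]) K) => //.
    - by rewrite /w2 /= -!catA /= -catA.
    - by rewrite /= -!catA /= -catA.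
    - by rewrite /= !size_cat /= size_cat sX0 sX1 /=; lia.
    - by rewrite (perm_uniq p2).
  have e : (-1) ^+ (p + t).+3 * ((-1) ^+ p.+2 * (-1) ^+ (p + t).+3) = (-1) ^+ p :> int.
    rewrite -!exprD sign_odd [RHS]sign_odd; congr (_ ^+ _).
    by congr nat_of_bool; lia.
  by rewrite m1 m2 m3 -e !mulrA.
rewrite -[_ * wsg _ * wsg _]mulrA wsg_sq mulr1 exprD; congr (_ * _).
pose X1' := map l (iota (p + s) t); pose K' := map l (iota p s).
have -> : [seq collapse_letter [:: q; p] s i | i <- o :: X0 ++ X1 ++ K] =
   o :: X0 ++ X1' ++ K'.
  rewrite /= !map_cat -!map_comp; congr (_ :: _ ++ (_ ++ _)).
  - by rewrite /collapse_letter /= eqxx.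
  - by apply/eq_in_map => c; rewrite mem_iota => hc; exact: collapse_branch_lt.
  - rewrite /X1' (_ : p + s = (p + s).+1 - 1)%N 1?subn1 //.
    apply: (@eq_from_nth _ v); rewrite !size_map !size_iota // => i hi.
    rewrite !(nth_map 0%N) ?size_iota // !nth_iota //.
    rewrite [LHS]collapse_branch_gt ?leq_addr //.
    by rewrite /l; congr ([:: _; _], _); lia.
  - rewrite /K' -[in RHS](addn0 p) iotaDl -map_comp; apply/eq_in_map => c _.
    exact: collapse_branch_eq.
have E2 : vblock [:: q] (p + (s + t)) = v :: o :: X0 ++ K' ++ X1'.
  by rewrite /vblock !iotaD !map_cat.
have uv := vblock_uniq [:: q] (p + (s + t)); rewrite E2 in uv *.
have pe2 : perm_eq (v :: o :: X0 ++ X1' ++ K') (v :: o :: X0 ++ K' ++ X1').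
  by apply/permP => f; rewrite /= !count_cat /=; lia.
rewrite word_signE //; last by rewrite (perm_uniq pe2).
have := @wsg_move (v :: o :: X0) X1' K' [::].
rewrite !cats0 => ->; last by rewrite (perm_uniq pe2).
by rewrite -mulrA wsg_sq mulr1 !size_map !size_iota mulnC.
Qed.

Lemma leaf_addr_zip F A L i : fleaves F = zip A L -> size A = size L -> i \in L ->
  leaf_addr F i = nth [::] A (index i L).
Proof.
move=> FE sE iL; rewrite /leaf_addr FE -/(unzip2 _) unzip2_zip ?sE //.
by rewrite nth_zip.
Qed.

Lemma leaf_addr_left c q d xs b : q \notin c ->
  leaf_addr (corolla (c ++ q :: d) xs b) q = [:: size c].
Proof.
move=> qc; rewrite (leaf_addr_zip (fleaves_corolla _ _ _)); first last.
- by rewrite !mem_cat mem_head orbT.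
- by rewrite !size_cat !size_map !size_iota.
rewrite !index_cat (negPf qc) mem_cat mem_head orbT /= eqxx addn0.
have h : (size c < size (c ++ q :: d))%N by rewrite size_cat /=; lia.
by rewrite nth_cat size_map size_iota h (nth_map 0%N) ?size_iota // nth_iota.
Qed.

Lemma leaf_addr_middle a c q d b : q \notin a -> q \notin c ->
  leaf_addr (corolla a (c ++ q :: d) b) q = [:: size a; size c].
Proof.
move=> qa qc; rewrite (leaf_addr_zip (fleaves_corolla _ _ _)); first last.
- by rewrite !mem_cat mem_head !orbT.
- by rewrite !size_cat !size_map !size_iota.
rewrite !index_cat (negPf qc) (negPf qa) mem_cat mem_head orbT /= eqxx addn0.
have h : (size c < size (c ++ q :: d))%N by rewrite size_cat /=; lia.
rewrite nth_cat size_map size_iota ltnNge leq_addr /= addKn.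
by rewrite nth_cat size_map size_iota h (nth_map 0%N) ?size_iota // nth_iota.
Qed.

Lemma leaf_addr_right a xs c q d : q \notin a -> q \notin xs -> q \notin c ->
  leaf_addr (corolla a xs (c ++ q :: d)) q = [:: (size a + size c).+1].
Proof.
move=> qa qx qc; rewrite (leaf_addr_zip (fleaves_corolla _ _ _)); first last.
- by rewrite !mem_cat mem_head !orbT.
- by rewrite !size_cat !size_map !size_iota.
rewrite !index_cat (negPf qc) (negPf qa) (negPf qx) /= eqxx addn0.
have h : (size c < size (c ++ q :: d))%N by rewrite size_cat /=; lia.
rewrite nth_cat size_map size_iota ltnNge leq_addr /= addKn.
rewrite nth_cat size_map size_iota ltnNge leq_addr /= addKn.
by rewrite (nth_map 0%N) ?size_iota // nth_iota // addSn.
Qed.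

(** The only vertex of the first corolla belongs to the tree numbered [size a1], so it lands on the
    leaf of that label; the graft sign then compares two vertex blocks. *)
Lemma graft_sign_corolla a1 x1 b1 a2 x2 b2 :
  graft_sign (corolla a1 x1 b1) (corolla a2 x2 b2) =
  word_sign (vblock (leaf_addr (corolla a2 x2 b2) (size a1)) (size x1) ++
             vblock [:: size a2] (size x2))
    (fword (graft (corolla a1 x1 b1) (corolla a2 x2 b2))).
Proof.
rewrite /graft_sign !fword_corolla; congr (word_sign (_ ++ _) _).
rewrite /vblock /= -map_comp /graft_letter /= !cats0; congr (_ :: _ :: _).
by apply: eq_map => c /=; rewrite cats1.
Qed.

Lemma word_sign_refl u : uniq u -> word_sign u u = 1.
Proof. by move=> uu; rewrite word_signE // wsg_sq. Qed.

Lemma word_sign_blocks a r b s : a != b ->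
  word_sign (vblock a r ++ vblock b s) (vblock b s ++ vblock a r) = (-1) ^+ (r * s).
Proof.
move=> neq; have u := vblock_disj r s neq.
have pe : perm_eq (vblock a r ++ vblock b s) (vblock b s ++ vblock a r).
  by apply/permPl; exact: perm_catC.
rewrite (word_signE u pe).
have -> : wsg (vblock a r ++ vblock b s) = (-1) ^+ (r * s) * wsg (vblock b s ++ vblock a r).
  apply: (@wsg_moveE [::] (vblock a r) (vblock b s) [::]); rewrite ?cats0 //.
  by rewrite !size_vblock !oddM /= !negbK.
by rewrite -mulrA wsg_sq mulr1.
Qed.

Lemma graft_corolla F a x b :
  graft F (corolla a x b) =
  [seq nth (Leaf 0) F i | i <- a] ++ Node [seq nth (Leaf 0) F i | i <- x] ::
  [seq nth (Leaf 0) F i | i <- b].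
Proof. by rewrite /graft map_cat /= -!map_comp. Qed.

Section Nowrap.
Variables (n r j : nat).
Hypothesis jr : (j + r <= n)%N.
Let F := white_blow n r j.

Lemma nowrap_before x y : (x + y <= j)%N ->
  [seq nth (Leaf 0) F i | i <- iota x y] = map Leaf (iota x y).
Proof.
move=> h; apply/eq_in_map => i; rewrite mem_iota => hi.
rewrite /F white_blow_nowrap // nth_cat size_map size_iota.
have -> : (i < j)%N by lia.
by rewrite (nth_map 0%N) ?size_iota ?nth_iota //; lia.
Qed.

Lemma nowrap_at : nth (Leaf 0) F j = Node (map Leaf (iota j r)).
Proof. by rewrite /F white_blow_nowrap // nth_cat size_map size_iota ltnn subnn. Qed.

(** A block of [r] leaves has become the single root [j], so the labels behind it are shifted by r -
    1. *)
Lemma nowrap_after x y : (j < x)%N -> (x + y <= (n - r).+1)%N ->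
  [seq nth (Leaf 0) F i | i <- iota x y] = map Leaf (iota (x + r).-1 y).
Proof.
move=> h h'; apply: (@eq_from_nth _ (Leaf 0)); rewrite !size_map !size_iota // => i hi.
rewrite !(nth_map 0%N) ?size_iota // !nth_iota //.
rewrite /F white_blow_nowrap // nth_cat size_map size_iota.
have -> : (x + i < j)%N = false by lia.
have -> : (x + i - j = (x + i - j).-1.+1)%N by lia.
by rewrite /= (nth_map 0%N) ?size_iota ?nth_iota //; [congr Leaf|..]; lia.
Qed.
End Nowrap.

Section Wrap.
Variables (n r j : nat).
Hypotheses (jr : (n < j + r)%N) (ltj : (j < n)%N) (ler : (r <= n)%N).
Let F := white_blow n r j.

Lemma wrap_at :
  nth (Leaf 0) F 0 = Node (map Leaf (iota j (n - j) ++ iota 0 (j + r - n))).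
Proof. by rewrite /F white_blow_wrap. Qed.

Lemma wrap_after x y : (0 < x)%N -> (x + y <= (n - r).+1)%N ->
  [seq nth (Leaf 0) F i | i <- iota x y] = map Leaf (iota (x.-1 + (j + r - n)) y).
Proof.
move=> h h'; apply: (@eq_from_nth _ (Leaf 0)); rewrite !size_map !size_iota // => i hi.
rewrite !(nth_map 0%N) ?size_iota // !nth_iota //.
rewrite /F white_blow_wrap //.
have -> : (x + i = (x + i).-1.+1)%N by lia.
by rewrite /= (nth_map 0%N) ?size_iota ?nth_iota //; [congr Leaf|..]; lia.
Qed.
End Wrap.

(** * Two vertices on the white vertex *)

Definition comp_forest N r1 j1 r2 j2 : forest :=
  graft (white_blow N r1 j1) (white_blow (N - r1).+1 r2 j2).

(** The factor [(-1) ^+ r1.+1] is the sign [ksgn (n - l)] of the Maurer-Cartan equation, with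
    [N = n.+1] and [r1 = N - l]. *)
Definition comp_sign N r1 j1 r2 j2 : int :=
  (-1) ^+ r1.+1 * (white_sign N r1 j1 * white_sign (N - r1).+1 r2 j2 *
    graft_sign (white_blow N r1 j1) (white_blow (N - r1).+1 r2 j2)).

Lemma iota_split x y u v : (x + y = u)%N -> forall w, (y + v = w)%N ->
  iota x w = iota x y ++ iota u v.
Proof. by move=> <- w <-; rewrite iotaD. Qed.

Lemma iota_eq x y u v : x = u -> y = v -> iota x y = iota u v.
Proof. by move=> -> ->. Qed.

Lemma notin_iota i x y : (i < x)%N || (x + y <= i)%N -> i \notin iota x y.
Proof. by rewrite mem_iota; lia. Qed.

Lemma sign_opp m n : odd m = ~~ odd n -> (-1) ^+ m = - (-1) ^+ n :> int.
Proof. by move=> e; rewrite sign_odd e signrN signr_odd. Qed.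

(* Here a and b are the labels of the first leaves of the two blocks moved to    *)
(* black vertices, of r1 and r2 leaves; in the section Cycle the first block     *)
(* goes past the start leaf.                                                     *)
Section Disjoint.
Variables (N r1 r2 a b : nat).
Hypotheses (r1_gt0 : (0 < r1)%N) (r2_gt0 : (0 < r2)%N).

Section Line.
Hypotheses (ab : (a + r1 <= b)%N) (bN : (b + r2 <= N)%N).

Definition line_forest := two_corollas (iota 0 a) (iota a r1)
  (iota (a + r1) (b - (a + r1))) (iota b r2) (iota (b + r2) (N - (b + r2))).

Lemma line_first_forest : comp_forest N r1 a r2 (b - r1).+1 = line_forest.
Proof.
rewrite /comp_forest (@white_blow_nowrap (N - r1).+1); last lia.
rewrite graft_corolla (@iota_split 0 a a (b - r1 - a).+1); try lia.
rewrite map_cat map_cons nowrap_before ?nowrap_at; try lia.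
rewrite !nowrap_after; try lia.
rewrite -catA.
rewrite -[LHS]/(two_corollas (iota _ _) (iota _ _) (iota _ _) (iota _ _) (iota _ _)).
by congr two_corollas; apply: iota_eq; lia.
Qed.

Lemma line_first_sign : comp_sign N r1 a r2 (b - r1).+1 =
  (-1) ^+ (r1.+1 + a * r1.+1 + (b - r1).+1 * r2.+1).
Proof.
rewrite /comp_sign white_sign_nowrap 1?white_sign_nowrap; try lia.
have := line_first_forest; rewrite /comp_forest => fE.
rewrite (@white_blow_nowrap N) ?(@white_blow_nowrap (N - r1).+1) in fE *; try lia.
rewrite graft_sign_corolla fE fword_two !size_iota.
rewrite (@iota_split 0 a a (b - r1 - a).+1); try lia.
rewrite leaf_addr_left ?notin_iota //; last lia.
rewrite size_iota.
have -> : (a + (b - (a + r1))).+1 = (b - r1).+1 by lia.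
rewrite word_sign_refl; first by rewrite mulr1 mulrNN -!exprD addnA.
by apply: vblock_disj; rewrite eqseq_cons; lia.
Qed.

Lemma line_second_forest : comp_forest N r2 b r1 a = line_forest.
Proof.
rewrite /comp_forest (@white_blow_nowrap (N - r2).+1); last lia.
rewrite graft_corolla (@iota_split (a + r1) (b - (a + r1)) b (N - (b + r2)).+1); try lia.
rewrite map_cat map_cons (nowrap_before bN (x := 0)) ?(nowrap_before bN (x := a))
  ?(nowrap_before bN (x := a + r1)) ?nowrap_at; try lia.
rewrite nowrap_after; try lia.
rewrite -[LHS]/(two_corollas (iota _ _) (iota _ _) (iota _ _) (iota _ _) (iota _ _)).
by congr two_corollas; apply: iota_eq; lia.
Qed.

Lemma line_second_sign : comp_sign N r2 b r1 a =
  (-1) ^+ (r2.+1 + b * r2.+1 + a * r1.+1 + r2 * r1).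
Proof.
rewrite /comp_sign white_sign_nowrap 1?white_sign_nowrap; try lia.
have := line_second_forest; rewrite /comp_forest => fE.
rewrite (@white_blow_nowrap N) ?(@white_blow_nowrap (N - r2).+1) in fE *; try lia.
rewrite graft_sign_corolla fE fword_two !size_iota.
rewrite (@iota_split (a + r1) (b - (a + r1)) b (N - (b + r2)).+1); try lia.
rewrite [iota b (N - (b + r2)).+1]/= leaf_addr_right ?notin_iota //; try lia.
rewrite !size_iota word_sign_blocks; first by rewrite mulrNN -!exprD !addnA.
by rewrite eqseq_cons; lia.
Qed.

(** The exponents differ by r1 + r2 from the prefactors, r1 r2 from the exchange of the two vertex
    blocks, and (r1 + 1)(r2 + 1) from the shift of the later block by r1 - 1 places; the sum is
    always odd. *)
Lemma line_signs : comp_sign N r2 b r1 a = - comp_sign N r1 a r2 (b - r1).+1.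
Proof.
rewrite line_second_sign line_first_sign; apply: sign_opp.
by rewrite !(oddD, oddM, oddS, oddB) /=; [do 4 case: odd | lia].
Qed.
End Line.

Section Cycle.
Hypotheses (aN : (N < a + r1)%N) (ltaN : (a < N)%N) (r1N : (r1 <= N)%N).
Hypotheses (ab : (a + r1 - N <= b)%N) (ba : (b + r2 <= a)%N).

(** The tree through the start leaf is the first one, so the second block, beginning at leaf [b], is
    found at position [(b + N - (a + r1)).+1] once the first is contracted. *)
Definition cycle_forest := two_corollas [::] (iota a (N - a) ++ iota 0 (a + r1 - N))
  (iota (a + r1 - N) (b - (a + r1 - N))) (iota b r2) (iota (b + r2) (a - (b + r2))).

Lemma cycle_first_forest :
  comp_forest N r1 a r2 (b + N - (a + r1)).+1 = cycle_forest.
Proof.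
rewrite /comp_forest (@white_blow_nowrap (N - r1).+1); last lia.
rewrite graft_corolla [iota 0 _]/= map_cons wrap_at; try lia.
rewrite !wrap_after; try lia.
rewrite -[LHS]/(two_corollas [::] (_ ++ _) (iota _ _) (iota _ _) (iota _ _)).
by congr two_corollas; apply: iota_eq; lia.
Qed.

Lemma cycle_first_sign : comp_sign N r1 a r2 (b + N - (a + r1)).+1 =
  (-1) ^+ (r1.+1 + a * (N - a) + (b + N - (a + r1)).+1 * r2.+1).
Proof.
rewrite /comp_sign white_sign_wrap 1?white_sign_nowrap; try lia.
have := cycle_first_forest; rewrite /comp_forest => fE.
rewrite (@white_blow_wrap N) ?(@white_blow_nowrap (N - r1).+1) in fE *; try lia.
rewrite graft_sign_corolla fE fword_two size_cat !size_iota [size [::]]/=.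
rewrite (@leaf_addr_left [::]) //.
have -> : (N - a + (a + r1 - N) = r1)%N by lia.
have -> : (0 + (b - (a + r1 - N))).+1 = (b + N - (a + r1)).+1 by lia.
rewrite word_sign_refl; first by rewrite mulr1 mulrNN -!exprD addnA.
by apply: vblock_disj; rewrite eqseq_cons.
Qed.

Lemma cycle_second_forest : comp_forest N r2 b r1 (a - r2).+1 = cycle_forest.
Proof.
rewrite /comp_forest (@white_blow_wrap (N - r2).+1); try lia.
rewrite graft_corolla.
have -> : ((a - r2).+1 + r1 - (N - r2).+1 = a + r1 - N)%N by lia.
have -> : ((N - r2).+1 - (a - r2).+1 = N - a)%N by lia.
rewrite (@iota_split (a + r1 - N) (b - (a + r1 - N)) b (a - (b + r2)).+1); try lia.
have bN : (b + r2 <= N)%N by lia.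
rewrite !map_cat map_cons nowrap_at //.
rewrite (nowrap_before bN (x := 0)); last lia.
rewrite (nowrap_before bN (x := a + r1 - N)); last lia.
rewrite (nowrap_after bN (x := (a - r2).+1)); try lia.
rewrite (nowrap_after bN (x := b.+1)); try lia.
rewrite -map_cat -[LHS]/(two_corollas [::] (_ ++ _) (iota _ _) (iota _ _) (iota _ _)).
by congr (two_corollas _ (_ ++ _)); apply: iota_eq; lia.
Qed.

Lemma cycle_second_sign : comp_sign N r2 b r1 (a - r2).+1 =
  (-1) ^+ (r2.+1 + b * r2.+1 + (a - r2).+1 * (N - a) + r2 * r1).
Proof.
rewrite /comp_sign white_sign_nowrap 1?white_sign_wrap; try lia.
have := cycle_second_forest; rewrite /comp_forest => fE.
rewrite (@white_blow_nowrap N) ?(@white_blow_wrap (N - r2).+1) in fE *; try lia.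
rewrite graft_sign_corolla fE fword_two !size_cat !size_iota [size [::]]/=.
rewrite (@iota_split ((a - r2).+1 + r1 - (N - r2).+1) (b - (a + r1 - N)) b
  (a - (b + r2)).+1); try lia.
rewrite [iota b (a - (b + r2)).+1]/= leaf_addr_right ?mem_cat ?negb_or ?notin_iota //; try lia.
rewrite !size_iota [size [::]]/=.
have -> : ((N - r2).+1 - (a - r2).+1 + ((a - r2).+1 + r1 - (N - r2).+1) = r1)%N by lia.
have -> : (N - a + (a + r1 - N) = r1)%N by lia.
rewrite word_sign_blocks; last by rewrite eqseq_cons; lia.
have -> : ((N - r2).+1 - (a - r2).+1 = N - a)%N by lia.
by rewrite mulrNN -!exprD !addnA.
Qed.

Lemma cycle_signs :
  comp_sign N r2 b r1 (a - r2).+1 = - comp_sign N r1 a r2 (b + N - (a + r1)).+1.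
Proof.
rewrite cycle_second_sign cycle_first_sign; apply: sign_opp.
have o1 : odd (b + N - (a + r1) + r1) = odd (b + (N - a)) by congr odd; lia.
have oa : odd (a - r2 + r2) = odd a by congr odd; lia.
move: o1 oa; rewrite !oddD !oddM !oddS.
by case: (odd b); case: (odd r1); case: (odd r2); case: (odd a);
   case: (odd (N - a)); case: (odd (a - r2)); case: (odd (b + N - _)).
Qed.
End Cycle.
End Disjoint.

(** * Nested vertices *)

Section Nested.
Variables (N R j s p : nat).
Hypotheses (s_gt0 : (0 < s)%N) (psR : (p + s <= R)%N) (RN : (R <= N)%N) (jN : (j < N)%N).

(** The coefficient, in the differential of [dL], of the forest in which a block of [s] leaves is
    split off at position [p] of a block of [R] leaves beginning at leaf [j]: the sign of the first
    blow-up times that of [blow_sign_nested]. *)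
Definition cut_sign : int := white_sign N R j * (-1) ^+ (p + s * (R - (p + s))).

Section NoWrap.
Hypothesis jR : (j + R <= N)%N.

Let hin : (j + p + s <= N)%N. Proof. by lia. Qed.

Definition nested_nowrap := nested_corollas (iota 0 j) (iota j p) (iota (j + p) s)
  (iota (j + p + s) (R - (p + s))) (iota (j + R) (N - (j + R))).

Lemma nested_nowrap_forest : comp_forest N s (j + p) (R - s).+1 j = nested_nowrap.
Proof.
rewrite /comp_forest (@white_blow_nowrap (N - s).+1); last lia.
rewrite graft_corolla (@iota_split j p (j + p) (R - (p + s)).+1); try lia.
rewrite map_cat map_cons nowrap_at //.
rewrite (nowrap_before hin (x := 0)); last lia.
rewrite (nowrap_before hin (x := j)); last lia.
rewrite !(nowrap_after hin); try lia.
rewrite -[LHS]/(nested_corollas (iota _ _) (iota _ _) (iota _ _) (iota _ _) (iota _ _)).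
by congr nested_corollas; apply: iota_eq; lia.
Qed.

Lemma nested_nowrap_sign : comp_sign N s (j + p) (R - s).+1 j = cut_sign.
Proof.
rewrite /comp_sign /cut_sign !white_sign_nowrap; try lia.
have := nested_nowrap_forest; rewrite /comp_forest => fE.
rewrite (@white_blow_nowrap N) ?(@white_blow_nowrap (N - s).+1) in fE *; try lia.
rewrite graft_sign_corolla fE fword_nested !size_iota.
rewrite (@iota_split j p (j + p) (R - (p + s)).+1); try lia.
rewrite [iota (j + p) _.+1]/= leaf_addr_middle ?notin_iota //; try lia.
rewrite !size_iota.
have -> : (p + (R - (p + s))).+1 = (R - s).+1 by lia.
rewrite word_sign_blocks; last by rewrite eqseq_cons andbF.
rewrite mulrNN mulNr -!exprD; apply: sign_opp.
have : odd (R - (p + s) + (p + s)) = odd R by congr odd; lia.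
have : odd (R - s + s) = odd R by congr odd; lia.
rewrite !(oddD, oddM, oddS).
by case: (odd j); case: (odd p); case: (odd s); case: (odd R);
  case: (odd (R - s)); case: (odd (R - _)).
Qed.
End NoWrap.

Section Wrap.
Hypothesis jR : (N < j + R)%N.

Definition nested_wrap X Y Z := nested_corollas [::] X Y Z (iota (j + R - N) (N - R)).

Section Left.
Hypothesis hin : (j + p + s <= N)%N.

Lemma nested_left_forest : comp_forest N s (j + p) (R - s).+1 j =
  nested_wrap (iota j p) (iota (j + p) s)
    (iota (j + p + s) (N - (j + p + s)) ++ iota 0 (j + R - N)).
Proof.
rewrite /comp_forest (@white_blow_wrap (N - s).+1); try lia.
rewrite graft_corolla (@iota_split j p (j + p) (N - (j + p + s)).+1); try lia.
have -> : (j + (R - s).+1 - (N - s).+1 = j + R - N)%N by lia.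
rewrite !map_cat map_cons nowrap_at //.
rewrite (nowrap_before hin (x := 0)); last lia.
rewrite (nowrap_before hin (x := j)); last lia.
rewrite (nowrap_before hin (x := j + R - N)); last lia.
rewrite (nowrap_after hin (x := (j + p).+1)); try lia.
rewrite -catA cat_cons -map_cat.
rewrite -[LHS]/(nested_corollas [::] (iota _ _) (iota _ _) (iota _ _ ++ iota _ _) (iota _ _)).
by congr (nested_corollas _ _ _ (_ ++ _)); apply: iota_eq; lia.
Qed.

Lemma nested_left_sign : comp_sign N s (j + p) (R - s).+1 j = cut_sign.
Proof.
rewrite /comp_sign /cut_sign white_sign_nowrap ?white_sign_wrap; try lia.
have := nested_left_forest; rewrite /comp_forest => fE.
rewrite (@white_blow_nowrap N) ?(@white_blow_wrap (N - s).+1) in fE *; try lia.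
rewrite graft_sign_corolla fE fword_nested !size_cat !size_iota.
rewrite (@iota_split j p (j + p) (N - (j + p + s)).+1); try lia.
rewrite [iota (j + p) _.+1]/= -catA cat_cons leaf_addr_middle ?notin_iota //; try lia.
rewrite !size_iota [size [::]]/=.
have -> : (p + (N - (j + p + s) + (j + R - N))).+1 = (R - s).+1 by lia.
have -> : ((N - s).+1 - j + (j + (R - s).+1 - (N - s).+1) = (R - s).+1)%N by lia.
rewrite word_sign_blocks; last by rewrite eqseq_cons andbF.
rewrite mulrNN mulNr -!exprD; apply: sign_opp.
have : odd (R - (p + s) + (p + s)) = odd R by congr odd; lia.
have : odd (R - s + s) = odd R by congr odd; lia.
have : odd (N - j + j) = odd N by congr odd; lia.
have : odd ((N - s).+1 - j + s + j) = odd (N.+1) by congr odd; lia.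
rewrite !(oddD, oddM, oddS).
case: (odd j); case: (odd p); case: (odd s); case: (odd R); case: (odd N);
  by case: (odd (R - s)); case: (odd (R - _)); case: (odd (_ - j)); case: (odd (_ - j)).
Qed.
End Left.

Section Straddle.
Hypotheses (hin : (N < j + p + s)%N) (jpN : (j + p < N)%N).

Let sN : (s <= N)%N. Proof. by lia. Qed.

Section Pos.
Hypothesis p_gt0 : (0 < p)%N.

(** The inner tree contains the start leaf and therefore gets label 0; the leaf [j], where the outer
    block begins, gets label [(N - (s + p)).+1]. *)
Lemma nested_straddle_forest :
  comp_forest N s (j + p) (R - s).+1 (N - (s + p)).+1 =
  nested_wrap (iota j p) (iota (j + p) (N - (j + p)) ++ iota 0 (j + p + s - N))
    (iota (j + p + s - N) (R - (p + s))).
Proof.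
rewrite /comp_forest (@white_blow_wrap (N - s).+1); try lia.
have -> : ((N - s).+1 - (N - (s + p)).+1 = p)%N by lia.
have -> : ((N - (s + p)).+1 + (R - s).+1 - (N - s).+1 = (R - (p + s)).+1)%N by lia.
rewrite graft_corolla [iota 0 _]/= !map_cat map_cons wrap_at //.
rewrite !(wrap_after hin) //; try lia.
rewrite -[LHS]/(nested_corollas [::] (iota _ _) (_ ++ _) (iota _ _) (iota _ _)).
by congr (nested_corollas _ _ (_ ++ _) _); apply: iota_eq; lia.
Qed.

Lemma nested_straddle_sign :
  comp_sign N s (j + p) (R - s).+1 (N - (s + p)).+1 = cut_sign.
Proof.
rewrite /comp_sign /cut_sign !white_sign_wrap; try lia.
have := nested_straddle_forest; rewrite /comp_forest => fE.
rewrite (@white_blow_wrap N) ?(@white_blow_wrap (N - s).+1) in fE *; try lia.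
rewrite graft_sign_corolla fE fword_nested !size_cat !size_iota.
have e1 : ((N - (s + p)).+1 + (R - s).+1 - (N - s).+1 = (R - (p + s)).+1)%N by lia.
rewrite e1 [iota 0 (R - _).+1]/= leaf_addr_middle ?notin_iota //; try lia.
rewrite !size_iota [size [::]]/=.
have -> : ((N - s).+1 - (N - (s + p)).+1 = p)%N by lia.
have -> : (N - (j + p) + (j + p + s - N) = s)%N by lia.
have -> : (p + (R - (p + s))).+1 = (R - s).+1 by lia.
have -> : (p + (R - (p + s)).+1 = (R - s).+1)%N by lia.
rewrite word_sign_blocks; last by rewrite eqseq_cons andbF.
rewrite mulrNN mulNr -!exprD; apply: sign_opp.
have : odd (R - (p + s) + (p + s)) = odd R by congr odd; lia.
have : odd (R - s + s) = odd R by congr odd; lia.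
have : odd (N - j + j) = odd N by congr odd; lia.
have : odd (N - (j + p) + (j + p)) = odd N by congr odd; lia.
have : odd (N - (s + p) + (s + p)) = odd N by congr odd; lia.
rewrite !(oddD, oddM, oddS).
case: (odd j); case: (odd p); case: (odd s); case: (odd R); case: (odd N);
  by case: (odd (R - s)); case: (odd (R - _)); case: (odd (N - j));
     case: (odd (_ - _)); case: (odd (_ - _)).
Qed.
End Pos.

Section Zero.
Hypothesis p0 : p = 0%N.

(** For p = 0 the outer block begins with the inner tree, which carries label 0, so the second
    blow-up no longer goes past the start leaf. *)
Lemma nested_start_forest : comp_forest N s (j + p) (R - s).+1 0 =
  nested_wrap (iota j p) (iota (j + p) (N - (j + p)) ++ iota 0 (j + p + s - N))
    (iota (j + p + s - N) (R - (p + s))).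
Proof.
rewrite /comp_forest (@white_blow_nowrap (N - s).+1); try lia.
rewrite graft_corolla [iota 0 0]/= [iota 0 _.+1]/= map_cons wrap_at //.
rewrite !(wrap_after hin) //; try lia.
rewrite -[LHS]/(nested_corollas [::] [::] (_ ++ _) (iota _ _) (iota _ _)).
congr (nested_corollas _ _ (_ ++ _) _); try by apply: iota_eq; lia.
by rewrite p0.
Qed.

Lemma nested_start_sign : comp_sign N s (j + p) (R - s).+1 0 = cut_sign.
Proof.
rewrite /comp_sign /cut_sign white_sign_wrap 1?white_sign_nowrap 1?white_sign_wrap; try lia.
have := nested_start_forest; rewrite /comp_forest => fE.
rewrite (@white_blow_wrap N) ?(@white_blow_nowrap (N - s).+1) in fE *; try lia.
rewrite graft_sign_corolla fE fword_nested !size_cat !size_iota.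
rewrite [iota 0 (R - _).+1]/= (@leaf_addr_middle _ [::]) //.
rewrite !size_iota; have -> : [:: 0%N; p] = [:: 0%N; 0%N] by rewrite p0.
have -> : (N - (j + p) + (j + p + s - N) = s)%N by lia.
have -> : (p + (R - (p + s))).+1 = (R - s).+1 by lia.
rewrite word_sign_blocks; last by rewrite eqseq_cons andbF.
rewrite p0 mulrNN mulNr -!exprD; apply: sign_opp.
rewrite addn0 !add0n mul0n.
have : odd (R - s + s) = odd R by congr odd; lia.
have : odd (N - j + j) = odd N by congr odd; lia.
rewrite !(oddD, oddM, oddS).
by case: (odd j); case: (odd s); case: (odd R); case: (odd N);
   case: (odd (R - s)); case: (odd (N - j)).
Qed.
End Zero.
End Straddle.

Section Right.
Hypothesis jpN : (N <= j + p)%N.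

Let hin : (j + p - N + s <= N)%N. Proof. by lia. Qed.

Lemma nested_right_forest :
  comp_forest N s (j + p - N) (R - s).+1 (j - s).+1 =
  nested_wrap (iota j (N - j) ++ iota 0 (j + p - N)) (iota (j + p - N) s)
    (iota (j + p - N + s) (R - (p + s))).
Proof.
rewrite /comp_forest (@white_blow_wrap (N - s).+1); try lia.
have -> : ((N - s).+1 - (j - s).+1 = N - j)%N by lia.
have -> : ((j - s).+1 + (R - s).+1 - (N - s).+1 = (j + R - s - N).+1)%N by lia.
rewrite graft_corolla (@iota_split 0 (j + p - N) (j + p - N) (R - (p + s)).+1); try lia.
rewrite !map_cat map_cons nowrap_at //.
rewrite (nowrap_before hin (x := 0)); last lia.
rewrite !(nowrap_after hin) //; try lia.
rewrite catA -map_cat.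
rewrite -[LHS]/(nested_corollas [::] (iota _ _ ++ iota _ _) (iota _ _) (iota _ _) (iota _ _)).
by congr (nested_corollas _ (_ ++ _) _ _); apply: iota_eq; lia.
Qed.

Lemma nested_right_sign :
  comp_sign N s (j + p - N) (R - s).+1 (j - s).+1 = cut_sign.
Proof.
rewrite /comp_sign /cut_sign white_sign_nowrap ?white_sign_wrap; try lia.
have := nested_right_forest; rewrite /comp_forest => fE.
rewrite (@white_blow_nowrap N) ?(@white_blow_wrap (N - s).+1) in fE *; try lia.
rewrite graft_sign_corolla fE fword_nested !size_cat !size_iota.
have -> : ((j - s).+1 + (R - s).+1 - (N - s).+1 = (j + R - s - N).+1)%N by lia.
have -> : ((N - s).+1 - (j - s).+1 = N - j)%N by lia.
rewrite (@iota_split 0 (j + p - N) (j + p - N) (R - (p + s)).+1); try lia.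
rewrite [iota (j + p - N) _.+1]/= catA leaf_addr_middle ?mem_cat ?negb_or ?notin_iota //; try lia.
rewrite size_cat !size_iota [size [::]]/=.
have -> : ((N - j + (j + p - N) + (R - (p + s))).+1 = (R - s).+1)%N by lia.
have -> : (N - j + (j + R - s - N).+1 = (R - s).+1)%N by lia.
rewrite word_sign_blocks; last by rewrite eqseq_cons andbF.
rewrite mulrNN mulNr -!exprD; apply: sign_opp.
have : odd (R - (p + s) + (p + s)) = odd R by congr odd; lia.
have : odd (R - s + s) = odd R by congr odd; lia.
have : odd (N - j + j) = odd N by congr odd; lia.
have : odd (j - s + s) = odd j by congr odd; lia.
have : odd (j + p - N + N) = odd (j + p) by congr odd; lia.
rewrite !(oddD, oddM, oddS).
case: (odd j); case: (odd p); case: (odd s); case: (odd R); case: (odd N);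
  by case: (odd (R - s)); case: (odd (R - _)); case: (odd (N - j));
     case: (odd (j - s)); case: (odd (_ - N)).
Qed.
End Right.
End Wrap.
End Nested.

(** * Matching of the index sets *)

Lemma sum_seq_bij (V : zmodType) (I J : eqType) (r : seq I) (s : seq J)
    (P : pred I) (Q : pred J) (f : I -> J) (g : J -> I) (F : I -> V) (G : J -> V) :
  uniq r -> uniq s ->
  (forall x, x \in r -> P x -> [/\ f x \in s, Q (f x), g (f x) = x & F x = G (f x)]) ->
  (forall y, y \in s -> Q y -> [/\ g y \in r, P (g y) & f (g y) = y]) ->
  \sum_(x <- r | P x) F x = \sum_(y <- s | Q y) G y.
Proof.
move=> ur us hf hg; rewrite -big_filter -[RHS]big_filter.
have pe : perm_eq (map f (filter P r)) (filter Q s).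
  apply: uniq_perm; rewrite ?filter_uniq //.
    rewrite map_inj_in_uniq ?filter_uniq // => x y.
    rewrite !mem_filter => /andP [Px xr] /andP [Py yr] E.
    by have [_ _ <- _] := hf x xr Px; rewrite E; have [] := hf y yr Py.
  move=> y; apply/mapP/idP => [[x]|].
    by rewrite !mem_filter => /andP [Px xr] ->; have [-> ->] := hf x xr Px.
  rewrite mem_filter => /andP [Qy ys]; have [gr Pg fg] := hg y ys Qy.
  by exists (g y); rewrite ?mem_filter ?Pg.
rewrite -(perm_big _ pe) big_map; apply: eq_big_seq => x.
by rewrite mem_filter => /andP [Px xr]; have [] := hf x xr Px.
Qed.

Definition white_left (N R j : nat) : seq nat := if (j + R <= N)%N then iota 0 j else [::].
Definition white_middle (N R j : nat) : seq nat :=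
  if (j + R <= N)%N then iota j R else iota j (N - j) ++ iota 0 (j + R - N).
Definition white_right (N R j : nat) : seq nat :=
  if (j + R <= N)%N then iota (j + R) (N - (j + R)) else iota (j + R - N) (N - R).

Lemma white_blowE (N R j : nat) : (j < N)%N -> (R <= N)%N ->
  white_blow N R j = corolla (white_left N R j) (white_middle N R j) (white_right N R j).
Proof.
move=> jN RN; rewrite /white_left /white_middle /white_right; case: leqP => h.
  exact: white_blow_nowrap.
exact: white_blow_wrap.
Qed.

Lemma size_white_middle (N R j : nat) : (j < N)%N -> (R <= N)%N ->
  size (white_middle N R j) = R.
Proof.
move=> jN RN; rewrite /white_middle; case: leqP => h; rewrite ?size_cat !size_iota //.
by lia.
Qed.

Definition cut_forest (N R j s p : nat) : forest :=
  let W := white_middle N R j in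
  nested_corollas (white_left N R j) (take p W) (take s (drop p W)) (drop (p + s) W)
    (white_right N R j).

Lemma take_drop_split (T : Type) (W X Y Z : seq T) p s : W = X ++ Y ++ Z ->
  size X = p -> size Y = s ->
  [/\ take p W = X, take s (drop p W) = Y & drop (p + s) W = Z].
Proof.
move=> -> <- <-; rewrite take_size_cat // drop_size_cat // take_size_cat //.
by rewrite addnC -drop_drop !drop_size_cat.
Qed.

Definition cut_pairs N R s := [seq (j, p) | j <- iota 0 N, p <- iota 0 (R - s).+1].
Definition comp_pairs N s := [seq (j1, j2) | j1 <- iota 0 N, j2 <- iota 0 (N - s).+1].

(** The inner block is contracted first: the first entry is the label of its first leaf, the second
    is the label then carried by the first branch of the outer block. The cases record whether the
    inner block lies before, across or after the start leaf. *)
Definition cut_to_comp (N R s : nat) (x : nat * nat) : nat * nat :=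
  let: (j, p) := x in
  if (j + R <= N)%N || (j + p + s <= N)%N then (j + p, j)%N
  else if (j + p < N)%N then (j + p, if p == 0%N then 0 else (N - (s + p)).+1)%N
  else (j + p - N, (j - s).+1)%N.

Definition comp_to_cut (N R s : nat) (x : nat * nat) : nat * nat :=
  let: (j1, j2) := x in
  if (j1 + s <= N)%N then
    if (j2 <= j1)%N then (j2, j1 - j2)%N else ((j2 + s).-1, j1 + N - (j2 + s).-1)%N
  else if j2 == 0%N then (j1, 0)%N else (j1 - ((N - s).+1 - j2), (N - s).+1 - j2)%N.

Lemma cut_comp N R s j p : (0 < s)%N -> (p + s <= R)%N -> (R <= N)%N -> (j < N)%N ->
  let y := cut_to_comp N R s (j, p) in
  cut_forest N R j s p = comp_forest N s y.1 (R - s).+1 y.2 /\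
  cut_sign N R j s p = comp_sign N s y.1 (R - s).+1 y.2.
Proof.
move=> s0 psR RN jN; rewrite /cut_to_comp /cut_forest /white_left /white_middle /white_right.
case: (leqP (j + R) N) => jR /=.
  split; last by rewrite nested_nowrap_sign.
  rewrite nested_nowrap_forest // /nested_nowrap.
  have e : iota j R = iota j p ++ iota (j + p) s ++ iota (j + p + s) (R - (p + s)).
    rewrite (@iota_split j p (j + p) (R - p)); try lia.
    by rewrite (@iota_split (j + p) s (j + p + s) (R - (p + s))); try lia.
  by have [-> -> ->] := take_drop_split e (size_iota _ _) (size_iota _ _).
rewrite -/(nested_wrap N R j _ _ _).
have We (X Y Z : seq nat) : iota j (N - j) ++ iota 0 (j + R - N) = X ++ Y ++ Z ->
    size X = p -> size Y = s ->
    nested_wrap N R j (take p (iota j (N - j) ++ iota 0 (j + R - N)))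
      (take s (drop p (iota j (N - j) ++ iota 0 (j + R - N))))
      (drop (p + s) (iota j (N - j) ++ iota 0 (j + R - N))) = nested_wrap N R j X Y Z.
  by move=> e sX sY; have [-> -> ->] := take_drop_split e sX sY.
case: (leqP (j + p + s) N) => h1 /=.
  split; last by rewrite nested_left_sign.
  rewrite nested_left_forest //; apply: We; rewrite ?size_iota //.
  rewrite (@iota_split j p (j + p) (N - (j + p))); try lia.
  rewrite (@iota_split (j + p) s (j + p + s) (N - (j + p + s))); try lia.
  by rewrite -!catA.
case: (ltnP (j + p) N) => h2 /=.
  have e : nested_wrap N R j (take p (iota j (N - j) ++ iota 0 (j + R - N)))
      (take s (drop p (iota j (N - j) ++ iota 0 (j + R - N))))
      (drop (p + s) (iota j (N - j) ++ iota 0 (j + R - N))) =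
      nested_wrap N R j (iota j p) (iota (j + p) (N - (j + p)) ++ iota 0 (j + p + s - N))
    (iota (j + p + s - N) (R - (p + s))).
    apply: We; rewrite ?size_cat ?size_iota //; last by lia.
    rewrite (@iota_split j p (j + p) (N - (j + p))); try lia.
    rewrite (@iota_split 0 (j + p + s - N) (j + p + s - N) (R - (p + s))); try lia.
    by rewrite -!catA.
  rewrite e; case: (eqVneq p 0%N) => p0.
    by rewrite nested_start_forest // nested_start_sign.
  by rewrite nested_straddle_forest ?nested_straddle_sign //; lia.
split; last by rewrite nested_right_sign.
rewrite nested_right_forest //; apply: We; rewrite ?size_cat ?size_iota //; last by lia.
rewrite (@iota_split 0 (j + p - N) (j + p - N) (R - p)); try lia.
rewrite (@iota_split (j + p - N) s (j + p - N + s) (R - (p + s))); try lia.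
by rewrite -!catA.
Qed.

(* The pairs (j1, j2) for which the two new vertices are both adjacent to the    *)
(* white vertex fall into two classes, exchanged with each other when the two    *)
(* blow-ups are made in the other order; the remaining pairs are nested.         *)
Definition first_before N r1 r2 j1 j2 :=
  (j2 + r2 <= (N - r1).+1)%N && (if (j1 + r1 <= N)%N then j1 < j2 else 0 < j2)%N.

Definition second_before N r1 r2 j1 j2 :=
  (j1 + r1 <= N)%N && (if (j2 + r2 <= (N - r1).+1)%N then j2 + r2 <= j1
                       else (j1 < j2) && (j2 + r2 - (N - r1).+1 <= j1))%N.

Section Sums.
Variables (V : zmodType) (g : forest -> V).

Let comp_term N r1 r2 (x : nat * nat) : V :=
  g (comp_forest N r1 x.1 r2 x.2) *~ comp_sign N r1 x.1 r2 x.2.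

Lemma uniq_pairs a b : uniq [seq (j, p) | j <- iota 0 a, p <- iota 0 b].
Proof. by apply: allpairs_uniq; rewrite ?iota_uniq // => -[x y] [u v]. Qed.

Lemma mem_pairs a b (x : nat * nat) :
  (x \in [seq (j, p) | j <- iota 0 a, p <- iota 0 b]) = (x.1 < a)%N && (x.2 < b)%N.
Proof.
case: x => x y; apply/allpairsP/idP => [[[u v]] /= []|/= /andP [xa yb]].
  by rewrite !mem_iota => /= h1 h2 [-> ->]; rewrite h1.
by exists (x, y); rewrite /= !mem_iota.
Qed.

(** Making the two blow-ups in the other order is a bijection of index pairs that keeps the forest
    and reverses the sign, by [line_signs] if no block passes the start leaf and by [cycle_signs]
    otherwise. *)
Lemma sum_disjoint N r1 r2 : (1 < r1)%N -> (1 < r2)%N -> (r1 <= N)%N -> (r2 <= N)%N ->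
  \sum_(x <- comp_pairs N r2 | second_before N r2 r1 x.1 x.2) comp_term N r2 r1 x =
  - \sum_(x <- comp_pairs N r1 | first_before N r1 r2 x.1 x.2) comp_term N r1 r2 x.
Proof.
move=> h1 h2 h3 h4; rewrite -sumrN; apply/esym.
(* The first map solves for [b] in [line_first_forest] or [cycle_first_forest] and returns the
   indices of the opposite order; the second map is its inverse. *)
apply: (@sum_seq_bij _ _ _ _ _ _ _
  (fun x => if x.1 + r1 <= N then ((x.2 + r1).-1, x.1)
            else ((x.2).-1 + x.1 + r1 - N, (x.1 - r2).+1))%N
  (fun y => if y.2 + r1 <= (N - r2).+1 then (y.2, (y.1 - r1).+1)
            else ((y.2 + r2).-1, (y.1 + N - ((y.2 + r2).-1 + r1)).+1))%N);
  rewrite ?uniq_pairs // => -[x y]; rewrite mem_pairs /first_before /second_before /=.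
- move=> /andP [xN yN] /andP [hy]; case: (leqP (x + r1) N) => hx hxy /=.
    have hb : (x + r1 <= (y + r1).-1)%N by lia.
    have hbN : ((y + r1).-1 + r2 <= N)%N by lia.
    rewrite mem_pairs /=; split; first lia.
    - by case: ifP => h; lia.
    - by case: ifP => h; [congr pair|]; lia.
    have ey : y = ((y + r1).-1 - r1).+1 by lia.
    have r0 : (0 < r1)%N by lia. have r0' : (0 < r2)%N by lia.
    rewrite /comp_term /= (line_signs r0 r0' hb hbN) -ey mulrNz; congr (- (_ *~ _)).
    by rewrite [in LHS]ey line_first_forest // line_second_forest.
  pose b := (y.-1 + x + r1 - N)%N.
  have hb : (x + r1 - N <= b)%N by rewrite /b; lia.
  have hbx : (b + r2 <= x)%N by rewrite /b; lia.
  rewrite mem_pairs /= -/b; split; first lia.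
  - by case: ifP => h; lia.
  - by case: ifP => h; [|congr pair]; lia.
  have ey : y = (b + N - (x + r1)).+1 by rewrite /b; lia.
  rewrite /comp_term /= cycle_signs // -?ey ?mulrNz; try lia.
  congr (- (_ *~ _)); rewrite ey cycle_first_forest ?cycle_second_forest //; lia.
move=> /andP [xN yN] /andP [hx]; case: (leqP (y + r1) (N - r2).+1) => hy hxy /=;
  rewrite mem_pairs /=; split; try lia.
- by case: ifP => h; lia.
- by case: ifP => h; [congr pair|]; lia.
- by case: ifP => h; lia.
- by case: ifP => h; [|congr pair]; lia.
Qed.

Lemma sum_nested N R s : (1 < s)%N -> (s < R)%N -> (R <= N)%N ->
  \sum_(x <- comp_pairs N s | ~~ first_before N s (R - s).+1 x.1 x.2 &&
                              ~~ second_before N s (R - s).+1 x.1 x.2)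
     comp_term N s (R - s).+1 x =
  \sum_(x <- cut_pairs N R s) g (cut_forest N R x.1 s x.2) *~ cut_sign N R x.1 s x.2.
Proof.
move=> h1 h2 h3; apply/esym.
apply: (@sum_seq_bij _ _ _ _ _ _ _ (cut_to_comp N R s) (comp_to_cut N R s));
  rewrite ?uniq_pairs // => -[x y]; rewrite mem_pairs /=.
  move=> /andP [xN yR] _; rewrite mem_pairs /first_before /second_before.
  have [||||e1 e2] := @cut_comp N R s x y; try lia.
  rewrite /comp_term e1 e2; split=> //; rewrite {e1 e2} /cut_to_comp.
  - case: (leqP (x + R) N) => a1 /=; first lia.
    case: (leqP (x + y + s) N) => a2 /=; first lia.
    case: (ltnP (x + y) N) => a3 /=; last lia.
    by case: (eqVneq y 0%N) => a4 /=; lia.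
  - case: (leqP (x + R) N) => a1 /=; first by do ?[case: ifP => ?]; lia.
    case: (leqP (x + y + s) N) => a2 /=; first by do ?[case: ifP => ?]; lia.
    case: (ltnP (x + y) N) => a3 /=; last by do ?[case: ifP => ?]; lia.
    by case: (eqVneq y 0%N) => a4 /=; do ?[case: ifP => ?]; lia.
  - rewrite /comp_to_cut.
    case: (leqP (x + R) N) => a1 /=; first by do ?[case: ifP => ?]; congr pair; lia.
    case: (leqP (x + y + s) N) => a2 /=; first by do ?[case: ifP => ?]; congr pair; lia.
    case: (ltnP (x + y) N) => a3 /=; last by do ?[case: ifP => ?]; congr pair; lia.
    by case: (eqVneq y 0%N) => a4 /=; do ?[case: ifP => ?]; congr pair; lia.
move=> /andP [xN yN]; rewrite /first_before /second_before mem_pairs /comp_to_cut.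
case: (leqP (x + s) N) => a1 /=.
  case: (leqP y x) => a2 /= hh; rewrite /cut_to_comp.
    have {hh} : (x - y < (R - s).+1)%N by move: hh; do ?[case: ifP => ?]; lia.
    move=> hh; split; [lia | by []|].
    by do ?[case: ifP => ?]; congr pair; lia.
  have {hh} : (x < y + (R - s).+1 - (N - s).+1)%N.
    by move: hh; do ?[case: ifP => ?]; lia.
  move=> hh; split; [lia | by []|].
  by do ?[case: ifP => ?]; congr pair; lia.
case: (eqVneq y 0%N) => a2 /= hh.
  split; [lia | by []|]; rewrite /cut_to_comp a2 addn0.
  by do ?[case: ifP => ?]; congr pair; lia.
have {hh} : ((N - s).+1 < y + (R - s).+1)%N by lia.
move=> hh; split; [lia | by []|]; rewrite /cut_to_comp.
by do ?[case: ifP => ?]; congr pair; lia.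
Qed.
End Sums.

(** * The Maurer-Cartan equation of [dL] *)

Lemma add_map0 (U V : zmodType) (f : U -> V) : add_map f -> f 0 = 0.
Proof. by move=> fD; apply: (addIr (f 0)); rewrite -fD !add0r. Qed.

Lemma add_map_sum (U V : zmodType) (f : U -> V) (I : Type) (r : seq I) (P : pred I)
    (F : I -> U) : add_map f ->
  f (\sum_(i <- r | P i) F i) = \sum_(i <- r | P i) f (F i).
Proof. by move=> fD; apply: big_morph; [exact: fD | exact: add_map0]. Qed.

Lemma fg_lift_scale (K : choiceType) (V : zmodType) (f : K -> V) c x :
  fg_lift f << c *g x >> = f x *~ c.
Proof.
rewrite (@fg_liftE _ _ _ _ [:: x]) //; first by rewrite big_seq1 coeffU eqxx mulr1.
move=> y; rewrite mem_dom coeffU inE [y == x]eq_sym.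
by case: (x == y); rewrite //= mulr0 eqxx.
Qed.

Lemma ainf_elt_scale m n k c F : ainf_elt m n k c F = ainf_elt m n k 1 F *~ c.
Proof.
rewrite /ainf_elt; case: insubP => [G _ _|_]; last by rewrite mul0rz.
by rewrite freeg_mulz intz.
Qed.

Lemma fg_lift_elt m n k c F (V : zmodType) (f : forest_of m n k -> V)
    (h : is_forest m n k F) : fg_lift f (ainf_elt m n k c F) = f (Sub F h) *~ c.
Proof. by rewrite /ainf_elt insubT fg_lift_scale. Qed.

Lemma ainf_dif_elt m n i j (e : i = j + 1) c F : is_forest m n i F ->
  ainf_dif e (ainf_elt m n i c F) =
  \sum_(b <- fblow F) ainf_elt m n j 1 b.1 *~ (c * blow_sign F b.1 b.2).
Proof.
move=> h; rewrite /ainf_dif (fg_lift_elt _ _ h) SubK mulrz_suml.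
by apply: eq_bigr => b _; rewrite ainf_elt_scale -mulrzA mulrC.
Qed.

Lemma ainf_comp_elt m n p i j k (e : i + j = k) c d F G :
  is_forest m n i F -> is_forest n p j G ->
  ainf_comp e (ainf_elt m n i c F) (ainf_elt n p j d G) =
  ainf_elt m p k 1 (graft F G) *~ (c * d * graft_sign F G).
Proof.
move=> hF hG; rewrite /ainf_comp (fg_lift_elt _ _ hF) (fg_lift_elt _ _ hG) !SubK.
by rewrite ainf_elt_scale -!mulrzA; congr (_ *~ _); lia.
Qed.

Lemma is_forest_white_blow n k j : (k < n)%N -> (j < n.+1)%N ->
  is_forest n.+1 k.+1 (n%:Z - k%:Z - 1) (white_blow n.+1 (n.+1 - k) j).
Proof.
move=> kn jn; have := @is_forest_white n.+1 (n.+1 - k) j.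
have -> : (n.+1 - (n.+1 - k))%N = k by lia.
have -> : (n.+1 - k)%N%:Z - 2 = n%:Z - k%:Z - 1 by lia.
by apply => //; lia.
Qed.

Lemma sum_ord_pairs (V : zmodType) a b (F : nat * nat -> V) :
  \sum_(i < a) \sum_(j < b) F (i : nat, j : nat) =
  \sum_(x <- [seq (i, j) | i <- iota 0 a, j <- iota 0 b]) F x.
Proof.
rewrite big_allpairs -(big_mkord xpredT (fun i => \sum_(j < b) F (i, j : nat))).
rewrite /index_iota subn0; apply: eq_bigr => i _.
by rewrite -(big_mkord xpredT (fun j => F (i, j))) /index_iota subn0.
Qed.

Section MaurerCartan.
Variables (n k : nat) (t : int).
Hypothesis kn : (k < n)%N.
Let g F := ainf_elt n.+1 k.+1 t 1 F.
Let N := n.+1.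
Let R := (n.+1 - k)%N.

(** Trivial trees have no blow-up, so each term of the differential splits the unique black vertex
    into two nested ones. *)
Lemma dL_dif_cut (e : n%:Z - k%:Z - 1 = t + 1) :
  dif e (dL n k) =
  \sum_(2 <= s < R) \sum_(x <- cut_pairs N R s)
    g (cut_forest N R x.1 s x.2) *~ cut_sign N R x.1 s x.2.
Proof.
have dD : add_map (@dif (mor Ainf n.+1 k.+1) _ _ e) by exact: fg_liftD.
rewrite /dL (add_map_sum _ _ _ dD).
transitivity (\sum_(j < N) \sum_(2 <= s < R) \sum_(p < (R - s).+1)
   g (cut_forest N R j s p) *~ cut_sign N R j s p).
  apply: eq_bigr => j _; rewrite [LHS]ainf_dif_elt; last exact: is_forest_white_blow.
  have RN : (R <= N)%N by rewrite leq_subr.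
  rewrite white_blowE // fblow_corolla size_white_middle // big_allpairs_dep.
  rewrite -/(index_iota 2 R) big_seq [RHS]big_seq; apply: eq_bigr => s.
  rewrite mem_index_iota => /andP [s2 sR].
  rewrite -(big_mkord xpredT (fun p => g (cut_forest N R j s p) *~ cut_sign N R j s p)).
  rewrite /index_iota subn0 big_seq [RHS]big_seq; apply: eq_bigr => p.
  rewrite mem_iota => /andP [_ pR] /=.
  rewrite /g /cut_forest /cut_sign; congr (_ *~ (_ * _)).
  have Wp : size (take p (white_middle N R j)) = p.
    by rewrite size_takel // size_white_middle //; lia.
  have := blow_sign_nested (white_left N R j) (take p (white_middle N R j))
    (take s (drop p (white_middle N R j))) (drop (p + s) (white_middle N R j)) (white_right N R j).
  rewrite take_drop_cat Wp => ->.
  rewrite size_takel; last by rewrite size_drop size_white_middle //; lia.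
  by rewrite size_drop size_white_middle.
rewrite exchange_big /=; apply: eq_bigr => s _.
by rewrite (sum_ord_pairs _ _ (fun x => g (cut_forest N R x.1 s x.2) *~ cut_sign N R x.1 s x.2)).
Qed.

Lemma dL_comp l (e : (n%:Z - l%:Z - 1) + (l%:Z - k%:Z - 1) = t) : (k < l < n)%N ->
  ksgn (n%:Z - l%:Z) (comp e (dL n l) (dL l k) : mor Ainf _ _ _) =
  \sum_(x <- comp_pairs N (N - l))
     g (comp_forest N (N - l) x.1 (l.+1 - k) x.2) *~
       comp_sign N (N - l) x.1 (l.+1 - k) x.2.
Proof.
case/andP=> kl ln; have LE : (N - (N - l)).+1 = l.+1 by rewrite /N; lia.
rewrite -(sum_ord_pairs _ _ (fun x =>  g (comp_forest N (N - l) x.1 (l.+1 - k) x.2) *~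
       comp_sign N (N - l) x.1 (l.+1 - k) x.2)).
have -> : comp e (dL n l) (dL l k) =
  \sum_(j1 < N) \sum_(j2 < l.+1)
    g (graft (white_blow N (N - l) j1) (white_blow l.+1 (l.+1 - k) j2)) *~
    (white_sign N (N - l) j1 * white_sign l.+1 (l.+1 - k) j2 *
      graft_sign (white_blow N (N - l) j1) (white_blow l.+1 (l.+1 - k) j2)).
  have cD1 : add_map (fun x : mor Ainf n.+1 l.+1 _ => comp e x (dL l k)) by exact: fg_liftD.
  rewrite {1}/dL (add_map_sum _ _ _ cD1); apply: eq_bigr => j1 _.
  have cD2 c F : is_forest n.+1 l.+1 (n%:Z - l%:Z - 1) F ->
      add_map (fun x : mor Ainf l.+1 k.+1 _ =>
        comp e (ainf_elt n.+1 l.+1 (n%:Z - l%:Z - 1) c F : mor Ainf _ _ _) x).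
    move=> hF x y; rewrite /= /ainf_comp.
    by rewrite !(fg_lift_elt _ _ hF) [fg_lift _ (x + y)]fg_liftD mulrzDl.
  rewrite /dL (add_map_sum _ _ _ (cD2 _ _ (is_forest_white_blow ln (ltn_ord j1)))).
  by apply: eq_bigr => j2 _; rewrite [LHS]ainf_comp_elt //; exact: is_forest_white_blow.
have sg : (-1) ^+ (N - l).+1 = (if odd `|n%:Z - l%:Z|%N then -1 else 1) :> int.
  have -> : `|n%:Z - l%:Z|%N = (n - l)%N by lia.
  by rewrite sign_odd /N subSn 1?ltnW // oddS oddS negbK; case: odd.
have kE (V : zmodType) (x : V) : ksgn (n%:Z - l%:Z) x = x *~ (-1) ^+ (N - l).+1.
  by rewrite sg /ksgn; case: (odd _).
rewrite kE mulrz_suml /comp_forest /comp_sign.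
rewrite -[(N - (N - l)).+1]/((N - (N - l)).+1) LE.
apply: eq_bigr => j1 _; rewrite mulrz_suml; apply: eq_bigr => j2 _.
by rewrite -mulrzA mulrC.
Qed.

(** This identity makes the twisted Hochschild differential square to zero. Each product on the
    right splits into nested pairs and two classes of disjoint pairs; by [sum_disjoint], the second
    class is minus the first class with the block sizes exchanged. *)
Lemma dL_maurer_cartan (e : n%:Z - k%:Z - 1 = t + 1)
    (el : forall l : nat, (n%:Z - l%:Z - 1) + (l%:Z - k%:Z - 1) = t) :
  dif e (dL n k) =
  \sum_(k.+1 <= l < n) ksgn (n%:Z - l%:Z) (comp (el l) (dL n l) (dL l k) : mor Ainf _ _ _).
Proof.
have RN : (R <= N)%N by rewrite leq_subr.
pose T r1 r2 (x : nat * nat) := g (comp_forest N r1 x.1 r2 x.2) *~ comp_sign N r1 x.1 r2 x.2.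
pose FST r1 r2 := \sum_(x <- comp_pairs N r1 | first_before N r1 r2 x.1 x.2) T r1 r2 x.
have split_l l : (k.+1 <= l < n)%N ->
    ksgn (n%:Z - l%:Z) (comp (el l) (dL n l) (dL l k) : mor Ainf _ _ _) =
    FST (N - l)%N (l.+1 - k)%N - FST (l.+1 - k)%N (N - l)%N +
    \sum_(x <- cut_pairs N R (N - l))
      g (cut_forest N R x.1 (N - l) x.2) *~ cut_sign N R x.1 (N - l) x.2.
  move=> hl; rewrite dL_comp //; rewrite /N in hl *.
  have rE : (l.+1 - k = (R - (n.+1 - l)).+1)%N by rewrite /R; lia.
  rewrite rE -(sum_nested g); try (rewrite /R; lia).
  rewrite -(sum_disjoint g); try (rewrite /R; lia).
  rewrite (bigID (fun x => first_before N (n.+1 - l) (R - (n.+1 - l)).+1 x.1 x.2)) /= -addrA.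
  congr (_ + _).
  rewrite (bigID (fun x => second_before N (n.+1 - l) (R - (n.+1 - l)).+1 x.1 x.2)) /=.
  congr (_ + _); apply: eq_bigl => x.
  by rewrite /first_before /second_before; do ?[case: ifP => ?]; lia.
rewrite dL_dif_cut (eq_big_nat _ _ split_l) big_split /= -[LHS]add0r; congr (_ + _).
  (* Reflecting [l] to k + n - l exchanges the block sizes N - l and l + 1 - k, so the disjoint
     pairs cancel in the sum over [l]. *)
  rewrite sumrB big_nat_rev /= -sumrB big_seq big1 // => l; rewrite mem_index_iota => hl.
  have -> : (N - (k.+1 + n - l.+1) = l.+1 - k)%N by rewrite /N; lia.
  have -> : ((k.+1 + n - l.+1).+1 - k = N - l)%N by rewrite /N; lia.
  by rewrite subrr.
(* An inner block of [s] leaves corresponds to the intermediate index l = N - s. *)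
apply: (@sum_seq_bij _ _ _ _ _ _ _ (fun s => N - s)%N (fun l => N - l)%N);
  rewrite ?iota_uniq // => s; rewrite !mem_index_iota /R /N => hs _; split=> //; try lia.
by have -> : (n.+1 - (n.+1 - s) = s)%N by lia.
Qed.
End MaurerCartan.

(** * Signs, direct sums and resolvents *)

Lemma add_mapN (U V : zmodType) (f : U -> V) : add_map f -> forall x, f (- x) = - f x.
Proof. by move=> fD x; apply: (addIr (f x)); rewrite -fD !addNr add_map0. Qed.

Lemma add_mapB (U V : zmodType) (f : U -> V) : add_map f ->
  forall x y, f (x - y) = f x - f y.
Proof. by move=> fD x y; rewrite fD add_mapN. Qed.

Lemma odd_abszD i j : odd `|(i + j : int)| = odd `|i| (+) odd `|j|.
Proof. by rewrite -oddD; lia. Qed.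

Lemma ksgnD (V : zmodType) i : add_map (@ksgn V i).
Proof. by move=> x y; rewrite /ksgn; case: ifP => _ //; rewrite opprD. Qed.

Lemma add_map_ksgn (U V : zmodType) (f : U -> V) i : add_map f ->
  forall x, f (ksgn i x) = ksgn i (f x).
Proof. by move=> fD x; rewrite /ksgn; case: ifP => // _; rewrite add_mapN. Qed.

Lemma ksgn_ksgn (V : zmodType) i j (x : V) : ksgn i (ksgn j x) = ksgn (i + j) x.
Proof.
by rewrite /ksgn odd_abszD; case: (odd `|i|); case: (odd `|j|) => //=; rewrite opprK.
Qed.

Lemma ksgn_eq (V : zmodType) i j (x : V) : odd `|i - j|%N = false -> ksgn i x = ksgn j x.
Proof.
by move=> h; rewrite /ksgn; have -> : odd `|i| = odd `|j| by lia.
Qed.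

Lemma ksgnN (V : zmodType) i j (x : V) : odd `|i - j|%N -> ksgn i x = - ksgn j x.
Proof.
move=> h; rewrite /ksgn; have -> : odd `|i| = ~~ odd `|j| by lia.
by case: (odd `|j|); rewrite //= opprK.
Qed.

Lemma ksgn0 (V : zmodType) (x : V) : ksgn 0 x = x. Proof. by []. Qed.

Section Dsum.
Variable F : nat -> zmodType.
Implicit Type x y : dsum F.

Lemma dinj_eq n (a : F n) : val (dinj n a) n = a.
Proof.
rewrite /dinj SubK /single; case: eqP => // e.
by rewrite (eq_irrelevance e erefl).
Qed.

Lemma dinj_neq n k (a : F n) : n != k -> val (dinj n a) k = 0.
Proof. by rewrite /dinj SubK /single; case: eqP. Qed.

Lemma dsum_valD x y n : val (x + y) n = val x n + val y n.
Proof. by []. Qed.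

Lemma dsum_eqP x y : (forall n, val x n = val y n) -> x = y.
Proof. by move=> h; apply: val_inj; apply: functional_extensionality_dep. Qed.

Lemma dinjD n : add_map (@dinj F n).
Proof.
move=> a b; apply: dsum_eqP => k; rewrite dsum_valD.
by case: (eqVneq n k) => [<-|h]; rewrite ?dinj_eq // !dinj_neq ?addr0.
Qed.

Lemma dbound_vanish x : vanish_from (val x) (dbound x).
Proof. by rewrite /dbound; case: ex_minnP. Qed.

Lemma dsum_decomp N x : vanish_from (val x) N -> x = \sum_(n < N) dinj n (val x n).
Proof.
move=> hN; apply: dsum_eqP => k.
have vD : add_map (fun y : dsum F => val y k) by move=> u v; exact: dsum_valD.
rewrite (add_map_sum _ _ _ vD); case: (ltnP k N) => hk.
  rewrite (bigD1 (Ordinal hk)) // big1 => [|i hi].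
    by apply/esym; apply: (etrans (addr0 _)); exact: dinj_eq.
  by apply: dinj_neq; apply: contraNneq hi => e; apply/eqP/val_inj.
move/asboolP: hN => -> //; rewrite big1 // => i _; apply: dinj_neq.
by rewrite neq_ltn (leq_trans (ltn_ord i) hk).
Qed.

Lemma dsum_ext (V : zmodType) (f g : dsum F -> V) : add_map f -> add_map g ->
  (forall n a, f (dinj n a) = g (dinj n a)) -> f =1 g.
Proof.
move=> fD gD h x; rewrite (dsum_decomp (dbound_vanish x)).
by rewrite (add_map_sum _ _ _ fD) (add_map_sum _ _ _ gD); apply: eq_bigr.
Qed.

Lemma vanish0 N : vanish_from (val (0 : dsum F)) N.
Proof. by apply/asboolP. Qed.

Lemma vanishD N x y : vanish_from (val x) N -> vanish_from (val y) N ->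
  vanish_from (val (x + y)) N.
Proof.
move=> /asboolP hx /asboolP hy; apply/asboolP => n hn.
by rewrite dsum_valD hx // hy // addr0.
Qed.

Lemma vanish_sum N (I : Type) (r : seq I) (P : pred I) (G : I -> dsum F) :
  (forall i, P i -> vanish_from (val (G i)) N) ->
  vanish_from (val (\sum_(i <- r | P i) G i)) N.
Proof.
by move=> h; apply: (big_ind (fun x => vanish_from (val x) N));
  [exact: vanish0 | exact: vanishD |].
Qed.

Lemma vanish_dinj N n (a : F n) : (n < N)%N -> vanish_from (val (dinj n a)) N.
Proof.
move=> h; apply/asboolP => k hk; rewrite dinj_neq //.
by rewrite neq_ltn (leq_trans h hk).
Qed.

Lemma vanish_zero x : vanish_from (val x) 0 -> x = 0.
Proof. by move=> /asboolP h; apply: dsum_eqP => n; rewrite h. Qed.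

End Dsum.

Section Resolvent.
Variables (F : nat -> zmodType) (K : dsum F -> dsum F).

(** The inverse of 1 - K as a geometric series. By [Klow] each application of [K] lowers the bound
    on the support, so all later iterates vanish on [x]. *)
Definition resolvent (x : dsum F) : dsum F := \sum_(p < dbound x) iter p K x.

Hypothesis KD : add_map K.
Hypothesis Klow : forall N x, vanish_from (val x) N.+1 -> vanish_from (val (K x)) N.

Lemma resolvent_step x : resolvent x = x + K (resolvent x).
Proof.
have itK p N y : vanish_from (val y) N -> vanish_from (val (iter p K y)) (N - p).
  elim: p N y => [|p IH] N y hN; first by rewrite subn0.
  rewrite iterSr; case: N hN => [|N] hN.
    rewrite (vanish_zero hN) add_map0 //; apply: (IH 0%N); exact: vanish0.
  by rewrite subSS; apply: IH; apply: Klow.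
rewrite /resolvent; set N := dbound x.
have hN : iter N K x = 0.
  by apply: vanish_zero; rewrite -(subnn N); apply: itK; exact: dbound_vanish.
rewrite (add_map_sum _ _ _ KD) -[LHS]addr0 -[X in _ + X = _]hN.
by transitivity (\sum_(p < N.+1) iter p K x); [rewrite big_ord_recr | rewrite big_ord_recl].
Qed.

(** A fixed point of [K] has its support bound lowered as often as desired. The identities about
    resolvents below are obtained by showing that a difference is such a fixed point. *)
Lemma resolvent_uniq x : x = K x -> x = 0.
Proof.
move=> xK; suff h N : vanish_from (val x) N -> x = 0 by exact: (h _ (dbound_vanish x)).
elim: N => [|N IH] hN; first exact: vanish_zero.
by apply: IH; rewrite xK; apply: Klow.
Qed.

Lemma resolvent_eq x y : y = x + K y -> y = resolvent x.
Proof.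
move=> yE; apply/eqP; rewrite -subr_eq0; apply/eqP/resolvent_uniq.
by rewrite {1}yE {1}resolvent_step opprD addrACA subrr add0r add_mapB.
Qed.

Lemma resolventD : add_map resolvent.
Proof.
move=> x y; apply/esym/resolvent_eq.
by rewrite {1}resolvent_step {1}[resolvent y]resolvent_step addrACA KD.
Qed.

End Resolvent.

(** * The Hochschild complex as a dg-functor *)

Section Irrelevance.
Variables (E : dgcat_data) (Phi : fun_data E).

Lemma act_irr m n (i j k : int) (e e' : i + j = k) (x : Phi m i) (f : mor E m n j) :
  act e x f = act e' x f.
Proof. by rewrite (eq_irrelevance e e'). Qed.

Lemma dif_irr (C : gcx) (i j : int) (e e' : i = j + 1) (x : C i) : dif e x = dif e' x.
Proof. by rewrite (eq_irrelevance e e'). Qed.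
End Irrelevance.

Section Twist.
Variable E : ainf_prop.

Definition twist n k m : mor E (n.+1 + m) (k.+1 + m) (n%:Z - k%:Z - 1) :=
  mon (addr0 _) (amul E (dL n k)) (idm m).

Let PE : is_prop E := dgpropP E.
Let CE : is_dgcat E := prop_dgcat PE.
Let AE : is_prop_functor (amul E) := amulP E.

Lemma twist_dif n k m (j : int) (e : n%:Z - k%:Z - 1 = j + 1)
    (el : forall l : nat, (n%:Z - l%:Z - 1) + (l%:Z - k%:Z - 1) = j) : (k < n)%N ->
  dif e (twist n k m) =
  \sum_(k.+1 <= l < n) ksgn (n%:Z - l%:Z) (comp (el l) (twist n l m) (twist l k m)).
Proof.
move=> kn; rewrite /twist.
have e1 : j + 0 = j by rewrite addr0.
have e2 : (n%:Z - k%:Z - 1) + (-1) = j by rewrite e addrK.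
have e0 : 0 = (-1) + 1 :> int by [].
rewrite (mon_dif PE (addr0 _) e e0 e e1 e2) (idm_cycle CE) add_map0; last first.
  exact: (mon_addr PE).
rewrite (add_map0 (@ksgnD _ _)) addr0.
have [jD j1] := cmap_chain (pf_dgfunctor AE) n.+1 k.+1.
rewrite -j1 (dL_maurer_cartan kn e el) (add_map_sum _ _ _ (jD j)).
rewrite (add_map_sum _ _ _ (@mon_addl _ PE _ _ _ _ _ _ _ e1 (idm m))).
apply: eq_bigr => l _.
rewrite (add_map_ksgn _ (jD j)) (add_map_ksgn _ (@mon_addl _ PE _ _ _ _ _ _ _ e1 (idm m))).
congr ksgn; rewrite (cmap_comp (pf_dgfunctor AE)).
rewrite (mon_comp PE _ _ _ (el l) (addr0 0) e1) mul0r ksgn0.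
by rewrite (comp_idl CE).
Qed.

(** The twist acts on the Hochschild inputs and [f] on the remaining ones, so by the interchange law
    they commute up to the Koszul sign. *)
Lemma twist_comm n k m p (j a : int)
    (e1 : n%:Z - k%:Z - 1 + j = a) (e2 : j + (n%:Z - k%:Z - 1) = a) (f : mor E m p j) :
  comp e2 (mon (add0r j) (idm n.+1) f : mor E _ _ _) (twist n k p) =
  ksgn (j * (n%:Z - k%:Z - 1))
    (comp e1 (twist n k m) (mon (add0r j) (idm k.+1) f : mor E _ _ _)).
Proof.
rewrite /twist.
rewrite (mon_comp PE _ _ _ (add0r _) (addr0 _) e1).
rewrite (mon_comp PE _ _ _ (addr0 _) (add0r _) e1) mul0r ksgn0.
by rewrite !(comp_idl CE, comp_idr CE).
Qed.

Lemma mon_id_dif n m p (j j' : int) (e : j = j' + 1) (f : mor E m p j) :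
  dif e (mon (add0r j) (idm n) f : mor E _ _ _) = mon (add0r j') (idm n) (dif e f).
Proof.
have e1 : (-1) + j = j' by rewrite e addrCA addNr addr0.
have e0 : 0 = (-1) + 1 :> int by [].
rewrite (mon_dif PE (add0r _) e0 e e e1 (add0r j')) (idm_cycle CE).
by rewrite (add_map0 (@mon_addl _ PE n n m p (-1) j j' e1 f)) add0r ksgn0.
Qed.

Lemma mon_id_comp n m p q (i j k : int) (e : i + j = k) (f : mor E m p i) (g : mor E p q j) :
  mon (add0r k) (idm n) (comp e f g) =
  comp e (mon (add0r i) (idm n) f) (mon (add0r j) (idm n) g) :> mor E _ _ _.
Proof.
rewrite (mon_comp PE _ _ _ (addr0 0) e (add0r k)) mulr0 ksgn0.
by rewrite (comp_idl CE).
Qed.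

Lemma amul_id m : amul E (idm m : mor Ainf m m 0) = idm m.
Proof. exact: (cmap_id (pf_dgfunctor AE)). Qed.

(** Exhibits the twist as the image of a morphism of A_infinity, so that maps satisfying
    [amul_natural] commute with it. *)
Lemma twist_amul n k m :
  twist n k m = amul E (mon (addr0 _) (dL n k) (idm m) : mor Ainf _ _ _).
Proof. by rewrite (pf_mon AE) amul_id. Qed.

Lemma mon_id_amul n m p j (f : mor Ainf m p j) :
  mon (add0r j) (idm n) (amul E f) =
  amul E (mon (add0r j) (idm n) f : mor Ainf _ _ _) :> mor E _ _ _.
Proof. by rewrite (pf_mon AE) amul_id. Qed.
End Twist.

Lemma add_map_zero (U V : zmodType) : add_map (fun _ : U => 0 : V).
Proof. by move=> x y; rewrite addr0. Qed.

Lemma add_map_comp (U V W : zmodType) (f : V -> W) (g : U -> V) :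
  add_map f -> add_map g -> add_map (fun x => f (g x)).
Proof. by move=> fD gD x y; rewrite gD fD. Qed.

Lemma add_map_add (U V : zmodType) (f g : U -> V) :
  add_map f -> add_map g -> add_map (fun x => f x + g x).
Proof. by move=> fD gD x y; rewrite fD gD addrACA. Qed.

Lemma add_map_opp (U V : zmodType) (f : U -> V) :
  add_map f -> add_map (fun x => - f x).
Proof. by move=> fD x y; rewrite fD opprD. Qed.

Lemma add_map_bigsum (U V : zmodType) (I : Type) (r : seq I) (P : pred I) (f : I -> U -> V) :
  (forall i, add_map (f i)) -> add_map (fun x => \sum_(i <- r | P i) f i x).
Proof. by move=> fD x y; rewrite -big_split; apply: eq_bigr => i _; exact: fD. Qed.

Lemma sum_triangle (V : zmodType) n (G : nat -> nat -> V) :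
  \sum_(k < n) \sum_(l < k) G k l = \sum_(l < n) \sum_(l.+1 <= k < n) G k l.
Proof.
elim: n => [|n IH]; first by rewrite !big_ord0.
rewrite !big_ord_recr /= IH big_geq // addr0 -big_split; apply: eq_bigr => l _ /=.
by rewrite big_nat_recr ?ltn_ord.
Qed.

Section HochFunctor.
Variables (E : ainf_prop) (Phi : fun_data E).
Hypothesis hP : is_dgfun Phi.
Let PE : is_prop E := dgpropP E.
Let CE : is_dgcat E := prop_dgcat PE.

Lemma fob_difD m (i j : int) (e : i = j + 1) : add_map (@dif (Phi m) i j e).
Proof. by have [] := fob_complex hP m. Qed.

Definition hoch_d0 m (t s : int) (e : t = s + 1) : hoch_complex Phi m t -> hoch_complex Phi m s :=
  dlift (fun n x => dinj n (dif (deg_shift_dif n e) x) : hoch_complex Phi m s).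

Definition hoch_tw_comp m (t s : int) (e : t = s + 1) n
    (x : Phi (n.+1 + m)%N (t - n%:Z)) : hoch_complex Phi m s :=
  \sum_(k < n) dinj (k : nat) (ksgn (t - n%:Z)
      (act (deg_shift_dL n k e) x (twist E n k m))).

Definition hoch_tw m (t s : int) (e : t = s + 1) :
    hoch_complex Phi m t -> hoch_complex Phi m s := dlift (hoch_tw_comp e).

Lemma hoch_difE m (t s : int) (e : t = s + 1) (x : hoch_complex Phi m t) :
  dif e x = hoch_d0 e x + hoch_tw e x.
Proof. by rewrite /hoch_d0 /hoch_tw /dlift -big_split. Qed.

Lemma hoch_d0_compD m (t s : int) (e : t = s + 1) n :
  add_map (fun x => dinj n (dif (deg_shift_dif n e) x) : hoch_complex Phi m s).
Proof. by move=> x y; rewrite fob_difD dinjD. Qed.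

Lemma hoch_tw_compD m (t s : int) (e : t = s + 1) n :
  add_map (@hoch_tw_comp m t s e n).
Proof.
apply: add_map_bigsum => k x y.
by rewrite (act_addl hP) ksgnD dinjD.
Qed.

Lemma hoch_d0D m (t s : int) (e : t = s + 1) : add_map (@hoch_d0 m t s e).
Proof. by apply: dliftD => n; exact: hoch_d0_compD. Qed.

Lemma hoch_twD m (t s : int) (e : t = s + 1) : add_map (@hoch_tw m t s e).
Proof. by apply: dliftD => n; exact: hoch_tw_compD. Qed.

Lemma hoch_difD m (t s : int) (e : t = s + 1) :
  add_map (@dif (hoch_complex Phi m) t s e).
Proof. by move=> x y; rewrite !hoch_difE hoch_d0D hoch_twD addrACA. Qed.

Lemma hoch_d0_inj m (t s : int) (e : t = s + 1) n (x : Phi (n.+1 + m)%N (t - n%:Z)) :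
  hoch_d0 e (dinj n x : hoch_complex Phi m t) = dinj n (dif (deg_shift_dif n e) x).
Proof.
apply: (@dlift_inj _ _ (fun n x => dinj n (dif (deg_shift_dif n e) x) : hoch_complex Phi m s)).
by move=> k; exact: (add_map0 (@hoch_d0_compD _ _ _ e k)).
Qed.

Lemma hoch_tw_inj m (t s : int) (e : t = s + 1) n (x : Phi (n.+1 + m)%N (t - n%:Z)) :
  hoch_tw e (dinj n x : hoch_complex Phi m t) = hoch_tw_comp e x.
Proof. by rewrite /hoch_tw dlift_inj // => k; exact: (add_map0 (@hoch_tw_compD _ _ _ e k)). Qed.

Lemma hoch_d0_sq m (t s r : int) (e : t = s + 1) (e' : s = r + 1)
  (x : hoch_complex Phi m t) : hoch_d0 e' (hoch_d0 e x) = 0.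
Proof.
move: x; apply: dsum_ext; first exact: (add_map_comp (hoch_d0D e') (hoch_d0D e)).
  exact: add_map_zero.
move=> n a; rewrite !hoch_d0_inj; have [_ ->] := fob_complex hP (n.+1 + m).
by rewrite (add_map0 (@dinjD _ _)).
Qed.

(** By the Leibniz rule the mixed terms of d and t add up to the action of the differential of the
    twist, which the square of t cancels by [twist_dif]. *)
Lemma hoch_dif_sq m (t s r : int) (e : t = s + 1) (e' : s = r + 1)
  (x : hoch_complex Phi m t) : dif e' (dif e x) = 0.
Proof.
move: x; apply: dsum_ext; first exact: (add_map_comp (hoch_difD e') (hoch_difD e)).
  exact: add_map_zero.
move=> n x; rewrite (hoch_difE e) hoch_difD !hoch_difE hoch_d0_sq add0r.
rewrite hoch_d0_inj !hoch_tw_inj.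
rewrite (add_map_sum _ _ _ (hoch_d0D e')) (add_map_sum _ _ _ (hoch_twD e')).
under eq_bigr => k _ do rewrite hoch_d0_inj.
under [X in _ + (_ + X)]eq_bigr => k _ do rewrite hoch_tw_inj /hoch_tw_comp.
set G := fun k l : nat => dinj l (ksgn (s - k%:Z) (act (deg_shift_dL k l e')
  (ksgn (t - n%:Z) (act (deg_shift_dL n k e) x (twist E n k m))) (twist E k l m)))
  : hoch_complex Phi m r.
(* The square of t is collected according to its final index, to be compared with the mixed terms
   landing there. *)
rewrite -[X in _ + (_ + X)]/(\sum_(k < n) \sum_(l < k) G k l) sum_triangle.
rewrite /hoch_tw_comp -!big_split big1 //= => k _; rewrite /G.
rewrite -(add_map_sum _ _ _ (@dinjD (fun n => Phi (n.+1 + m)%N (r - n%:Z)) k)) -!dinjD.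
rewrite -[RHS](add_map0 (@dinjD _ k)); congr dinj.
have kn := ltn_ord k.
have ek : n%:Z - k%:Z - 1 = (n%:Z - k%:Z - 1 - 1) + 1 by rewrite subrK.
have el l : (n%:Z - l%:Z - 1) + (l%:Z - k%:Z - 1) = n%:Z - k%:Z - 1 - 1 by lia.
have e2 : (t - n%:Z) + (n%:Z - k%:Z - 1 - 1) = r - k%:Z by lia.
rewrite (add_map_ksgn _ (fob_difD _)).
rewrite (act_dif hP _ (deg_shift_dif n e) ek _ (deg_shift_dL n k e') e2).
rewrite (@twist_dif E n k m _ ek el kn) (add_map_sum _ _ _ (@act_addr _ _ hP _ _ _ _ _ e2 x)).
rewrite !(ksgnD, ksgn_ksgn) addrA.
(* The two terms containing the differential of [x] carry the signs of t - n and s - n, which are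
   opposite as t = s + 1. *)
rewrite (@ksgnN _ (s - n%:Z) (t - n%:Z)); last by rewrite e; lia.
rewrite addKr.
rewrite (add_map_sum _ _ _ (@ksgnD _ _)) -big_split big_nat big1 //= => l /andP [kl ln].
rewrite (add_map_ksgn _ (@act_addr _ _ hP _ _ _ _ _ e2 x)).
rewrite (add_map_ksgn _ (@act_addl _ _ hP _ _ _ _ _ _ _)) !ksgn_ksgn.
have e3 : t - n%:Z + (n%:Z - l%:Z - 1) = s - l%:Z by rewrite e; lia.
rewrite -(act_comp hP e3 (deg_shift_dL l k e')) (act_irr e3 (deg_shift_dL n l e)).
rewrite (@ksgnN _ (s - _ + _) (t - n%:Z + (t - n%:Z) + (n%:Z - l%:Z))) ?subrr //.
by rewrite e; lia.
Qed.

Lemma hoch_act_compD m p n (i j k : int) (e : i + j = k) (f : mor E m p j) :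
  add_map (fun y : Phi (n.+1 + m)%N (i - n%:Z) => dinj n (ksgn (n%:Z * j)
      (act (deg_shift_act n e) y (mon (add0r j) (idm n.+1) f : mor E _ _ _)))
    : hoch_complex Phi p k).
Proof. by move=> x y; rewrite (act_addl hP) ksgnD dinjD. Qed.

Lemma hoch_act_inj m p n (i j k : int) (e : i + j = k) (f : mor E m p j)
    (y : Phi (n.+1 + m)%N (i - n%:Z)) :
  hoch_act e (dinj n y : hoch_complex Phi m i) f = dinj n (ksgn (n%:Z * j)
      (act (deg_shift_act n e) y (mon (add0r j) (idm n.+1) f : mor E _ _ _))).
Proof.
apply: (@dlift_inj _ _ (fun n (y : Phi (n.+1 + m)%N (i - n%:Z)) => dinj n (ksgn (n%:Z * j)
      (act (deg_shift_act n e) y (mon (add0r j) (idm n.+1) f : mor E _ _ _)))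
    : hoch_complex Phi p k)).
by move=> l; exact: (add_map0 (@hoch_act_compD _ _ l _ _ _ e f)).
Qed.

Lemma hoch_act_addl m p (i j k : int) (e : i + j = k) (f : mor E m p j) :
  add_map (fun x : hoch_complex Phi m i => hoch_act e x f).
Proof. by apply: dliftD => n; exact: hoch_act_compD. Qed.

Lemma hoch_act_addr m p (i j k : int) (e : i + j = k) (x : hoch_complex Phi m i) :
  add_map (fun f : mor E m p j => hoch_act e x f).
Proof.
move=> f g; move: x; apply: dsum_ext; first exact: hoch_act_addl.
  by apply: add_map_add; exact: hoch_act_addl.
move=> n a; rewrite !hoch_act_inj -dinjD -ksgnD -(act_addr hP).
by rewrite -(mon_addr PE).
Qed.

(** The point is the Leibniz rule for the twisted part: moving [f] past the twist costs j(n - l -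
    1), which together with the change of total degree by j turns the sign of n j in [hoch_act] into
    that of l j. Being a functor again is what permits iterating the construction. *)
Lemma hoch_is_dgfun : is_dgfun (hoch Phi).
Proof.
split.
- by move=> m; split; [exact: hoch_difD | exact: hoch_dif_sq].
- exact: hoch_act_addl.
- exact: hoch_act_addr.
- move=> m p i j k i' j' k' e ei ej ek e1 e2 x f; move: x; apply: dsum_ext.
  + exact: (add_map_comp (hoch_difD ek) (hoch_act_addl e f)).
  + apply: add_map_add; first exact: (add_map_comp (hoch_act_addl e1 f) (hoch_difD ei)).
    exact: (add_map_comp (@ksgnD _ _) (hoch_act_addl e2 (dif ej f))).
  move=> n x; rewrite [act _ _ _]hoch_act_inj !hoch_difE hoch_d0_inj hoch_tw_inj.
  rewrite [act _ _ (dif ej f)]hoch_act_inj hoch_d0_inj hoch_tw_inj.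
  rewrite [act _ (_ + _) f]hoch_act_addl [hoch_act _ (dinj _ _) f]hoch_act_inj.
  rewrite -(add_map_ksgn _ (@dinjD _ _)) addrAC -dinjD; congr (dinj _ _ + _).
    rewrite (add_map_ksgn _ (fob_difD _)).
    rewrite (act_dif hP _ (deg_shift_dif n ei) ej _ (deg_shift_act n e1) (deg_shift_act n e2)).
    rewrite ksgnD mon_id_dif !ksgn_ksgn; congr (_ + _).
    by apply: ksgn_eq; rewrite ej; lia.
  rewrite /hoch_tw_comp (add_map_sum _ _ _ (hoch_act_addl e1 f)); apply: eq_bigr => l _.
  rewrite [RHS]hoch_act_inj; congr dinj.
  rewrite !(add_map_ksgn _ (@act_addl _ _ hP _ _ _ _ _ _ _)) !ksgn_ksgn.
  have a1 : n%:Z - l%:Z - 1 + j = n%:Z - l%:Z - 1 + j by [].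
  have a2 : j + (n%:Z - l%:Z - 1) = n%:Z - l%:Z - 1 + j by rewrite addrC.
  have a3 : i - n%:Z + (n%:Z - l%:Z - 1 + j) = k' - l%:Z by lia.
  rewrite (act_comp hP _ _ a2 a3) (act_comp hP _ _ a1 a3) (@twist_comm E n l m p j _ a1 a2 f).
  rewrite (add_map_ksgn _ (@act_addr _ _ hP _ _ _ _ _ a3 x)) ksgn_ksgn.
  apply: ksgn_eq.
  have -> : k = i + j by [].
  lia.
- move=> m i e x; move: x; apply: dsum_ext; [exact: hoch_act_addl | by []|].
  move=> n a; rewrite [LHS]hoch_act_inj mulr0 ksgn0.
  by rewrite (mon_id PE) (act_id hP).
- move=> m p q i j k ij jk t e1 e2 e3 e4 x f g; move: x; apply: dsum_ext.
  + exact: (add_map_comp (hoch_act_addl e2 g) (hoch_act_addl e1 f)).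
  + exact: hoch_act_addl.
  move=> n a; rewrite [act e1 _ _]hoch_act_inj [LHS]hoch_act_inj [RHS]hoch_act_inj.
  congr dinj; rewrite (add_map_ksgn _ (@act_addl _ _ hP _ _ _ _ _ _ _)) ksgn_ksgn.
  rewrite -mulrDr [k + j]addrC e3; congr ksgn.
  rewrite (mon_id_comp _ e3).
  exact: (act_comp hP).
Qed.
End HochFunctor.

(** * Perturbation of contractions *)

Lemma perturbation_cancel (V : zmodType) (y a h p q r s : V) :
  ((y - a - h) - p) + (h + r - q) - (y - (a - s)) = - (p + q - (r - s)).
Proof.
rewrite !opprB opprD !addrA.
by rewrite [LHS](ACl ((1*10)*(2*8)*(3*5)*(6*9*4*7))) /= subrr !addNr !add0r.
Qed.

Section Perturbation.
Variables (C D : gcx).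
Variables (dC tC : forall i j : int, i = j + 1 -> C i -> C j).
Variables (dD tD : forall i j : int, i = j + 1 -> D i -> D j).
Arguments dC {i j}.
Arguments tC {i j}.
Arguments dD {i j}.
Arguments tD {i j}.
Variables (eta : gmap C D) (alpha : gmap D C).
Variable htp : forall i j : int, j = i + 1 -> D i -> D j.
Arguments htp {i j}.
Variables (beta : gmap C D) (Htp : forall i j : int, j = i + 1 -> D i -> D j).
Arguments Htp {i j}.

Hypothesis difC : forall i j (e : i = j + 1) x, dif e x = dC e x + tC e x.
Hypothesis difD : forall i j (e : i = j + 1) x, dif e x = dD e x + tD e x.
Hypothesis dDD : forall i j (e : i = j + 1), add_map (dD e).
Hypothesis tDD : forall i j (e : i = j + 1), add_map (tD e).
Hypothesis dD_sq : forall i j k (e : i = j + 1) (e' : j = k + 1) x, dD e' (dD e x) = 0.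
Hypothesis dif_sq : forall i j k (e : i = j + 1) (e' : j = k + 1) (x : D i),
  dif e' (dif e x) = 0.
Hypothesis etaD : forall i, add_map (@eta i).
Hypothesis eta_d : forall i j (e : i = j + 1) x, eta (dC e x) = dD e (eta x).
Hypothesis alphaD : forall i, add_map (@alpha i).
Hypothesis alpha_t : forall i j (e : i = j + 1) x, alpha (tD e x) = tC e (alpha x).
Hypothesis tCD : forall i j (e : i = j + 1), add_map (tC e).
Hypothesis alpha_eta : forall i (x : C i), alpha (eta x) = x.
Hypothesis htpD : forall i j (e : j = i + 1), add_map (htp e).
Hypothesis alpha_htp : forall i j (e : j = i + 1) x, alpha (htp e x) = 0.
Hypothesis htp_eq : forall i j k (e : j = i + 1) (e' : i = k + 1) x,
  dD e (htp e x) + htp e' (dD e' x) = x - eta (alpha x).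

(** The operator K = - h t. The perturbed maps [beta] and [Htp] enter only through the fixed-point
    equations [betaE] and [HtpE], with [step_uniq] as the uniqueness principle. *)
Definition perturb_step i (y : D i) : D i := - htp (subr1K i) (tD (subr1K i) y).

Hypothesis step_uniq : forall i (y : D i), y = perturb_step y -> y = 0.
Hypothesis betaE : forall i (x : C i), beta x = eta x + perturb_step (beta x).
Hypothesis HtpE : forall i j (e : j = i + 1) y,
  Htp e y = htp e y + perturb_step (Htp e y).

Lemma perturb_stepE i j (e : i = j + 1) (y : D i) :
  perturb_step y = - htp e (tD e y).
Proof.
rewrite /perturb_step; have ej : i - 1 = j by rewrite e addrK.
by move: (subr1K i); rewrite ej => e'; rewrite (eq_irrelevance e' e).
Qed.

(** From (d + t)^2 = 0 and d^2 = 0. *)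
Lemma dD_tD i j k (e : i = j + 1) (e' : j = k + 1) (y : D i) :
  dD e' (tD e y) = - tD e' (dif e y).
Proof.
apply/eqP; rewrite -addr_eq0; apply/eqP.
have := dif_sq e e' y; rewrite !difD dDD dD_sq add0r => h.
by rewrite -[RHS]h tDD.
Qed.

Lemma alpha_step i (y : D i) : alpha (perturb_step y) = 0.
Proof. by rewrite /perturb_step (add_mapN (@alphaD _)) alpha_htp oppr0. Qed.

Lemma perturbed_section i (x : C i) : alpha (beta x) = x.
Proof. by rewrite betaE alphaD alpha_step addr0 alpha_eta. Qed.

Lemma perturbed_htp0 i j (e : j = i + 1) y : alpha (Htp e y) = 0.
Proof. by rewrite HtpE alphaD alpha_step addr0 alpha_htp. Qed.

(** The homotopy formula applied to t y, with alpha t = t alpha used to rewrite its last term. *)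
Lemma dD_step i j k (e : i = j + 1) (e' : j = k + 1) (y : D i) :
  dD e (perturb_step y) + tD e y = eta (tC e (alpha y)) + htp e' (dD e' (tD e y)).
Proof.
rewrite (perturb_stepE e) (add_mapN (@dDD _ _ _)).
have /(canRL (addrK _)) -> := htp_eq e e' (tD e y).
by rewrite alpha_t !opprD !opprK [LHS]addrC !addrA subrr add0r.
Qed.

(** The defect of [beta] from being a chain map is a fixed point of K, hence zero: the terms with
    eta agree by [eta_d], and [dD_tD] brings the rest into the form K of the defect. *)
Lemma perturbed_chain i j (e : i = j + 1) (x : C i) :
  beta (dif e x) = dif e (beta x).
Proof.
apply/esym/eqP; rewrite -subr_eq0; apply/eqP/step_uniq.
have bE : dif e (beta x) = eta (dif e x) + htp (subr1K j) (dD (subr1K j) (tD e (beta x))).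
  rewrite difD {1}betaE dDD -addrA (dD_step e (subr1K j)) perturbed_section.
  by rewrite -eta_d addrA -etaD -difC.
rewrite {1}bE [beta (dif e x) in LHS]betaE opprD addrACA subrr add0r dD_tD.
rewrite !(perturb_stepE (subr1K j)) (add_mapN (@htpD _ _ _)).
by rewrite (add_mapB (@tDD _ _ _)) (add_mapB (@htpD _ _ _)) opprK opprB addrC.
Qed.

(** Again the difference of the two sides is a fixed point of K. Here alpha of the perturbed
    homotopy is zero, so no eta term arises from [dD_step]. *)
Lemma perturbed_homotopy i j k (e : j = i + 1) (e' : i = k + 1) (y : D i) :
  dif e (Htp e y) + Htp e' (dif e' y) = y - beta (alpha y).
Proof.
apply/eqP; rewrite -subr_eq0; apply/eqP/step_uniq.
have sE : dif e (Htp e y) =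
    (y - eta (alpha y) - htp e' (dD e' y)) + htp e' (dD e' (tD e (Htp e y))).
  rewrite difD {1}HtpE dDD -addrA (dD_step e e') perturbed_htp0 (add_map0 (tCD e)).
  by rewrite (add_map0 (@etaD _)) add0r -(htp_eq e e' y) addrK.
rewrite dD_tD (add_mapN (@htpD _ _ _)) in sE.
have HE := HtpE e' (dif e' y); rewrite (perturb_stepE e') in HE.
have hE : htp e' (dif e' y) = htp e' (dD e' y) + htp e' (tD e' y) by rewrite difD htpD.
rewrite {1}hE in HE.
have bE := betaE (alpha y); rewrite (perturb_stepE e') in bE.
rewrite [in RHS](perturb_stepE e') (add_mapB (@tDD _ _ _)) (add_mapB (@htpD _ _ _)).
rewrite tDD htpD (add_mapB (@tDD _ _ _)) (add_mapB (@htpD _ _ _)).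
rewrite {1}sE {1}HE {1}bE.
exact: perturbation_cancel.
Qed.
End Perturbation.

(* cinc is a chain map for each object m, not assumed natural in m.               *)
Record contraction (E : dgcat_data) (Phi Psi : fun_data E) := Contraction {
  cinc : fmap Phi Psi;
  chtp : forall m (i j : int), j = i + 1 -> Psi m i -> Psi m j }.
Arguments cinc {E Phi Psi} c m i x.
Arguments chtp {E Phi Psi} c {m i j}.

Record is_contraction (E : dgcat_data) (Phi Psi : fun_data E)
    (alpha : fmap Psi Phi) (c : contraction Phi Psi) : Prop := IsContraction {
  cinc_chain : forall m, chain_map (cinc c m);
  chtp_add : forall m (i j : int) (e : j = i + 1), add_map (@chtp _ _ _ c m i j e);
  cinc_section : forall m (i : int) (x : Phi m i), alpha m i (cinc c m i x) = x;
  chtp_aug : forall m (i j : int) (e : j = i + 1) (x : Psi m i), alpha m j (chtp c e x) = 0;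
  chtp_eq : forall m (i j k : int) (e : j = i + 1) (e' : i = k + 1) (x : Psi m i),
    dif e (chtp c e x) + chtp c e' (dif e' x) = x - cinc c m i (alpha m i x) }.

(* A dg-functor j as in the theorem need not be monoidal, but it preserves the   *)
(* tensor products of morphisms coming from A_infinity; so naturality is only    *)
(* required along those.                                                         *)
Record amul_natural (E E' : ainf_prop) (Phi : fun_data E) (Phi' : fun_data E')
    (th : fmap Phi Phi') : Prop := AmulNatural {
  an_chain : forall m, chain_map (th m);
  an_act : forall m n (i j k : int) (e : i + j = k) (x : Phi m i) (f : mor Ainf m n j),
    th n k (act e x (amul E f)) = act e (th m i x) (amul E' f) }.

(** * Maps induced on Hochschild complexes *)

Section HochMap.
Variables (E E' : ainf_prop) (Phi : fun_data E) (Phi' : fun_data E') (th : fmap Phi Phi').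
Hypotheses (hP : is_dgfun Phi) (hP' : is_dgfun Phi') (hth : amul_natural th).

Lemma amul_naturalD m i : add_map (@th m i).
Proof. by have [] := an_chain hth m. Qed.

Lemma hoch_map_compD m t n :
  add_map (fun y : Phi (n.+1 + m)%N (t - n%:Z) => dinj n (@th _ _ y) : hoch Phi' m t).
Proof. by move=> x y; rewrite amul_naturalD dinjD. Qed.

Lemma hoch_mapD m t : add_map (@hoch_map E E' Phi Phi' th m t).
Proof. by apply: dliftD => n; exact: hoch_map_compD. Qed.

Lemma hoch_map_inj m t n (y : Phi (n.+1 + m)%N (t - n%:Z)) :
  hoch_map th (dinj n y : hoch Phi m t) = dinj n (@th _ _ y).
Proof.
apply: (@dlift_inj _ _ (fun n (y : Phi (n.+1 + m)%N (t - n%:Z)) =>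
  dinj n (@th _ _ y) : hoch Phi' m t)) => k.
exact: (add_map0 (@hoch_map_compD m t k)).
Qed.

Lemma hoch_map_d0 m t s (e : t = s + 1) (x : hoch Phi m t) :
  hoch_map th (hoch_d0 e x) = hoch_d0 e (hoch_map th x).
Proof.
move: x; apply: dsum_ext.
- exact: (add_map_comp (@hoch_mapD m s) (hoch_d0D hP e)).
- exact: (add_map_comp (hoch_d0D hP' e) (@hoch_mapD m t)).
move=> n y; rewrite hoch_d0_inj // hoch_map_inj [hoch_map _ _]hoch_map_inj hoch_d0_inj //.
by have [_ ->] := an_chain hth (n.+1 + m).
Qed.

Lemma hoch_map_tw m t s (e : t = s + 1) (x : hoch Phi m t) :
  hoch_map th (hoch_tw e x) = hoch_tw e (hoch_map th x).
Proof.
move: x; apply: dsum_ext.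
- exact: (add_map_comp (@hoch_mapD m s) (hoch_twD hP e)).
- exact: (add_map_comp (hoch_twD hP' e) (@hoch_mapD m t)).
move=> n y; rewrite hoch_tw_inj // [in RHS]hoch_map_inj hoch_tw_inj //.
rewrite /hoch_tw_comp (add_map_sum _ _ _ (@hoch_mapD m s)); apply: eq_bigr => k _.
rewrite hoch_map_inj (add_map_ksgn _ (@amul_naturalD _ _)).
by rewrite !twist_amul (an_act hth).
Qed.

(** The action of i(f) on the Hochschild complex is the action of id + i(f), again in the image of
    A_infinity; so the weak naturality passes to every iterate. *)
Lemma hoch_map_natural : amul_natural (hoch_map th).
Proof.
split=> [m|m n i j k e x f].
  split; first exact: hoch_mapD.
  move=> i j e x; rewrite !hoch_difE hoch_mapD hoch_map_d0 hoch_map_tw.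
  by rewrite -hoch_difE.
move: x; apply: dsum_ext.
- exact: (add_map_comp (@hoch_mapD n k) (hoch_act_addl hP e _)).
- exact: (add_map_comp (hoch_act_addl hP' e _) (@hoch_mapD m i)).
move=> l y; rewrite [act e _ _]hoch_act_inj // hoch_map_inj [hoch_map _ _]hoch_map_inj.
rewrite [RHS]hoch_act_inj // (add_map_ksgn _ (@amul_naturalD _ _)) !mon_id_amul.
by rewrite (an_act hth).
Qed.
End HochMap.

(** * Contractions of Hochschild complexes *)

Section HochContraction.
Variables (E : ainf_prop) (Phi Psi : fun_data E) (c : contraction Phi Psi).

Definition hoch_inc m t (x : hoch Phi m t) : hoch Psi m t := hoch_map (cinc c) x.

Definition hoch_htp m (i j : int) (e : j = i + 1) : hoch Psi m i -> hoch Psi m j :=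
  dlift (fun n (y : Psi (n.+1 + m)%N (i - n%:Z)) =>
    dinj n (chtp c (deg_shift_dif n e) y) : hoch Psi m j).

Definition hoch_step m t (y : hoch Psi m t) : hoch Psi m t :=
  - hoch_htp (subr1K t) (hoch_tw (subr1K t) y).

Definition hoch_contraction : contraction (hoch Phi) (hoch Psi) :=
  @Contraction E (hoch Phi) (hoch Psi)
    (fun m t x => resolvent (@hoch_step m t) (hoch_inc x))
    (fun m i j e y => resolvent (@hoch_step m j) (hoch_htp e y)).

Variable alpha : fmap Psi Phi.
Hypotheses (hPhi : is_dgfun Phi) (hPsi : is_dgfun Psi).
Hypotheses (ha : amul_natural alpha) (hc : is_contraction alpha c).

Lemma cincD m i : add_map (cinc c m i).
Proof. by have [] := cinc_chain hc m. Qed.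

Lemma hoch_htp_compD m (i j : int) (e : j = i + 1) n :
  add_map (fun y : Psi (n.+1 + m)%N (i - n%:Z) =>
    dinj n (chtp c (deg_shift_dif n e) y) : hoch Psi m j).
Proof. by move=> x y; rewrite (chtp_add hc) dinjD. Qed.

Lemma hoch_htpD m (i j : int) (e : j = i + 1) : add_map (@hoch_htp m i j e).
Proof. by apply: dliftD => n; exact: hoch_htp_compD. Qed.

Lemma hoch_htp_inj m (i j : int) (e : j = i + 1) n (y : Psi (n.+1 + m)%N (i - n%:Z)) :
  hoch_htp e (dinj n y : hoch Psi m i) = dinj n (chtp c (deg_shift_dif n e) y).
Proof.
apply: (@dlift_inj _ _ (fun n (y : Psi (n.+1 + m)%N (i - n%:Z)) =>
  dinj n (chtp c (deg_shift_dif n e) y) : hoch Psi m j)) => k.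
exact: (add_map0 (@hoch_htp_compD m i j e k)).
Qed.

Lemma hoch_inc_compD m t n :
  add_map (fun y : Phi (n.+1 + m)%N (t - n%:Z) => dinj n (cinc c _ _ y) : hoch Psi m t).
Proof. by move=> x y; rewrite cincD dinjD. Qed.

Lemma hoch_incD m t : add_map (@hoch_inc m t).
Proof. by apply: dliftD => n; exact: hoch_inc_compD. Qed.

Lemma hoch_inc_inj m t n (y : Phi (n.+1 + m)%N (t - n%:Z)) :
  hoch_inc (dinj n y : hoch Phi m t) = dinj n (cinc c _ _ y).
Proof.
apply: (@dlift_inj _ _ (fun n (y : Phi (n.+1 + m)%N (t - n%:Z)) =>
  dinj n (cinc c _ _ y) : hoch Psi m t)) => k.
exact: (add_map0 (@hoch_inc_compD m t k)).
Qed.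

Lemma hoch_stepD m t : add_map (@hoch_step m t).
Proof.
by apply: add_map_opp; exact: (add_map_comp (hoch_htpD (subr1K t)) (hoch_twD hPsi (subr1K t))).
Qed.

(** The twist sends the summand of index n to those of index k < n, and the homotopy preserves the
    index. *)
Lemma hoch_step_low m t N (x : hoch Psi m t) :
  vanish_from (val x) N.+1 -> vanish_from (val (hoch_step x)) N.
Proof.
move=> hx; rewrite (dsum_decomp hx) (add_map_sum _ _ _ (@hoch_stepD m t)).
apply: vanish_sum => n _; rewrite /hoch_step hoch_tw_inj // /hoch_tw_comp.
rewrite (add_map_sum _ _ _ (hoch_htpD _)) -sumrN; apply: vanish_sum => k _.
rewrite hoch_htp_inj -(add_mapN (@dinjD _ _)); apply: vanish_dinj.
by rewrite (leq_trans (ltn_ord k)) // -ltnS ltn_ord.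
Qed.

Lemma hoch_alpha_tw m i j (e : i = j + 1) x :
  hoch_map alpha (hoch_tw e x : hoch Psi m j) = hoch_tw e (hoch_map alpha x).
Proof. exact: (hoch_map_tw hPsi hPhi ha). Qed.

(** Applied summand by summand, [c] is a contraction for the untwisted differential [hoch_d0]; the
    perturbation results are used with [hoch_tw] as perturbation, which commutes with the map
    induced by [alpha]. *)
Lemma hoch_is_contraction : is_contraction (hoch_map alpha) hoch_contraction.
Proof.
have res m t := @resolvent_step _ (@hoch_step m t) (@hoch_stepD m t) (@hoch_step_low m t).
have uniq m t := @resolvent_uniq _ (@hoch_step m t) (@hoch_step_low m t).
have aD := hoch_mapD ha.
have inc_d m i j (e : i = j + 1) x :
    hoch_inc (hoch_d0 e x : hoch Phi m j) = hoch_d0 e (hoch_inc x).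
  move: x; apply: dsum_ext.
  - exact: (add_map_comp (@hoch_incD m j) (hoch_d0D hPhi e)).
  - exact: (add_map_comp (hoch_d0D hPsi e) (@hoch_incD m i)).
  move=> n y; rewrite hoch_d0_inj // !hoch_inc_inj hoch_d0_inj //.
  by have [_ ->] := cinc_chain hc (n.+1 + m).
have a_inc m i (x : hoch Phi m i) : hoch_map alpha (hoch_inc x) = x.
  move: x; apply: dsum_ext => [||n y];
    [exact: (add_map_comp (@aD m i) (@hoch_incD m i)) | by []|].
  by rewrite hoch_inc_inj hoch_map_inj // (cinc_section hc).
have a_htp m i j (e : j = i + 1) (x : hoch Psi m i) : hoch_map alpha (hoch_htp e x) = 0.
  move: x; apply: dsum_ext => [||n y];
    [exact: (add_map_comp (@aD m j) (hoch_htpD e)) | exact: add_map_zero|].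
  by rewrite hoch_htp_inj hoch_map_inj // (chtp_aug hc) (add_map0 (@dinjD _ _)).
have h_eq m i j k (e : j = i + 1) (e' : i = k + 1) (x : hoch Psi m i) :
    hoch_d0 e (hoch_htp e x) + hoch_htp e' (hoch_d0 e' x) = x - hoch_inc (hoch_map alpha x).
  move: x; apply: dsum_ext => [||n y].
  - apply: add_map_add; first exact: (add_map_comp (hoch_d0D hPsi e) (hoch_htpD e)).
    exact: (add_map_comp (hoch_htpD e') (hoch_d0D hPsi e')).
  - apply: (@add_map_add _ _ id) => //; apply: add_map_opp.
    exact: (add_map_comp (@hoch_incD m i) (@aD m i)).
  rewrite hoch_htp_inj !hoch_d0_inj // hoch_htp_inj hoch_map_inj // hoch_inc_inj.
  by rewrite -dinjD -(add_mapB (@dinjD _ _)) (chtp_eq hc).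
have resI m t x := res m t (hoch_inc x).
have resH m i j (e : j = i + 1) x := res m j (hoch_htp e x).
have d0D m := fun i j e => @hoch_d0D E Psi hPsi m i j e.
have twD m := fun i j e => @hoch_twD E Psi hPsi m i j e.
have twD' m := fun i j e => @hoch_twD E Phi hPhi m i j e.
have d0sq m := fun i j k e e' x => @hoch_d0_sq E Psi hPsi m i j k e e' x.
have dsq m := fun i j k e e' x => @hoch_dif_sq E Psi hPsi m i j k e e' x.
have dE m := fun i j e x => @hoch_difE E Psi m i j e x.
have dE' m := fun i j e x => @hoch_difE E Phi m i j e x.
have atw m := fun i j e x => @hoch_alpha_tw m i j e x.
have incD m := fun i => @hoch_incD m i.
have htpD m := fun i j e => @hoch_htpD m i j e.
split=> /=.
- move=> m; split=> [i x y|i j e x].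
    by rewrite hoch_incD (resolventD (@hoch_stepD m i) (@hoch_step_low m i)).
  exact: (perturbed_chain (dE' m) (dE m) (d0D m) (twD m) (d0sq m) (dsq m) (incD m) (inc_d m)
    (aD m) (atw m) (a_inc m) (htpD m) (a_htp m) (h_eq m) (uniq m) (resI m)).
- move=> m i j e x y.
  by rewrite hoch_htpD (resolventD (@hoch_stepD m j) (@hoch_step_low m j)).
- move=> m i x.
  exact: (perturbed_section (aD m) (a_inc m) (a_htp m) (resI m)).
- move=> m i j e x.
  exact: (perturbed_htp0 (aD m) (a_htp m) (resH m)).
- move=> m i j k e e' x.
  exact: (perturbed_homotopy (dE m) (d0D m) (twD m) (d0sq m) (dsq m) (incD m)
    (aD m) (atw m) (twD' m) (htpD m) (a_htp m) (h_eq m) (uniq m) (resI m) (resH m)).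
Qed.
End HochContraction.

(** The chain map alpha is a left inverse, which gives injectivity on homology, and the homotopy
    gives surjectivity. *)
Lemma contraction_quasi_iso (E : ainf_prop) (Phi Psi : fun_data E) (alpha : fmap Psi Phi)
    (c : contraction Phi Psi) m :
  is_complex (Phi m) -> is_complex (Psi m) -> chain_map (alpha m) ->
  is_contraction alpha c -> quasi_iso (cinc c m).
Proof.
move=> cP cS [aD aC] hc; split=> //; first exact: (cinc_chain hc).
move=> i; split=> [x y _ _ [k [e [b hb]]]|z hz].
  exists k, e, (alpha m k b); rewrite -aC -hb (add_mapB (aD i)).
  by rewrite !(cinc_section hc).
exists (alpha m i z).
  by move=> j e; rewrite -aC hz (add_map0 (aD j)).
(* For a cycle z the homotopy formula reads d h z = z - inc (alpha z), hence the bounding chain - h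
   z. *)
exists (i + 1), erefl, (- chtp c erefl z).
rewrite (add_mapN (proj1 cS _ _ _)).
have := chtp_eq hc (erefl (i + 1)) (subr1K i) z.
by rewrite hz (add_map0 (chtp_add hc _)) addr0 => ->; rewrite opprB.
Qed.

(** Compatibility with the homotopies is included because they enter the inclusion at the next
    Hochschild iterate. *)
Definition contraction_compat (E E' : dgcat_data) (Phi Psi : fun_data E)
    (Phi' Psi' : fun_data E') (th : fmap Phi Phi') (ph : fmap Psi Psi')
    (c : contraction Phi Psi) (c' : contraction Phi' Psi') : Prop :=
  (forall m i x, ph m i (cinc c m i x) = cinc c' m i (th m i x)) /\
  (forall m i j (e : j = i + 1) y, ph m j (chtp c e y) = chtp c' e (ph m i y)).

(** * Naturality of the perturbed contractions *)

Section Compat.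
Variables (E E' : ainf_prop) (Phi Psi : fun_data E) (Phi' Psi' : fun_data E').
Variables (th : fmap Phi Phi') (ph : fmap Psi Psi').
Variables (c : contraction Phi Psi) (c' : contraction Phi' Psi').
Variables (alpha : fmap Psi Phi) (alpha' : fmap Psi' Phi').
Hypotheses (hPsi : is_dgfun Psi) (hPsi' : is_dgfun Psi').
Hypotheses (hth : amul_natural th) (hph : amul_natural ph).
Hypotheses (hc : is_contraction alpha c) (hc' : is_contraction alpha' c').
Hypothesis cc : contraction_compat th ph c c'.

Lemma hoch_map_inc m i x : hoch_map ph (hoch_inc c x : hoch Psi m i) = hoch_inc c' (hoch_map th x).
Proof.
move: x; apply: dsum_ext => [||n y].
- exact: (add_map_comp (@hoch_mapD _ _ _ _ _ hph m i) (@hoch_incD _ _ _ _ _ hc m i)).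
- exact: (add_map_comp (@hoch_incD _ _ _ _ _ hc' m i) (@hoch_mapD _ _ _ _ _ hth m i)).
rewrite (hoch_inc_inj hc) (hoch_map_inj hph) (hoch_map_inj hth) (hoch_inc_inj hc').
by rewrite (proj1 cc).
Qed.

Lemma hoch_map_htp m i j (e : j = i + 1) x :
  hoch_map ph (hoch_htp c e x : hoch Psi m j) = hoch_htp c' e (hoch_map ph x).
Proof.
move: x; apply: dsum_ext => [||n y].
- exact: (add_map_comp (@hoch_mapD _ _ _ _ _ hph m j) (@hoch_htpD _ _ _ _ _ hc m i j e)).
- exact: (add_map_comp (@hoch_htpD _ _ _ _ _ hc' m i j e) (@hoch_mapD _ _ _ _ _ hph m i)).
rewrite (hoch_htp_inj hc) !(hoch_map_inj hph) (hoch_htp_inj hc').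
by rewrite (proj2 cc).
Qed.

(** The image of a resolvent solves the fixed-point equation of the target, whose solution is
    unique. *)
Lemma hoch_map_resolvent m t y :
  hoch_map ph (resolvent (@hoch_step _ _ _ c m t) y : hoch Psi m t) =
  resolvent (@hoch_step _ _ _ c' m t) (hoch_map ph y).
Proof.
apply: (resolvent_eq (@hoch_stepD _ _ _ _ _ hPsi' hc' m t)
  (@hoch_step_low _ _ _ _ _ hPsi' hc' m t)).
rewrite {1}(resolvent_step (@hoch_stepD _ _ _ _ _ hPsi hc m t)
  (@hoch_step_low _ _ _ _ _ hPsi hc m t)).
rewrite (hoch_mapD hph); congr (_ + _).
rewrite /hoch_step (add_mapN (@hoch_mapD _ _ _ _ _ hph m t)) hoch_map_htp.
by rewrite (hoch_map_tw hPsi hPsi' hph).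
Qed.

Lemma hoch_contraction_compat :
  contraction_compat (hoch_map th) (hoch_map ph) (hoch_contraction c) (hoch_contraction c').
Proof.
split=> [m i x|m i j e y] /=; rewrite hoch_map_resolvent; congr resolvent.
  exact: hoch_map_inc.
exact: hoch_map_htp.
Qed.
End Compat.

(** * Iteration *)

Fixpoint hoch_iter_contraction (E : ainf_prop) (Phi Psi : fun_data E)
    (c : contraction Phi Psi) n : contraction (hoch_iter n Phi) (hoch_iter n Psi) :=
  match n with
  | 0 => c
  | n'.+1 => hoch_contraction (hoch_iter_contraction c n')
  end.

Lemma hoch_iter_is_dgfun (E : ainf_prop) (Phi : fun_data E) n :
  is_dgfun Phi -> is_dgfun (hoch_iter n Phi).
Proof. by move=> hP; elim: n => //= n IH; exact: hoch_is_dgfun. Qed.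

Lemma hoch_iter_map_natural (E E' : ainf_prop) (Phi : fun_data E) (Phi' : fun_data E')
    (th : fmap Phi Phi') n :
  is_dgfun Phi -> is_dgfun Phi' -> amul_natural th -> amul_natural (hoch_iter_map n th).
Proof.
move=> hP hP' hth; elim: n => //= n IH.
by apply: hoch_map_natural => //; exact: hoch_iter_is_dgfun.
Qed.

Lemma hoch_iter_is_contraction (E : ainf_prop) (Phi Psi : fun_data E)
    (alpha : fmap Psi Phi) (c : contraction Phi Psi) n :
  is_dgfun Phi -> is_dgfun Psi -> amul_natural alpha -> is_contraction alpha c ->
  is_contraction (hoch_iter_map n alpha) (hoch_iter_contraction c n).
Proof.
move=> hP hS ha hc; elim: n => //= n IH.
apply: hoch_is_contraction => //; try exact: hoch_iter_is_dgfun.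
exact: hoch_iter_map_natural.
Qed.

Lemma hoch_iter_compat (E E' : ainf_prop) (Phi Psi : fun_data E) (Phi' Psi' : fun_data E')
    (th : fmap Phi Phi') (ph : fmap Psi Psi')
    (c : contraction Phi Psi) (c' : contraction Phi' Psi')
    (alpha : fmap Psi Phi) (alpha' : fmap Psi' Phi') n :
  is_dgfun Phi -> is_dgfun Psi -> is_dgfun Phi' -> is_dgfun Psi' ->
  amul_natural th -> amul_natural ph -> amul_natural alpha -> amul_natural alpha' ->
  is_contraction alpha c -> is_contraction alpha' c' ->
  contraction_compat th ph c c' ->
  contraction_compat (hoch_iter_map n th) (hoch_iter_map n ph)
    (hoch_iter_contraction c n) (hoch_iter_contraction c' n).
Proof.
move=> hP hS hP' hS' hth hph ha ha' hc hc' cc; elim: n => //= n IH.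
apply: (hoch_contraction_compat (alpha := hoch_iter_map n alpha)
  (alpha' := hoch_iter_map n alpha')) => //.
- exact: hoch_iter_is_dgfun.
- exact: hoch_iter_is_dgfun.
- exact: hoch_iter_map_natural.
- exact: hoch_iter_map_natural.
- exact: hoch_iter_is_contraction.
- exact: hoch_iter_is_contraction.
Qed.

(** * The bar construction *)

Section TensBasics.
Variables (E : dgcat_data) (T : nat -> gcx) (n : nat) (k : int).
Notation pi u := (\pi_(Quotient.quot (@tens_relb E T n k)) u)%qT.

Lemma tens_piD (u v : tfree E T n k) : pi (u + v) = pi u + pi v :> tens E T n k.
Proof. exact: (Quotient.pi_add (@tens_relb E T n k)). Qed.

Lemma tens_pi_eq (u v : tfree E T n k) : tens_rel (u - v) -> pi u = pi v :> tens E T n k.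
Proof.
by move=> h; apply/eqP; rewrite -Quotient.idealrBE; apply/asboolP.
Qed.

Lemma tpureDl m (i j : int) (e : i + j = k) (f : mor E m n j) :
  add_map (fun x : T m i => tpure e x f : tens E T n k).
Proof.
move=> x y; rewrite /tpure -tens_piD; apply: tens_pi_eq.
by rewrite opprD addrA; exact: tens_rel_l.
Qed.

Lemma tpureDr m (i j : int) (e : i + j = k) (x : T m i) :
  add_map (fun f : mor E m n j => tpure e x f : tens E T n k).
Proof.
move=> f g; rewrite /tpure -tens_piD; apply: tens_pi_eq.
by rewrite opprD addrA; exact: tens_rel_r.
Qed.

Lemma tens_ext (V : zmodType) (f g : tens E T n k -> V) : add_map f -> add_map g ->
  (forall m (i j : int) (e : i + j = k) (x : T m i) (h : mor E m n j),
     f (tpure e x h) = g (tpure e x h)) -> f =1 g.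
Proof.
move=> fD gD fg u; rewrite -[u](@reprK _ (Quotient.quot (@tens_relb E T n k))).
move: (repr _) => v; rewrite -[v]freeg_sumE.
have fpD : add_map (fun w : tfree E T n k => f (pi w)) by move=> a b; rewrite tens_piD fD.
have gpD : add_map (fun w : tfree E T n k => g (pi w)) by move=> a b; rewrite tens_piD gD.
rewrite (add_map_sum _ _ _ fpD) (add_map_sum _ _ _ gpD); apply: eq_bigr => w _.
have Mz (h : tfree E T n k -> V) (hD : add_map h) (c : int) x : h (x *~ c) = h x *~ c.
  have hn p : h (x *+ p) = h x *+ p.
    elim: p => [|p IH]; first by rewrite !mulr0n add_map0.
    by rewrite !mulrS hD IH.
  by case: c => p; [exact: hn | rewrite !NegzE !mulrNz (add_mapN hD); congr (- _); exact: hn].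
have -> : << coeff w v *g w >> = << w >> *~ (coeff w v) :> tfree E T n k.
  by rewrite freeg_mulz intz.
rewrite (Mz _ fpD) (Mz _ gpD); congr (_ *~ _).
case: w => m i j e x h; exact: fg.
Qed.

Lemma tpure_irr m (i j : int) (e e' : i + j = k) (x : T m i) (f : mor E m n j) :
  tpure e x f = tpure e' x f :> tens E T n k.
Proof. by rewrite (eq_irrelevance e e'). Qed.
End TensBasics.

Section TensFunctor.
Variables (E : dgcat_data) (T : nat -> gcx).
Hypotheses (CE : is_dgcat E) (cT : forall m, is_complex (T m)).

Let difTD m (i j : int) (e : i = j + 1) : add_map (@dif (T m) i j e).
Proof. by have [] := cT m. Qed.

Let difED m n (i j : int) (e : i = j + 1) : add_map (@dif (mor E m n) i j e).
Proof. by have [] := hom_complex CE m n. Qed.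

Lemma tens_dif_biadditive n (t s : int) (e : t = s + 1) :
  biadditive (fun m i j (e' : i + j = t) (x : T m i) (f : mor E m n j) =>
    tpure (addr1_left e' e (subr1K i)) (dif (subr1K i) x) f +
    ksgn i (tpure (addr1_right e' e (subr1K j)) x (dif (subr1K j) f)) : tens E T n s).
Proof.
split=> m i j e' => [f x y|x f g].
  by rewrite difTD !tpureDl ksgnD addrACA.
by rewrite difED !tpureDr ksgnD addrACA.
Qed.

Lemma tensC_difD n (t s : int) (e : t = s + 1) : add_map (@dif (tensC E T n) t s e).
Proof. exact: (tliftD (tens_dif_biadditive n e)). Qed.

Lemma tensC_dif_pure n m (t s i j i' j' : int) (e : t = s + 1) (e' : i + j = t)
    (ei : i = i' + 1) (ej : j = j' + 1) (e1 : i' + j = s) (e2 : i + j' = s)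
    (x : T m i) (f : mor E m n j) :
  dif e (tpure e' x f : tensC E T n t) =
  (tpure e1 (dif ei x) f : tensC E T n s) + ksgn i (tpure e2 x (dif ej f)).
Proof.
rewrite [LHS](tlift_pure _ _ _ (tens_dif_biadditive n e)).
have hi : i - 1 = i' by rewrite ei addrK.
have hj : j - 1 = j' by rewrite ej addrK.
move: (subr1K i) (subr1K j) (addr1_left _ _ _) (addr1_right _ _ _).
rewrite hi hj => a1 a2 a3 a4.
by rewrite (dif_irr a1 ei) (dif_irr a2 ej) (tpure_irr a3 e1) (tpure_irr a4 e2).
Qed.

Lemma tensC_complex n : is_complex (tensC E T n).
Proof.
split=> [|i j k e e']; first exact: tensC_difD.
apply: tens_ext => [||m a b e0 x f].
- exact: (add_map_comp (tensC_difD e') (tensC_difD e)).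
- exact: add_map_zero.
have ea := subr1K a; have eb := subr1K b.
have ea' := subr1K (a - 1); have eb' := subr1K (b - 1).
have h1 : a - 1 + b = j by lia.
have h2 : a + (b - 1) = j by lia.
have h3 : a - 1 - 1 + b = k by lia.
have h4 : a - 1 + (b - 1) = k by lia.
have h5 : a + (b - 1 - 1) = k by lia.
rewrite (tensC_dif_pure e e0 ea eb h1 h2) tensC_difD (add_map_ksgn _ (tensC_difD e')).
rewrite (tensC_dif_pure e' h1 ea' eb h3 h4) (tensC_dif_pure e' h2 ea eb' h4 h5).
have [_ ->] := cT m; have [_ ->] := hom_complex CE m n.
rewrite (add_map0 (tpureDl _ _)) (add_map0 (tpureDr _ _)) (add_map0 (@ksgnD _ _)) addr0 add0r.
by rewrite (@ksgnN _ (a - 1) a) ?addNr //; lia.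
Qed.

(** For [T := bar_tens Phi q] this is [bar_last] up to conversion; the laws are proved once for an
    arbitrary family of complexes. *)
Definition tens_act m n (i j k : int) (e : i + j = k) (b : tensC E T m i) (f : mor E m n j) :
    tensC E T n k :=
  tlift (fun l a c (e' : a + c = i) (x : T l a) (g : mor E l m c) =>
    tpure (etrans (addrA a c j) (etrans (congr1 (fun z => z + j) e') e))
      x (comp erefl g f) : tensC E T n k) b.

Definition tens_fun : fun_data E := FunData tens_act.

Lemma tens_act_biadditive m n (i j k : int) (e : i + j = k) (f : mor E m n j) :
  biadditive (fun l a c (e' : a + c = i) (x : T l a) (g : mor E l m c) =>
    tpure (etrans (addrA a c j) (etrans (congr1 (fun z => z + j) e') e))
      x (comp erefl g f) : tensC E T n k).
Proof.
split=> l a c e' => [g x y|x g h]; first by rewrite tpureDl.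
by rewrite (comp_addl CE) tpureDr.
Qed.

Lemma tens_act_addl m n (i j k : int) (e : i + j = k) (f : mor E m n j) :
  add_map (fun b => tens_act e b f).
Proof. exact: (tliftD (tens_act_biadditive e f)). Qed.

Lemma tens_act_pure l m n (i j k a c d : int) (e : i + j = k) (e' : a + c = i)
    (h : c + j = d) (h' : a + d = k) (x : T l a) (g : mor E l m c) (f : mor E m n j) :
  tens_act e (tpure e' x g : tensC E T m i) f = tpure h' x (comp h g f).
Proof.
rewrite [LHS](tlift_pure _ _ _ (tens_act_biadditive e f)).
by case: d / h h' => h'; rewrite (tpure_irr _ h').
Qed.

Lemma tens_act_addr m n (i j k : int) (e : i + j = k) b :
  add_map (fun f : mor E m n j => tens_act e b f).
Proof.
move=> f g; move: b; apply: tens_ext => [||l a c e' x h].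
- exact: tens_act_addl.
- by apply: add_map_add; exact: tens_act_addl.
have h' : a + (c + j) = k by rewrite addrA e'.
by rewrite !(tens_act_pure e e' erefl h') (comp_addr CE) tpureDr.
Qed.

Lemma tens_is_dgfun : is_dgfun tens_fun.
Proof.
split.
- exact: tensC_complex.
- exact: tens_act_addl.
- exact: tens_act_addr.
- move=> m n i j k i' j' k' e ei ej ek e1 e2 x f; move: x; apply: tens_ext.
  + exact: (add_map_comp (tensC_difD ek) (tens_act_addl e f)).
  + apply: add_map_add; first exact: (add_map_comp (tens_act_addl e1 f) (tensC_difD ei)).
    exact: (add_map_comp (@ksgnD _ _) (tens_act_addl e2 (dif ej f))).
  move=> l a c e' x g.
  have ea := subr1K a; have ec := subr1K c.
  have ecj : c + j = (c - 1 + j) + 1 by lia.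
  have h1 : a - 1 + c = i' by lia.
  have h2 : a + (c - 1) = i' by lia.
  have h3 : a + (c + j) = k by lia.
  have h4 : a - 1 + (c + j) = k' by lia.
  have h5 : a + (c - 1 + j) = k' by lia.
  have h6 : c + j' = c - 1 + j by lia.
  rewrite [act _ _ _](tens_act_pure e e' erefl h3) (tensC_dif_pure ek h3 ea ecj h4 h5).
  rewrite (tensC_dif_pure ei e' ea ec h1 h2) [act e1 _ _]tens_act_addl.
  rewrite (add_map_ksgn _ (tens_act_addl e1 f)).
  rewrite (tens_act_pure e1 h1 erefl h4) (tens_act_pure e1 h2 erefl h5).
  rewrite [act e2 _ _](tens_act_pure e2 e' h6 h5).
  rewrite (comp_dif CE erefl ec ej ecj erefl h6) tpureDr ksgnD addrA; congr (_ + _).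
  rewrite (add_map_ksgn _ (tpureDr _ _)) ksgn_ksgn; congr ksgn; exact: e'.
- move=> m i e x; move: x; apply: tens_ext => [||l a c e' x g]; [exact: tens_act_addl | by []|].
  have h : c + 0 = c by rewrite addr0.
  by rewrite [LHS](tens_act_pure e e' h e') (comp_idr CE).
- move=> m n p i j k ij jk t e1 e2 e3 e4 x f g; move: x; apply: tens_ext.
  + exact: (add_map_comp (tens_act_addl e2 g) (tens_act_addl e1 f)).
  + exact: tens_act_addl.
  move=> l a c e' x h.
  have h1 : a + (c + j) = ij by lia.
  have h2 : a + (c + j + k) = t by lia.
  have h3 : c + jk = c + j + k by lia.
  rewrite [act e1 _ _](tens_act_pure e1 e' erefl h1) [LHS](tens_act_pure e2 h1 erefl h2).
  rewrite [RHS](tens_act_pure e4 e' h3 h2).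
  by rewrite (comp_assoc CE _ _ e3 h3).
Qed.
End TensFunctor.

(** * The simplicial boundary *)

Section BarFunctor.
Variables (E : dgcat_data) (Phi : fun_data E).
Hypotheses (CE : is_dgcat E) (hP : is_dgfun Phi).

Definition bar_tens_act q m n (i j k : int) (e : i + j = k) (b : bar_tens Phi q m i)
    (f : mor E m n j) : bar_tens Phi q n k :=
  match q return bar_tens Phi q m i -> bar_tens Phi q n k with
  | 0 => fun b => act e b f
  | q'.+1 => fun b => bar_last e b f
  end b.

Lemma bar_act_dgfun q : is_dgfun (FunData (@bar_tens_act q)).
Proof.
elim: q => [|q IH]; first by case: hP => *; split.
by apply: (tens_is_dgfun CE) => m; exact: (fob_complex IH m).
Qed.

Lemma bar_tens_complex q m : is_complex (bar_tens Phi q m).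
Proof. exact: (fob_complex (bar_act_dgfun q) m). Qed.

Lemma bar_tens_difD q m (i j : int) (e : i = j + 1) :
  add_map (@dif (bar_tens Phi q m) i j e).
Proof. by have [] := bar_tens_complex q m. Qed.

Lemma bar_tens_act_addl q m n (i j k : int) (e : i + j = k) (f : mor E m n j) :
  add_map (fun b : bar_tens Phi q m i => bar_tens_act e b f).
Proof. exact: (act_addl (bar_act_dgfun q)). Qed.

Lemma bar_tens_act_addr q m n (i j k : int) (e : i + j = k) (b : bar_tens Phi q m i) :
  add_map (fun f : mor E m n j => bar_tens_act e b f).
Proof. exact: (act_addr (bar_act_dgfun q)). Qed.

(* For q = 0 this is the action B_0 -> Phi, which is not part of the             *)
(* differential of the bar construction but computes its augmentation.           *)
Definition bar_bnd q n (i k : int) (e : i = k) (b : bar_tens Phi q.+1 n i) :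
    bar_tens Phi q n k :=
  \sum_(r < q.+1) ksgn r%:Z (bar_face r e b).

Lemma bar_act_pair_biadditive q n (i k : int) (e : i = k) :
  biadditive (fun m a c (e' : a + c = i) (b : bar_tens Phi q m a) (f : mor E m n c) =>
    bar_tens_act (etrans e' e) b f).
Proof.
by split=> m a c e'; [move=> f; exact: bar_tens_act_addl | move=> b; exact: bar_tens_act_addr].
Qed.

Lemma bar_face_top q n m (i k a c : int) (e : i = k) (e' : a + c = i)
    (b : bar_tens Phi q m a) (f : mor E m n c) :
  bar_face q e (tpure e' b f : bar_tens Phi q.+1 n i) = bar_tens_act (etrans e' e) b f.
Proof.
case: q b => [|q] b; rewrite /= ?eqxx.
  exact: (tlift_pure _ _ _ (bar_act_pair_biadditive 0 n e)).
exact: (tlift_pure _ _ _ (bar_act_pair_biadditive q.+1 n e)).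
Qed.

Lemma bar_face_pair_biadditive q r n (i k : int) (e : i = k) :
  (forall m (a : int), add_map (@bar_face E Phi q r m a a erefl)) ->
  biadditive (fun m a c (e' : a + c = i) (b : bar_tens Phi q.+1 m a) (f : mor E m n c) =>
    tpure (etrans e' e) (bar_face r (erefl a) b) f : bar_tens Phi q.+1 n k).
Proof.
move=> fD; split=> m a c e'; last by move=> b; exact: tpureDr.
by move=> f x y; rewrite fD tpureDl.
Qed.

Lemma bar_faceD q r n (i k : int) (e : i = k) : (r <= q)%N ->
  add_map (@bar_face E Phi q r n i k e).
Proof.
elim: q r n i k e => [|q IH] r n i k e.
  by rewrite leqn0 => _; exact: (tliftD (bar_act_pair_biadditive 0 n e)).
rewrite /=; case: eqVneq => h rq.
  exact: (tliftD (bar_act_pair_biadditive q.+1 n e)).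
apply: tliftD; apply: bar_face_pair_biadditive => m a; apply: IH.
by rewrite -ltnS ltn_neqAle h.
Qed.

Lemma bar_face_pure q r n m (i k a c : int) (e : i = k) (e' : a + c = i)
    (b : bar_tens Phi q.+1 m a) (f : mor E m n c) : (r <= q)%N ->
  bar_face r e (tpure e' b f : bar_tens Phi q.+2 n i) =
  tpure (etrans e' e) (bar_face r erefl b) f.
Proof.
move=> rq; rewrite /= ifF; last by apply: ltn_eqF; rewrite ltnS.
rewrite [LHS](tlift_pure _ _ _ (bar_face_pair_biadditive n e _)) // => l d.
exact: bar_faceD.
Qed.

Lemma bar_bndD q n (i k : int) (e : i = k) : add_map (@bar_bnd q n i k e).
Proof.
move=> x y; rewrite /bar_bnd -big_split; apply: eq_bigr => r _ /=.
by rewrite bar_faceD ?ksgnD // -ltnS ltn_ord.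
Qed.

Lemma bar_bnd0_pure n m (i k a c : int) (e : i = k) (e' : a + c = i) (h : a + c = k)
    (b : bar_tens Phi 0 m a) (f : mor E m n c) :
  bar_bnd e (tpure e' b f : bar_tens Phi 1 n i) = bar_tens_act h b f.
Proof.
rewrite /bar_bnd big_ord1 ksgn0 (bar_face_top e e' b f).
by rewrite (eq_irrelevance (etrans e' e) h).
Qed.

(** A recursion on the number of tensor factors: every face but the last acts on [b] alone, and the
    last one lets [f] act on [b]. It takes the place of the simplicial identities. *)
Lemma bar_bnd_pure q n m (i k a c : int) (e : i = k) (e' : a + c = i) (h : a + c = k)
    (b : bar_tens Phi q.+1 m a) (f : mor E m n c) :
  bar_bnd e (tpure e' b f : bar_tens Phi q.+2 n i) =
  (tpure h (bar_bnd erefl b) f : bar_tens Phi q.+1 n k) +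
  ksgn q.+1%:Z (bar_tens_act h b f).
Proof.
rewrite {1}/bar_bnd big_ord_recr (bar_face_top e e' b f).
rewrite (eq_irrelevance (etrans e' e) h); congr (_ + _).
rewrite /bar_bnd (add_map_sum _ _ _ (tpureDl h f)); apply: eq_bigr => r _.
rewrite (add_map_ksgn _ (tpureDl h f)); congr ksgn.
rewrite (@bar_face_pure q r n m i k a c e e' b f) ?(tpure_irr _ h) //.
by rewrite -ltnS ltn_ord.
Qed.

Lemma bar_bnd_act q m n (i i' j k k' : int) (ei : i = i') (ek : k = k') (e : i + j = k)
    (e' : i' + j = k') (b : bar_tens Phi q.+1 m i) (f : mor E m n j) :
  bar_bnd ek (bar_last e b f) = bar_tens_act e' (bar_bnd ei b) f.
Proof.
move: b; apply: tens_ext => [||l a c e0 x g].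
- exact: (add_map_comp (@bar_bndD q n k k' ek) (@bar_tens_act_addl q.+1 m n i j k e f)).
- exact: (add_map_comp (@bar_tens_act_addl q m n i' j k' e' f) (@bar_bndD q m i i' ei)).
have h1 : a + (c + j) = k by rewrite addrA e0.
have h2 : a + (c + j) = k' by rewrite h1.
have h3 : a + c = i' by rewrite e0.
rewrite [bar_last _ _ _](tens_act_pure CE e e0 erefl h1).
case: q x => [|q] x.
  rewrite (bar_bnd0_pure ek h1 h2) (bar_bnd0_pure ei e0 h3).
  by rewrite [RHS](act_comp (bar_act_dgfun 0) h3 e' erefl h2).
rewrite (bar_bnd_pure ek h1 h2) (bar_bnd_pure ei e0 h3) (bar_tens_act_addl e').
rewrite [@bar_tens_act q.+1 _ _ _ _ _ e' (tpure _ _ _) f](tens_act_pure CE e' h3 erefl h2).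
congr (_ + _); rewrite (add_map_ksgn _ (@bar_tens_act_addl q.+1 _ _ _ _ _ e' f)); congr ksgn.
by rewrite [RHS](act_comp (bar_act_dgfun q.+1) h3 e' erefl h2).
Qed.

Lemma bar_bnd_dif q n (i i' k k' : int) (e : i = k) (e' : i' = k') (d : i = i' + 1)
    (d' : k = k' + 1) (b : bar_tens Phi q.+1 n i) :
  bar_bnd e' (dif d b) = dif d' (bar_bnd e b).
Proof.
elim: q n i i' k k' e e' d d' b => [|q IH] n i i' k k' e e' d d'; apply: tens_ext.
- exact: (add_map_comp (@bar_bndD 0 n i' k' e') (@bar_tens_difD 0.+1 n i i' d)).
- exact: (add_map_comp (@bar_tens_difD 0 n k k' d') (@bar_bndD 0 n i k e)).
- move=> m a c e0 x f.
  have ea := subr1K a; have ec := subr1K c.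
  have h1 : a - 1 + c = i' by lia.
  have h2 : a + (c - 1) = i' by lia.
  have h3 : a + c = k by lia.
  have h4 : a - 1 + c = k' by lia.
  have h5 : a + (c - 1) = k' by lia.
  rewrite (tensC_dif_pure CE (bar_tens_complex 0) d e0 ea ec h1 h2) bar_bndD.
  rewrite (add_map_ksgn _ (@bar_bndD 0 _ _ _ e')).
  rewrite (bar_bnd0_pure e' h1 h4) (bar_bnd0_pure e' h2 h5) (bar_bnd0_pure e e0 h3).
  by rewrite [RHS](act_dif hP h3 ea ec d' h4 h5).
- exact: (add_map_comp (@bar_bndD q.+1 n i' k' e') (@bar_tens_difD q.+1.+1 n i i' d)).
- exact: (add_map_comp (@bar_tens_difD q.+1 n k k' d') (@bar_bndD q.+1 n i k e)).
move=> m a c e0 x f.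
have ea := subr1K a; have ec := subr1K c.
have h1 : a - 1 + c = i' by lia.
have h2 : a + (c - 1) = i' by lia.
have h3 : a + c = k by lia.
have h4 : a - 1 + c = k' by lia.
have h5 : a + (c - 1) = k' by lia.
rewrite (tensC_dif_pure CE (bar_tens_complex q.+1) d e0 ea ec h1 h2) bar_bndD.
rewrite (add_map_ksgn _ (@bar_bndD q.+1 _ _ _ e')).
rewrite (bar_bnd_pure e' h1 h4) (bar_bnd_pure e' h2 h5) (bar_bnd_pure e e0 h3).
rewrite bar_tens_difD (tensC_dif_pure CE (bar_tens_complex q) d' h3 ea ec h4 h5).
rewrite (add_map_ksgn _ (@bar_tens_difD q.+1 _ _ _ d')).
rewrite [dif d' (bar_tens_act _ _ _)](act_dif (bar_act_dgfun q.+1) h3 ea ec d' h4 h5).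
rewrite -(IH _ _ _ _ _ erefl erefl ea ea) !ksgnD addrACA; congr (_ + _).
by congr (_ + _); rewrite !ksgn_ksgn addrC.
Qed.

(** By the recursion, the boundary of b (x) f is applied twice; the induction hypothesis removes one
    term, and the two terms in which [f] acts cancel since the boundary commutes with that action.
    The case q = 0 says that the augmentation kills boundaries from B_1. *)
Lemma bar_bnd_sq q n (i k l : int) (e : i = k) (e' : k = l) (b : bar_tens Phi q.+2 n i) :
  bar_bnd e' (bar_bnd e b) = 0.
Proof.
elim: q n i k l e e' b => [|q IH] n i k l e e'; apply: tens_ext.
- exact: (add_map_comp (@bar_bndD 0 n k l e') (@bar_bndD 0.+1 n i k e)).
- exact: add_map_zero.
- move=> m a c e0 x f.
  have h1 : a + c = k by lia.
  have h2 : a + c = l by lia.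
  rewrite (bar_bnd_pure e e0 h1) bar_bndD (bar_bnd0_pure e' h1 h2).
  rewrite (add_map_ksgn _ (@bar_bndD 0 _ _ _ e')) (bar_bnd_act erefl e' h1 h2).
  by rewrite (@ksgnN _ 1 0) // addrN.
- exact: (add_map_comp (@bar_bndD q.+1 n k l e') (@bar_bndD q.+1.+1 n i k e)).
- exact: add_map_zero.
move=> m a c e0 x f.
have h1 : a + c = k by lia.
have h2 : a + c = l by lia.
rewrite (bar_bnd_pure e e0 h1) bar_bndD (bar_bnd_pure e' h1 h2) IH.
rewrite (add_map_ksgn _ (@bar_bndD q.+1 _ _ _ e')) (bar_bnd_act erefl e' h1 h2).
rewrite (add_map0 (tpureDl _ _)) add0r (@ksgnN _ q.+2%:Z q.+1%:Z) ?addrN //.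
by lia.
Qed.
End BarFunctor.

(** * The bar construction as a functor, and its contraction *)

Section BarComplex.
Variables (E : dgcat_data) (Phi : fun_data E).
Hypotheses (CE : is_dgcat E) (hP : is_dgfun Phi).

Definition bar_lower m (t s : int) (e : t = s + 1) (p : nat) :
    bar_tens Phi p.+1 m (t - p%:Z) -> bar Phi m s :=
  match p with
  | 0 => fun=> 0
  | p'.+1 => fun b => dinj p' (bar_bnd (deg_shift_face p' e) b)
  end.

Lemma bar_facesE m (t s : int) (e : t = s + 1) p (b : bar_tens Phi p.+1 m (t - p%:Z)) :
  bar_faces e b = bar_lower e b.
Proof.
case: p b => [|p] b //=.
by rewrite /bar_bnd (add_map_sum _ _ _ (@dinjD (fun p => bar_tens Phi p.+1 m (s - p%:Z)) p)).
Qed.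

Lemma bar_lowerD m (t s : int) (e : t = s + 1) p : add_map (@bar_lower m t s e p).
Proof.
case: p => [|p] x y /=; first by rewrite addr0.
by rewrite (bar_bndD CE hP) dinjD.
Qed.

Definition bar_dif_comp m (t s : int) (e : t = s + 1) p
    (b : bar_tens Phi p.+1 m (t - p%:Z)) : bar Phi m s :=
  dinj p (ksgn p%:Z (dif (deg_shift_dif p e) b)) + bar_faces e b.

Lemma bar_dif_compD m (t s : int) (e : t = s + 1) p : add_map (@bar_dif_comp m t s e p).
Proof.
move=> x y; rewrite /bar_dif_comp !bar_facesE bar_lowerD (bar_tens_difD CE hP) ksgnD dinjD.
by rewrite addrACA.
Qed.

Lemma bar_difD m (t s : int) (e : t = s + 1) : add_map (@dif (bar Phi m) t s e).
Proof. exact: (dliftD (bar_dif_compD e)). Qed.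

Lemma bar_dif_inj m (t s : int) (e : t = s + 1) p (b : bar_tens Phi p.+1 m (t - p%:Z)) :
  dif e (dinj p b : bar Phi m t) =
  dinj p (ksgn p%:Z (dif (deg_shift_dif p e) b)) + bar_lower e b.
Proof.
rewrite -bar_facesE; apply: (@dlift_inj _ _ (@bar_dif_comp m t s e)) => k.
exact: (add_map0 (@bar_dif_compD m t s e k)).
Qed.

Lemma bar_is_complex m : is_complex (bar Phi m).
Proof.
split=> [|i j k e e']; first exact: bar_difD.
apply: dsum_ext => [||p b].
- exact: (add_map_comp (@bar_difD m j k e') (@bar_difD m i j e)).
- exact: add_map_zero.
rewrite bar_dif_inj bar_difD bar_dif_inj (add_map_ksgn _ (bar_tens_difD CE hP _)).
have [_ ->] := bar_tens_complex CE hP p.+1 m.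
rewrite (add_map0 (@ksgnD _ _)) (add_map0 (@ksgnD _ _)) (add_map0 (@dinjD _ _)) add0r.
case: p b => [|p] b; rewrite [bar_lower e b]/=.
  by rewrite add0r (add_map0 (@bar_difD m j k e')).
rewrite [bar_lower e' (ksgn _ _)]/= bar_dif_inj.
rewrite (add_map_ksgn _ (@bar_bndD _ _ CE hP p.+1 _ _ _ _)).
rewrite (bar_bnd_dif CE hP (deg_shift_face p e) (deg_shift_face p e') (deg_shift_dif p.+1 e)
  (deg_shift_dif p e')).
rewrite addrA -dinjD (@ksgnN _ p.+1%:Z p%:Z) ?addNr; last by lia.
rewrite (add_map0 (@dinjD _ _)) add0r.
by case: p b => [|p] b //=; rewrite (bar_bnd_sq CE hP) (add_map0 (@dinjD _ _)).
Qed.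

Lemma bar_act_compD m n (i j k : int) (e : i + j = k) (f : mor E m n j) p :
  add_map (fun c : bar_tens Phi p.+1 m (i - p%:Z) =>
    dinj p (bar_last (deg_shift_act p e) c f) : bar Phi n k).
Proof.
move=> x y; rewrite -dinjD; congr dinj.
exact: (@bar_tens_act_addl _ _ CE hP p.+1).
Qed.

Lemma bar_act_addl m n (i j k : int) (e : i + j = k) (f : mor E m n j) :
  add_map (fun b : bar Phi m i => act e b f).
Proof. exact: (dliftD (bar_act_compD e f)). Qed.

Lemma bar_act_inj m n (i j k : int) (e : i + j = k) (f : mor E m n j) p
    (c : bar_tens Phi p.+1 m (i - p%:Z)) :
  act e (dinj p c : bar Phi m i) f = dinj p (bar_last (deg_shift_act p e) c f).
Proof.
apply: (@dlift_inj _ _ (fun p (c : bar_tens Phi p.+1 m (i - p%:Z)) =>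
  dinj p (bar_last (deg_shift_act p e) c f) : bar Phi n k)) => l.
exact: (add_map0 (@bar_act_compD m n i j k e f l)).
Qed.

Let actT q : is_dgfun (FunData (@bar_tens_act E Phi q)) := bar_act_dgfun CE hP q.

Lemma bar_is_dgfun : is_dgfun (bar Phi).
Proof.
split.
- exact: bar_is_complex.
- exact: bar_act_addl.
- move=> m n i j k e x f g; move: x; apply: dsum_ext => [||p b].
  + exact: bar_act_addl.
  + by apply: add_map_add; exact: bar_act_addl.
  rewrite !bar_act_inj -dinjD; congr dinj.
  exact: (act_addr (actT p.+1)).
- move=> m n i j k i' j' k' e ei ej ek e1 e2 x f; move: x; apply: dsum_ext => [||p b].
  + exact: (add_map_comp (@bar_difD n k k' ek) (bar_act_addl e f)).
  + apply: add_map_add; first exact: (add_map_comp (bar_act_addl e1 f) (@bar_difD m i i' ei)).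
    exact: (add_map_comp (@ksgnD _ _) (bar_act_addl e2 (dif ej f))).
  rewrite !bar_act_inj !bar_dif_inj bar_act_addl bar_act_inj.
  rewrite -(add_map_ksgn _ (@dinjD _ _)) addrAC -dinjD; congr (dinj _ _ + _).
    have := act_dif (actT p.+1) (deg_shift_act p e) (deg_shift_dif p ei) ej (deg_shift_dif p ek)
      (deg_shift_act p e1) (deg_shift_act p e2) b f.
    move=> /= ->; rewrite ksgnD ksgn_ksgn; congr (_ + _); last by apply: ksgn_eq; lia.
    by rewrite -(add_map_ksgn _
      (@bar_tens_act_addl _ _ CE hP p.+1 _ _ _ _ _ (deg_shift_act p e1) f)).
  case: p b => [|p] b; rewrite ![bar_lower _ _]/=; first by rewrite (add_map0 (bar_act_addl e1 f)).
  rewrite bar_act_inj; congr dinj.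
  exact: (bar_bnd_act CE hP).
- move=> m i e x; move: x; apply: dsum_ext => [||p b]; [exact: bar_act_addl | by []|].
  rewrite bar_act_inj; congr dinj.
  exact: (act_id (actT p.+1)).
- move=> m n p i j k ij jk t e1 e2 e3 e4 x f g; move: x; apply: dsum_ext => [||q b].
  + exact: (add_map_comp (bar_act_addl e2 g) (bar_act_addl e1 f)).
  + exact: bar_act_addl.
  rewrite !bar_act_inj; congr dinj.
  exact: (act_comp (actT q.+1)).
Qed.

Definition bar_aug_comp m t p : bar_tens Phi p.+1 m (t - p%:Z) -> Phi m t :=
  match p return bar_tens Phi p.+1 m (t - p%:Z) -> Phi m t with
  | 0 => bar_bnd (deg_shift_0 t)
  | _.+1 => fun=> 0
  end.

Lemma bar_augE m t (b : bar Phi m t) : bar_aug b = dlift (@bar_aug_comp m t) b.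
Proof.
rewrite /bar_aug /dlift; apply: eq_bigr => -[[|p] lp] _ //=.
by rewrite /bar_bnd big_ord1.
Qed.

Lemma bar_aug_compD m t p : add_map (@bar_aug_comp m t p).
Proof.
case: p => [|p] x y /=; last by rewrite addr0.
exact: (@bar_bndD _ _ CE hP 0).
Qed.

Lemma bar_augD m t : add_map (@bar_aug E Phi m t).
Proof. by move=> x y; rewrite !bar_augE (dliftD (@bar_aug_compD m t)). Qed.

Lemma bar_aug_inj m t p (b : bar_tens Phi p.+1 m (t - p%:Z)) :
  bar_aug (dinj p b : bar Phi m t) = bar_aug_comp b.
Proof.
rewrite bar_augE dlift_inj // => k; exact: (add_map0 (@bar_aug_compD m t k)).
Qed.

Lemma bar_aug_natural : natural_transf (@bar_aug E Phi).
Proof.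
split=> [m|m n i j k e x f].
  split=> [i|i j e x]; first exact: bar_augD.
  have PD l a b (d : a = b + 1) : add_map (@dif (Phi l) a b d) by have [] := fob_complex hP l.
  move: x; apply: dsum_ext => [||p b].
  - exact: (add_map_comp (@bar_augD m j) (@bar_difD m i j e)).
  - exact: (add_map_comp (PD m i j e) (@bar_augD m i)).
  rewrite bar_dif_inj bar_augD !bar_aug_inj.
  case: p b => [|[|p]] b; rewrite [bar_lower _ _]/= ![bar_aug_comp _]/=.
  - rewrite (add_map0 (@bar_augD _ _)) addr0 ksgn0.
    exact: (@bar_bnd_dif _ _ CE hP 0).
  - rewrite add0r bar_aug_inj (add_map0 (PD _ _ _ _)).
    exact: (@bar_bnd_sq _ _ CE hP 0).
  - by rewrite add0r bar_aug_inj (add_map0 (PD _ _ _ _)).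
move: x; apply: dsum_ext => [||p b].
- exact: (add_map_comp (@bar_augD n k) (bar_act_addl e f)).
- exact: (add_map_comp (act_addl hP e f) (@bar_augD m i)).
rewrite bar_act_inj !bar_aug_inj; case: p b => [|p] b; rewrite ![bar_aug_comp _]/=.
  exact: (@bar_bnd_act _ _ CE hP 0).
by rewrite (add_map0 (act_addl hP e f)).
Qed.

Fact deg_unit (i : int) : i + 0 = i - 0%:Z.
Proof. lia. Qed.

Fact deg_htp (i j : int) p : j = i + 1 -> (i - p%:Z) + 0 = j - p.+1%:Z.
Proof. by move=> ->; lia. Qed.

Lemma tpure_bnd q m n (i k c l : int) (e : i = k) (h : i + c = l) (h' : k + c = l)
    (b : bar_tens Phi q.+1 m i) (f : mor E m n c) :
  tpure h (bar_bnd erefl b) f = tpure h' (bar_bnd e b) f :> tens E (bar_tens Phi q) n l.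
Proof. by case: k / e h' => h'; rewrite (tpure_irr h h'). Qed.

(** The sign of p + 1 is that of the last face in [bar_bnd_pure], so that the last face of the
    homotopy applied to [b] is [b] itself. *)
Definition bar_contraction : contraction Phi (bar Phi) :=
  @Contraction E Phi (bar Phi)
    (fun m t x => dinj 0 (tpure (deg_unit t) x (idm m) : bar_tens Phi 1 m (t - 0%:Z)))
    (fun m i j e => dlift (fun p (b : bar_tens Phi p.+1 m (i - p%:Z)) =>
      dinj p.+1 (ksgn p.+1%:Z (tpure (deg_htp p e) b (idm m)
        : bar_tens Phi p.+2 m (j - p.+1%:Z))) : bar Phi m j)).

Lemma bar_htp_compD m (i j : int) (e : j = i + 1) p :
  add_map (fun b : bar_tens Phi p.+1 m (i - p%:Z) =>
      dinj p.+1 (ksgn p.+1%:Z (tpure (deg_htp p e) b (idm m)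
        : bar_tens Phi p.+2 m (j - p.+1%:Z))) : bar Phi m j).
Proof. by move=> x y; rewrite tpureDl ksgnD dinjD. Qed.

Lemma bar_htpD m (i j : int) (e : j = i + 1) :
  add_map (@chtp _ _ _ bar_contraction m i j e).
Proof. exact: (dliftD (@bar_htp_compD m i j e)). Qed.

Lemma bar_htp_inj m (i j : int) (e : j = i + 1) p (b : bar_tens Phi p.+1 m (i - p%:Z)) :
  chtp bar_contraction e (dinj p b : bar Phi m i) =
  dinj p.+1 (ksgn p.+1%:Z (tpure (deg_htp p e) b (idm m) : bar_tens Phi p.+2 m (j - p.+1%:Z))).
Proof.
apply: (@dlift_inj _ _ (fun p (b : bar_tens Phi p.+1 m (i - p%:Z)) =>
      dinj p.+1 (ksgn p.+1%:Z (tpure (deg_htp p e) b (idm m)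
        : bar_tens Phi p.+2 m (j - p.+1%:Z))) : bar Phi m j)) => k.
exact: (add_map0 (@bar_htp_compD m i j e k)).
Qed.

Lemma tens_dif_id (T : nat -> gcx) (cT : forall m, is_complex (T m)) m (t s i i' : int)
    (e : t = s + 1) (e' : i + 0 = t) (ei : i = i' + 1) (e1 : i' + 0 = s) (x : T m i) :
  dif e (tpure e' x (idm m) : tensC E T m t) = tpure e1 (dif ei x) (idm m).
Proof.
have e2 : i + -1 = s by lia.
have e0 : 0 = -1 + 1 :> int by [].
rewrite (tensC_dif_pure CE cT e e' ei e0 e1 e2) (idm_cycle CE).
by rewrite (add_map0 (tpureDr _ _)) (add_map0 (@ksgnD _ _)) addr0.
Qed.

(** In dh + hd the internal differentials cancel and the last face of h b gives b. For p > 0 the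
    other faces of h b cancel with h applied to the faces of b; for p = 0 they leave minus the
    augmentation of b tensored with the identity. *)
Lemma bar_is_contraction : is_contraction (@bar_aug E Phi) bar_contraction.
Proof.
split.
- move=> m; split=> [i x y|i j e x]; first by rewrite /= tpureDl dinjD.
  rewrite [LHS]/=; apply/esym/(etrans (bar_dif_inj _ _)); rewrite [bar_lower _ _]/=.
  rewrite addr0 ksgn0; congr dinj.
  by rewrite (tens_dif_id (fob_complex hP) _ _ e (deg_unit j)).
- exact: bar_htpD.
- move=> m i x; rewrite bar_aug_inj /=.
  have h : i + 0 = i by rewrite addr0.
  by rewrite (bar_bnd0_pure CE hP _ _ h) /= (act_id hP).
- move=> m i j e x; move: x; apply: dsum_ext => [||p b].
  + exact: (add_map_comp (@bar_augD m j) (@bar_htpD m i j e)).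
  + exact: add_map_zero.
  by rewrite bar_htp_inj bar_aug_inj.
move=> m i j k e e' x; move: x; apply: dsum_ext => [||p b].
- apply: add_map_add; first exact: (add_map_comp (@bar_difD m j i e) (@bar_htpD m i j e)).
  exact: (add_map_comp (@bar_htpD m k i e') (@bar_difD m i k e')).
- apply: (@add_map_add _ _ id) => //; apply: add_map_opp => x y.
  by rewrite bar_augD /= tpureDl dinjD.
rewrite bar_htp_inj !bar_dif_inj bar_htpD bar_htp_inj bar_aug_inj.
have cT := bar_tens_complex CE hP p.+1.
rewrite (add_map_ksgn _ (bar_tens_difD CE hP _)).
rewrite (tens_dif_id cT _ _ (deg_shift_dif p e') (deg_htp p e')).
rewrite (add_map_ksgn _ (tpureDl _ _)) !ksgn_ksgn.
rewrite [bar_lower _ _]/= (add_map_ksgn _ (@bar_bndD _ _ CE hP p.+1 _ _ _ _)).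
have h : i - p%:Z + 0 = i - p%:Z by rewrite addr0.
rewrite (bar_bnd_pure CE hP _ _ h) ksgnD ksgn_ksgn.
have -> : bar_tens_act h b (idm m) = b by exact: (act_id (actT p.+1)).
have s0 : odd (absz (p.+1%:Z + p.+1%:Z - 0)%R) = false by lia.
have s1 : odd (absz (p.+1%:Z + p%:Z - 0)%R) by lia.
rewrite (ksgn_eq b s0) (ksgn_eq _ s0) (ksgnN _ s1) !ksgn0 addrACA.
rewrite -(add_mapN (@dinjD _ _)) -dinjD subrr (add_map0 (@dinjD _ _)) add0r dinjD.
rewrite addrAC addrC; congr (_ + _).
case: p b cT h s0 s1 => [|p] b cT h s0 s1; rewrite [bar_lower _ _]/= [bar_aug_comp _]/=.
  rewrite (add_map0 (@bar_htpD m k i e')) addr0 (@ksgnN _ 1 0) //.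
  congr (dinj _ (- _)).
  exact: (@tpure_bnd 0 m m _ _ 0 _ (deg_shift_0 i) h (deg_unit i) b (idm m)).
rewrite bar_htp_inj -dinjD (tpure_bnd (deg_shift_face p e') h (deg_htp p e')).
rewrite (@ksgnN _ p.+2%:Z p.+1%:Z) ?addNr ?(add_map0 (@dinjD _ _)); last by lia.
by rewrite (add_map0 (tpureDl _ _)) oppr0 (add_map0 (@dinjD _ _)).
Qed.
End BarComplex.

(** * Naturality of the bar contraction *)

Section BarNatural.
Variables (E E' : dgcat_data) (Phi : fun_data E) (Phi' : fun_data E').
Hypotheses (CE : is_dgcat E) (hP : is_dgfun Phi) (CE' : is_dgcat E') (hP' : is_dgfun Phi').
Variables (j : cmap E E') (th : fmap Phi Phi').
Hypotheses (hj : is_dgfunctor j) (thC : forall m, chain_map (@th m)).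
Hypothesis thA : forall m n (a b c : int) (e : a + b = c) (x : Phi m a) (f : mor E m n b),
  th (act e x f) = act e (th x) (@j m n b f).

Let jD m n i : add_map (@j m n i).
Proof. by have [] := cmap_chain hj m n. Qed.

Let jd m n (a b : int) (e : a = b + 1) (f : mor E m n a) : j (dif e f) = dif e (j f).
Proof. by have [_ ->] := cmap_chain hj m n. Qed.

Lemma bar_tens_map_biadditive q n k : (forall m a, add_map (@bar_tens_map _ _ _ _ j th q m a)) ->
  biadditive (fun m a c (e : a + c = k) (x : bar_tens Phi q m a) (f : mor E m n c) =>
    tpure e (@bar_tens_map _ _ _ _ j th q m a x) (j f) : bar_tens Phi' q.+1 n k).
Proof.
move=> mD; split=> m a c e; first by move=> f x y; rewrite mD tpureDl.
by move=> x f g; rewrite jD tpureDr.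
Qed.

Lemma bar_tens_mapD q n k : add_map (@bar_tens_map _ _ _ _ j th q n k).
Proof.
elim: q n k => [|q IH] n k; first by have [] := thC n.
exact: (tliftD (bar_tens_map_biadditive n k IH)).
Qed.

Lemma bar_tens_map_pure q n m (k a c : int) (e : a + c = k) (x : bar_tens Phi q m a)
    (f : mor E m n c) :
  @bar_tens_map _ _ _ _ j th q.+1 n k (tpure e x f) =
  tpure e (@bar_tens_map _ _ _ _ j th q m a x) (j f).
Proof.
exact: (tlift_pure _ _ _ (bar_tens_map_biadditive n k (@bar_tens_mapD q))).
Qed.

Lemma bar_tens_map_dif q n (k l : int) (e : k = l + 1) (x : bar_tens Phi q n k) :
  @bar_tens_map _ _ _ _ j th q n l (dif e x) = dif e (@bar_tens_map _ _ _ _ j th q n k x).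
Proof.
elim: q n k l e x => [|q IH] n k l e; first by have [_] := thC n; exact.
apply: tens_ext => [||m a c e0 x f].
- exact: (add_map_comp (@bar_tens_mapD q.+1 n l) (@bar_tens_difD _ _ CE hP q.+1 n k l e)).
- exact: (add_map_comp (@bar_tens_difD _ _ CE' hP' q.+1 n k l e) (@bar_tens_mapD q.+1 n k)).
have ea := subr1K a; have ec := subr1K c.
have h1 : a - 1 + c = l by lia.
have h2 : a + (c - 1) = l by lia.
rewrite (tensC_dif_pure CE (bar_tens_complex CE hP q) e e0 ea ec h1 h2) bar_tens_mapD.
rewrite (add_map_ksgn _ (@bar_tens_mapD q.+1 n l)) !bar_tens_map_pure.
rewrite (tensC_dif_pure CE' (bar_tens_complex CE' hP' q) e e0 ea ec h1 h2).
by rewrite IH jd.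
Qed.

Lemma bar_tens_map_act q m n (a b c : int) (e : a + b = c) (x : bar_tens Phi q m a)
    (f : mor E m n b) :
  @bar_tens_map _ _ _ _ j th q n c (bar_tens_act e x f) =
  bar_tens_act e (@bar_tens_map _ _ _ _ j th q m a x) (j f).
Proof.
case: q x => [|q]; first by move=> x; exact: thA.
apply: tens_ext => [||l d g e0 x h].
- exact: (add_map_comp (@bar_tens_mapD q.+1 n c)
    (@bar_tens_act_addl _ _ CE hP q.+1 m n a b c e f)).
- exact: (add_map_comp (@bar_tens_act_addl _ _ CE' hP' q.+1 m n a b c e _)
    (@bar_tens_mapD q.+1 m a)).
have h1 : d + (g + b) = c by rewrite addrA e0.
rewrite [bar_tens_act e (tpure e0 x h : bar_tens Phi q.+1 m a) f](tens_act_pure CE e e0 erefl h1).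
rewrite !bar_tens_map_pure [RHS](tens_act_pure CE' e e0 erefl h1).
by rewrite (cmap_comp hj).
Qed.

Lemma bar_tens_map_bnd q n (i k : int) (e : i = k) (x : bar_tens Phi q.+1 n i) :
  @bar_tens_map _ _ _ _ j th q n k (bar_bnd e x) =
  bar_bnd e (@bar_tens_map _ _ _ _ j th q.+1 n i x).
Proof.
elim: q n i k e x => [|q IH] n i k e; apply: tens_ext.
- exact: (add_map_comp (@bar_tens_mapD 0 n k) (@bar_bndD _ _ CE hP 0 n i k e)).
- exact: (add_map_comp (@bar_bndD _ _ CE' hP' 0 n i k e) (@bar_tens_mapD 1 n i)).
- move=> m a c e0 x f; have h : a + c = k by rewrite e0.
  rewrite (bar_bnd0_pure CE hP e e0 h) bar_tens_map_pure.
  by rewrite (bar_bnd0_pure CE' hP' e e0 h) bar_tens_map_act.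
- exact: (add_map_comp (@bar_tens_mapD q.+1 n k) (@bar_bndD _ _ CE hP q.+1 n i k e)).
- exact: (add_map_comp (@bar_bndD _ _ CE' hP' q.+1 n i k e) (@bar_tens_mapD q.+2 n i)).
move=> m a c e0 x f; have h : a + c = k by rewrite e0.
rewrite (bar_bnd_pure CE hP e e0 h) [@bar_tens_map _ _ _ _ j th q.+2 _ _ _]bar_tens_map_pure.
rewrite (bar_bnd_pure CE' hP' e e0 h) bar_tens_mapD bar_tens_map_pure IH.
by rewrite (add_map_ksgn _ (@bar_tens_mapD q.+1 n k)) bar_tens_map_act.
Qed.

Lemma bar_map_compD m t p : add_map (fun c : bar_tens Phi p.+1 m (t - p%:Z) =>
  dinj p (@bar_tens_map _ _ _ _ j th p.+1 m (t - p%:Z) c) : bar Phi' m t).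
Proof. by move=> x y; rewrite bar_tens_mapD dinjD. Qed.

Lemma bar_mapD m t : add_map (@bar_map _ _ _ _ j th m t).
Proof. exact: (dliftD (@bar_map_compD m t)). Qed.

Lemma bar_map_inj m t p (c : bar_tens Phi p.+1 m (t - p%:Z)) :
  bar_map j th (dinj p c : bar Phi m t) =
  dinj p (@bar_tens_map _ _ _ _ j th p.+1 m (t - p%:Z) c).
Proof.
apply: (@dlift_inj _ _ (fun p (c : bar_tens Phi p.+1 m (t - p%:Z)) =>
  dinj p (@bar_tens_map _ _ _ _ j th p.+1 m (t - p%:Z) c) : bar Phi' m t)) => k.
exact: (add_map0 (@bar_map_compD m t k)).
Qed.

Lemma bar_map_chain m : chain_map (@bar_map _ _ _ _ j th m).
Proof.
split=> [i|i k e x]; first exact: bar_mapD.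
move: x; apply: dsum_ext => [||p b].
- exact: (add_map_comp (@bar_mapD m k) (@bar_difD _ _ CE hP m i k e)).
- exact: (add_map_comp (@bar_difD _ _ CE' hP' m i k e) (@bar_mapD m i)).
rewrite (bar_dif_inj CE hP) bar_mapD !bar_map_inj (bar_dif_inj CE' hP').
rewrite (add_map_ksgn _ (@bar_tens_mapD _ _ _)) bar_tens_map_dif; congr (_ + _).
case: p b => [|p] b; rewrite ![bar_lower _ _]/=; first exact: (add_map0 (@bar_mapD m k)).
by rewrite bar_map_inj bar_tens_map_bnd.
Qed.

Lemma bar_map_act m n (a b c : int) (e : a + b = c) (x : bar Phi m a) (f : mor E m n b) :
  bar_map j th (act e x f) = act e (bar_map j th x) (j f).
Proof.
move: x; apply: dsum_ext => [||p y].
- exact: (add_map_comp (@bar_mapD n c) (bar_act_addl CE hP e f)).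
- exact: (add_map_comp (bar_act_addl CE' hP' e _) (@bar_mapD m a)).
rewrite (bar_act_inj CE hP) !bar_map_inj (bar_act_inj CE' hP'); congr dinj.
exact: (@bar_tens_map_act p.+1).
Qed.

Lemma bar_contraction_compat :
  contraction_compat th (bar_map j th) (bar_contraction Phi) (bar_contraction Phi').
Proof.
split=> [m i x|m i k e y].
  apply: (etrans (bar_map_inj _)); congr dinj.
  by rewrite bar_tens_map_pure (cmap_id hj).
move: y; apply: dsum_ext => [||p b].
- exact: (add_map_comp (@bar_mapD m k) (@bar_htpD _ Phi m i k e)).
- exact: (add_map_comp (@bar_htpD _ Phi' m i k e) (@bar_mapD m i)).
rewrite bar_htp_inj !bar_map_inj bar_htp_inj; congr dinj.
by rewrite (add_map_ksgn _ (@bar_tens_mapD _ _ _)) bar_tens_map_pure (cmap_id hj).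
Qed.
End BarNatural.

(** * Assembly *)

Lemma ainf_dgcat (E : ainf_prop) : is_dgcat E.
Proof. exact: (prop_dgcat (dgpropP E)). Qed.

Lemma natural_amul_natural (E : ainf_prop) (Phi Phi' : fun_data E) (th : fmap Phi Phi') :
  natural_transf th -> amul_natural th.
Proof. by case=> thC thA; split. Qed.

Lemma bar_map_amul_natural (E E' : ainf_prop) (Phi : fun_data E) (Phi' : fun_data E')
    (j : cmap E E') (th : fmap Phi Phi') :
  is_dgfun Phi -> is_dgfun Phi' -> is_dgfunctor j ->
  (forall m n k (f : mor Ainf m n k), amul E' f = j m n k (amul E f)) ->
  (forall m, chain_map (th m)) ->
  (forall m n (a b c : int) (e : a + b = c) (x : Phi m a) (f : mor E m n b),
    th n c (act e x f) = act e (th m a x) (j m n b f)) ->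
  amul_natural (bar_map j th).
Proof.
move=> hP hP' hj hja thC thA; split=> [m|m n a b c e x f].
  exact: (bar_map_chain (ainf_dgcat E) hP (ainf_dgcat E') hP' hj thC thA).
rewrite hja.
exact: (bar_map_act (ainf_dgcat E) hP (ainf_dgcat E') hP' hj thC thA).
Qed.

Lemma id_cmap_dgfunctor (E : dgcat_data) : is_dgfunctor (@id_cmap E).
Proof. by split. Qed.

Lemma bar_aug_amul_natural (E : ainf_prop) (Phi : dgfun E) : amul_natural (@bar_aug E Phi).
Proof.
by apply: natural_amul_natural; apply: bar_aug_natural; [exact: ainf_dgcat | exact: dgfunP].
Qed.

Theorem proposition5p9 :
  exists beta : forall (E : ainf_prop) (Phi : dgfun E) (n m : nat),
      gmap (hoch_iter n Phi m) (hoch_iter n (bar Phi) m),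
    [/\ (forall (E : ainf_prop) (Phi : dgfun E) (n m : nat),
           quasi_iso (beta E Phi n m)),
        (forall (E : ainf_prop) (Phi Phi' : dgfun E) (th : fmap Phi Phi'),
           natural_transf th ->
           forall (n m : nat) (t : int) (x : hoch_iter n Phi m t),
             hoch_iter_map n (bar_map (@id_cmap E) th) m t (beta E Phi n m t x) =
             beta E Phi' n m t (hoch_iter_map n th m t x)),
        (forall (E E' : ainf_prop) (j : cmap E E') (hj : is_dgfunctor j),
           (forall (m n : nat) (k : int) (f : mor Ainf m n k),
              amul E' f = j m n k (amul E f)) ->
           forall (Phi : dgfun E') (n m : nat) (t : int)
                  (x : hoch_iter n (restr hj Phi) m t),
             hoch_iter_map n (bar_map j (@restr_id E E' j Phi)) m t
               (beta E (restr hj Phi) n m t x) =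
             beta E' Phi n m t (hoch_iter_map n (@restr_id E E' j Phi) m t x)) &
        (forall (E : ainf_prop) (Phi : dgfun E) (n m : nat) (t : int)
                (x : hoch_iter n Phi m t),
           hoch_iter_map n (@bar_aug E Phi) m t (beta E Phi n m t x) = x)].
Proof.
have barP (E : ainf_prop) (Phi : dgfun E) : is_dgfun (bar Phi).
  exact: (bar_is_dgfun (ainf_dgcat E) (dgfunP Phi)).
have barC (E : ainf_prop) (Phi : dgfun E) := bar_is_contraction (ainf_dgcat E) (dgfunP Phi).
have augN := bar_aug_amul_natural.
have iterC (E : ainf_prop) (Phi : dgfun E) n :=
  hoch_iter_is_contraction n (dgfunP Phi) (barP E Phi) (augN E Phi) (barC E Phi).
(* The map is the inclusion of the contraction obtained from the bar contraction by n
   perturbations. *)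
exists (fun E Phi n m => cinc (hoch_iter_contraction (bar_contraction Phi) n) m); split.
- move=> E Phi n m.
  apply: (contraction_quasi_iso _ _ _ (iterC E Phi n)).
  + exact: (fob_complex (hoch_iter_is_dgfun n (dgfunP Phi))).
  + exact: (fob_complex (hoch_iter_is_dgfun n (barP E Phi))).
  + exact: (an_chain (hoch_iter_map_natural n (barP E Phi) (dgfunP Phi) (augN E Phi))).
- move=> E Phi Phi' th hth n m t x.
  have [thC thA] := hth; have CE := ainf_dgcat E.
  have cc := bar_contraction_compat (id_cmap_dgfunctor E) thC.
  have bN : amul_natural (bar_map (@id_cmap E) th).
    by apply: bar_map_amul_natural => //; exact: dgfunP.
  exact: (proj1 (hoch_iter_compat n (dgfunP Phi) (barP E Phi) (dgfunP Phi') (barP E Phi')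
    (natural_amul_natural hth) bN (augN E Phi) (augN E Phi') (barC E Phi) (barC E Phi') cc)).
- move=> E E' j hj hja Phi n m t x.
  have thC k : chain_map (@restr_id E E' j Phi k) by [].
  have cc := bar_contraction_compat hj thC.
  have bN : amul_natural (bar_map j (@restr_id E E' j Phi)).
    by apply: bar_map_amul_natural => //; exact: (dgfunP (restr hj Phi)) || exact: dgfunP.
  (* On values this is the identity; it is compatible with the actions of A_infinity precisely
     because i' = j i. *)
  have rN : amul_natural (@restr_id E E' j Phi).
    by split=> // k l a b c e y f; rewrite hja.
  exact: (proj1 (hoch_iter_compat n (dgfunP (restr hj Phi)) (barP E (restr hj Phi)) (dgfunP Phi)
    (barP E' Phi) rN bN (augN E (restr hj Phi)) (augN E' Phi) (barC E (restr hj Phi))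
    (barC E' Phi) cc)).
- by move=> E Phi n m t x; exact: (cinc_section (iterC E Phi n)).
Qed.
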